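(* Let $\Omega_1,\Omega_2\subset\mathbb{R}^n$ be open, let $f:\Omega_1\to\Omega_2$ be a homeomorphism in $W^{1,1}_{\mathrm{loc}}(\Omega_1,\mathbb{R}^n)$, and let $K>0$. Then the condition $$|Df|(f^{-1}(A))\le K\,\mathcal{L}^n(A)\quad\text{for all Borel sets } A\subset\Omega_2$$ is equivalent to $$|Df(x)|\le K\,|J_f(x)|\quad\text{for a.e. } x\in\Omega_1.$$
   Context: $\mathcal{L}^n$ is Lebesgue measure on $\mathbb{R}^n$. For $f\in W^{1,1}_{\mathrm{loc}}$, $Df(x)$ is the weak derivative matrix, $J_f=\det Df$ is the Jacobian, and $|Df|(E)=\int_E|Df(x)|\,dx$ is the total variation measure of the distributional derivative. *)

(* Defs.v *)
From HB Require Import structures.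
From mathcomp Require Import all_boot all_order all_algebra.
From mathcomp Require Import all_classical all_reals all_analysis measurable_realfun.

Set Implicit Arguments.
Unset Strict Implicit.
Unset Printing Implicit Defensive.

Import Order.TTheory GRing.Theory Num.Theory.
Import numFieldNormedType.Exports.

Local Open Scope classical_set_scope.
Local Open Scope ring_scope.

(* 'M[R]_(m, n), hence R^n = 'rV[R]_n, carries its Borel sigma-algebra. *)
Section borel_matrix.
Context (R : realType) (m n : nat).

Definition borel_mx : set (set 'M[R]_(m, n)) := <<s open >>.

Let borel_mx0 : borel_mx set0. Proof. exact: sigma_algebra0. Qed.

Let borel_mxC A : borel_mx A -> borel_mx (~` A).
Proof. exact: sigma_algebraC. Qed.

Let borel_mx_bigcup (F : (set 'M[R]_(m, n))^nat) :
  (forall i, borel_mx (F i)) -> borel_mx (\bigcup_i F i).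
Proof. exact: sigma_algebra_bigcup. Qed.

HB.instance Definition _ :=
  @isMeasurable.Build default_measure_display 'M[R]_(m, n)
    borel_mx borel_mx0 borel_mxC borel_mx_bigcup.

End borel_matrix.

Section lebesgue_Rn.
Context (R : realType).

Lemma open_measurable_mx m n (U : set 'M[R]_(m, n)) : open U -> measurable U.
Proof. by move=> oU; apply: sub_sigma_algebra. Qed.

Definition consv n (p : R * 'rV[R]_n) : 'rV[R]_n.+1 :=
  \row_i (if unlift ord0 i is Some j then p.2 ord0 j else p.1).

Definition unconsv n (v : 'rV[R]_n.+1) : R * 'rV[R]_n :=
  (v ord0 ord0, \row_j v ord0 (lift ord0 j)).

Lemma consvK n : cancel (@consv n) (@unconsv n).
Proof.
case=> x v; rewrite /unconsv /consv /=; congr (_, _).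
  by rewrite mxE unlift_none.
by apply/rowP => j; rewrite !mxE liftK.
Qed.

Lemma open_bigcup_rat_ball m n (U : set 'M[R]_(m, n)) : open U ->
  U = \bigcup_(p in [set p : 'M[rat]_(m, n) * nat |
         ball (map_mx ratr p.1 : 'M[R]_(m, n)) (p.2.+1%:R^-1 : R) `<=` U])
      ball (map_mx ratr p.1 : 'M[R]_(m, n)) (p.2.+1%:R^-1 : R).
Proof.
move=> oU; apply/seteqP; split=> [x Ux|x [p /= pU]]; last exact: pU.
have /nbhs_ballP[e /= e0 xeU] : nbhs x U by apply: open_nbhs_nbhs; split.
have [k ke] : exists k, (k.+1%:R^-1 : R) < e / 2.
  have [k] := @ltr_add_invr R 0 (e / 2) (divr_gt0 e0 (ltr0Sn _ 1)).
  by rewrite add0r => ke; exists k.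
have k0 : 0 < (k.+1%:R^-1 : R) by rewrite invr_gt0.
have xr i j : exists q : rat, `|x i j - ratr q| < (k.+1%:R^-1 : R).
  have /rat_in_itvoo[q] : x i j - k.+1%:R^-1 < x i j + k.+1%:R^-1.
    by rewrite ltrBlDr -addrA ltrDl addr_gt0.
  rewrite in_itv /= => /andP[q1 q2]; exists q.
  by rewrite ltr_distlC q1 q2.
pose q := \matrix_(i, j) projT1 (cid (xr i j)) : 'M[rat]_(m, n).
have qx : ball (map_mx ratr q : 'M[R]_(m, n)) (k.+1%:R^-1 : R) x.
  split=> // i j; rewrite !mxE /ball /= distrC.
  exact: (projT2 (cid (xr i j))).
exists (q, k) => //= y qy; apply: xeU.
rewrite [e]splitr; apply: (@ball_triangle _ _ (map_mx ratr q : 'M[R]_(m, n))).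
  by apply: ball_sym; apply: le_ball qx; exact: ltW.
by apply: le_ball qy; exact: ltW.
Qed.

Lemma measurable_consv n : measurable_fun setT (@consv n).
Proof.
apply: (measurability (@open 'rV[R]_n.+1)) => // _ [U oU <-]; rewrite setTI.
rewrite (open_bigcup_rat_ball oU) bigcup_mkcond preimage_bigcup.
apply: countable_bigcupT_measurable => [|[q k]]; first exact: countableP.
case: ifPn => _; last by rewrite preimage_set0.
rewrite /=.
set r := k.+1%:R^-1.
set c : 'rV[R]_n.+1 := map_mx ratr q.
suff -> : @consv n @^-1` ball c r = ball (unconsv c).1 r `*` ball (unconsv c).2 r.
  apply: measurableX; first by apply: open_measurable; exact: ball_open.
  by apply: open_measurable_mx; exact: ball_open.
apply/seteqP; split=> -[x v] /=.
- move=> [r0 cr]; split.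
    by have := cr ord0 ord0; rewrite [consv _ _ _]mxE unlift_none.
  split=> // i j; have := cr i (lift ord0 j).
  by rewrite [consv _ _ _]mxE liftK /= mxE !ord1.
- move=> [cx [r0 cv]]; split=> // i j; rewrite [consv _ _ _]mxE ord1.
  case: unliftP => [j'|] ->//.
  by have := cv ord0 j'; rewrite mxE.
Qed.

Lemma measurable_coord m n (i : 'I_m) (j : 'I_n) :
  measurable_fun setT (fun A : 'M[R]_(m, n) => A i j).
Proof.
apply: (measurability _ (RGenOpens.measurableE R)).
move=> _ [_ [a [b ->] <-]]; rewrite setTI; apply: open_measurable_mx.
by apply: open_comp => [x _|]; [exact: coord_continuous|exact: interval_open].
Qed.

Lemma measurable_unconsv n : measurable_fun setT (@unconsv n).
Proof.
apply: measurable_fun_pair; first exact: measurable_coord.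
apply: (measurability (@open 'rV[R]_n)) => // _ [U oU <-]; rewrite setTI.
apply: open_measurable_mx; apply: open_comp => // v _.
move=> B /nbhs_ballP[e /= e0 vB]; apply/nbhs_ballP; exists e => //= w [_ vw].
by apply: vB; split=> // i j; rewrite !mxE; exact: vw.
Qed.

Section lebesgue_step.
Variables (n : nat) (mu : {sigma_finite_measure set 'rV[R]_n -> \bar R}).

Definition lebesgue_step : set 'rV[R]_n.+1 -> \bar R :=
  pushforward (@lebesgue_measure R \x mu)%E (@consv n).

Let pm : {measure set 'rV[R]_n.+1 -> \bar R} :=
  measure_function_pushforward__canonical__measure_function_Measure
    (@lebesgue_measure R \x mu)%E (@measurable_consv n).

Let step_ge0 A : (0 <= lebesgue_step A)%E. Proof. exact: (measure_ge0 pm). Qed.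

HB.instance Definition _ := isMeasure.Build _ _ _ lebesgue_step
  (measure0 pm) step_ge0 (@measure_semi_sigma_additive _ _ _ pm).

Let step_sigma_finite : sigma_finite setT lebesgue_step.
Proof.
have [F FT Foo] : sigma_finite setT (@lebesgue_measure R \x mu)%E :=
  isSigmaFinite.sigma_finiteT
    (lebesgue_integral_fubini.measure_function_Measure_isSigmaFinite__to__measure_function_isSigmaFinite
       _ mu).
exists (fun k => @unconsv n @^-1` F k).
  by rewrite -preimage_bigcup -FT preimage_setT.
move=> k; have [mF Fk] := Foo k; split.
  by rewrite -[X in measurable X]setTI; exact: measurable_unconsv.
rewrite /lebesgue_step /pushforward -comp_preimage.
by rewrite (_ : _ \o _ = id)// funeqE => p; exact: consvK.
Qed.

HB.instance Definition _ := Measure_isSigmaFinite.Build _ _ _ lebesgue_step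
  step_sigma_finite.

End lebesgue_step.

(* Lebesgue measure on the Borel sets of R^n, as the n-fold product of the
   one-dimensional one transported along [consv]; its value on boxes is
   [lebesgue_Rn_box]. *)
Fixpoint lebesgue_Rn n : {sigma_finite_measure set 'rV[R]_n -> \bar R} :=
  match n with
  | 0 => @dirac _ 'rV[R]_0 0 R
  | m.+1 => lebesgue_step (lebesgue_Rn m)
  end.

Lemma lebesgue_Rn_box n (a b : 'rV[R]_n) :
  (forall i, a ord0 i <= b ord0 i) ->
  lebesgue_Rn n [set v : 'rV[R]_n | forall i, a ord0 i <= v ord0 i <= b ord0 i] =
  (\prod_i (b ord0 i - a ord0 i))%:E.
Proof.
elim: n a b => [|n IHn] a b ab.
  by rewrite big_ord0 /= diracE mem_set//= => -[].
rewrite big_ord_recl EFinM -[in RHS]/(unconsv a).1 -[in RHS]/(unconsv b).1.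
pose a' := (unconsv a).2; pose b' := (unconsv b).2.
have -> : \prod_(i < n) (b ord0 (lift ord0 i) - a ord0 (lift ord0 i)) =
    \prod_i (b' ord0 i - a' ord0 i) by apply: eq_bigr => i _; rewrite !mxE.
rewrite -IHn => [|i]; last by rewrite !mxE.
set B := [set v : 'rV[R]_n | forall i, a' ord0 i <= v ord0 i <= b' ord0 i].
have mB : measurable B.
  have -> : B = \bigcap_i ((fun v : 'rV[R]_n => v ord0 i) @^-1` `[a' ord0 i, b' ord0 i]).
    apply/seteqP; split=> v /= vB i; last by have := vB i I; rewrite /= in_itv.
    by move=> _; rewrite /= in_itv; exact: vB.
  apply: fin_bigcap_measurable => // i _.
  by rewrite -[X in measurable X]setTI; apply: measurable_coord.
rewrite /= /lebesgue_step /pushforward.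
have lI : lebesgue_measure `[a ord0 ord0, b ord0 ord0] =
    (b ord0 ord0 - a ord0 ord0)%:E.
  rewrite lebesgue_measure_itv /= lte_fin; case: ltgtP (ab ord0) => // ->.
  by rewrite subrr.
rewrite -lI -product_measure1E//; congr (_ _).
apply/seteqP; split=> -[x v] /=.
- move=> H; split=> [|i].
    by have := H ord0; rewrite in_itv mxE unlift_none.
  by have := H (lift ord0 i); rewrite !mxE liftK.
- rewrite in_itv /= => -[Hx Hv] i; rewrite mxE.
  case: unliftP => [j|] ->//.
  by have := Hv j; rewrite !mxE.
Qed.

End lebesgue_Rn.

Section sobolev.
Context (R : realType) (n : nat).
Implicit Types (Omega : set 'rV[R]_n) (f : 'rV[R]_n -> 'rV[R]_n)
  (Df : 'rV[R]_n -> 'M[R]_n) (phi u : 'rV[R]_n -> R).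

Local Notation mu := (lebesgue_Rn R n).

Definition homeo_onto Omega1 Omega2 f :=
  [/\ set_bij Omega1 Omega2 f, {within Omega1, continuous f} &
      exists2 g : 'rV[R]_n -> 'rV[R]_n,
        {within Omega2, continuous g} &
        forall x, Omega1 x -> g (f x) = x].

Definition partial_deriv (j : 'I_n) phi : 'rV[R]_n -> R :=
  fun x => 'D_(delta_mx ord0 j) phi x.

Fixpoint Ck (k : nat) phi : Prop :=
  if k is k'.+1 then
    continuous phi /\
    forall j, (forall x, derivable phi x (delta_mx ord0 j)) /\
              Ck k' (partial_deriv j phi)
  else continuous phi.

(* test functions on Omega, extended by 0 to the whole space *)
Definition test_function Omega phi :=
  [/\ forall k, Ck k phi,
      compact (closure [set x | phi x != 0]) &
      closure [set x | phi x != 0] `<=` Omega].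

Definition L1loc Omega u :=
  measurable_fun Omega u /\
  forall K, K `<=` Omega -> compact K -> mu.-integrable K (EFin \o u).

(* Entry (i, j) of [Df x] is the weak derivative of the i-th component of f
   in the direction j. Weak derivatives are only determined almost everywhere;
   [Df] is a Borel representative. *)
Definition weak_derivative Omega f Df :=
  forall i j phi, test_function Omega phi ->
    (\int[mu]_(x in Omega) (f x ord0 i * partial_deriv j phi x) =
     - \int[mu]_(x in Omega) (Df x i j * phi x))%R.

Definition W11loc Omega f Df :=
  [/\ forall i, L1loc Omega (fun x => f x ord0 i),
      forall i j, L1loc Omega (fun x => Df x i j) &
      weak_derivative Omega f Df].

(* The norm |Df(x)| may be the operator norm, the Frobenius norm, or any other
   norm on matrices. *)
Definition matrix_norm (N : 'M[R]_n -> R) :=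
  [/\ forall A, N A = 0 -> A = 0,
      forall a A, N (a *: A) = `|a| * N A &
      forall A B, N (A + B) <= N A + N B].

Definition total_variation_measure (N : 'M[R]_n -> R) Df (E : set 'rV[R]_n) : \bar R :=
  (\int[mu]_(x in E) (N (Df x))%:E)%E.

End sobolev.

(* Main.v *)
Require Import Defs.
From HB Require Import structures.
From mathcomp Require Import all_boot all_order all_algebra fingroup perm.
From mathcomp Require Import all_classical all_reals all_analysis.
From mathcomp Require Import measurable_realfun ring lra.

Import Order.TTheory GRing.Theory Num.Theory.
Import numFieldNormedType.Exports.

Local Open Scope classical_set_scope.
Local Open Scope ring_scope.

Set Implicit Arguments.
Unset Strict Implicit.
Unset Printing Implicit Defensive.

(** Write [mu] for Lebesgue measure and [J] for [|det Df|].  Since [f] is a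
    bijection, the condition on the variation compares [\int_E |Df|] with
    [K * mu (f E)] for Borel sets [E], and the theorem follows once [mu (f E)]
    is known to be [\int_E J].  This area formula ([area_formula]) holds for [E]
    disjoint from some null set [Z].  The restriction is harmless.  If
    [|Df| <= K * J] almost everywhere, integrate over the preimage of [A] with
    [Z] removed: the image of this set is contained in [A], and the integral
    does not notice [Z] ([variation_le_of_ae]).  Conversely, test the condition
    on the image of a bounded set, disjoint from [Z], where
    [|Df| >= K * J + d] with [d > 0]: its measure has to vanish
    ([ae_of_variation_le]).

    The area formula rests on a Lipschitz estimate for a continuous function [u]
    with weak derivatives in [L^1_loc].  If all small balls around [x] and
    around [y] give [|Du|] an average of at most [e], then
    [|u x - u y| <= B * e * |x - y|] whenever [x] and [y] are close
    ([good_points_lipschitz]).  Indeed [u x] and [u y] are limits of means of [u]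
    against product mollifiers; the difference of two product mollifiers is a
    telescoping sum of partial derivatives of compactly supported products
    ([mollifier_diff]), so a difference of means at scale [r] is at most [r]
    times an average of [|Du|], and the scales sum up geometrically.  By a
    Vitali covering argument, almost every point with [|Du| < e] has averages at
    most [2 * e] around it ([ae_small_average]).

    For matrices [S] and [T], apply this to the components of [S f - T x], with
    weak derivative [S Df - T].  Where the rows of [S Df - T] are small, the map
    [S f - T x] has small Lipschitz constants on countably many Borel pieces
    ([matrix_pieces]).  Where [Df] is invertible take [T = 1] and [S] a rational
    approximation of the inverse of [Df]: on a piece [S f] is almost an
    isometry, while [|det S| * J] is almost [1], and linear maps multiply measure
    by their determinant ([invertible_piece], [lebesgue_Rn_mulmx_image]).  Where
    [Df] is singular take [T = 0] and for [S] a unipotent rational matrix for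
    which one row of [S Df] is almost zero: one component of [S f] has a tiny
    Lipschitz constant and the others have bounded ones, so the image of the
    piece has tiny measure ([singular_piece], [lipschitz_image_measure]).  There
    are countably many choices of [S], hence of pieces, and summing over them
    gives the area formula up to an arbitrarily small error. *)

(** * Lebesgue measure on product sets and integrals of products *)

Section product_structure.
Context (R : realType).
Local Notation leb := (@lebesgue_measure R).

Lemma measurable_prodset n (A : 'I_n -> set R) :
  (forall i, measurable (A i)) ->
  measurable [set v : 'rV[R]_n | forall i, A i (v ord0 i)].
Proof.
move=> mA.
have -> : [set v : 'rV[R]_n | forall i, A i (v ord0 i)] =
    \bigcap_i ((fun v : 'rV[R]_n => v ord0 i) @^-1` A i).
  by apply/seteqP; split=> v /= vA i; [move=> _|]; exact: vA.
apply: fin_bigcap_measurable => // i _.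
by rewrite -[X in measurable X]setTI; apply: measurable_coord.
Qed.

Lemma lebesgue_Rn_prodset n (A : 'I_n -> set R) :
  (forall i, measurable (A i)) ->
  lebesgue_Rn R n [set v : 'rV[R]_n | forall i, A i (v ord0 i)] =
  (\prod_i leb (A i))%E.
Proof.
elim: n A => [|n IHn] A mA.
  by rewrite big_ord0 /= diracE mem_set//= => -[].
rewrite big_ord_recl -IHn //.
rewrite /= /lebesgue_step /pushforward -product_measure1E//; last 2 first.
  exact: mA.
  by apply: (measurable_prodset (A := fun i => A (lift ord0 i))).
congr (_ _); apply/seteqP; split=> -[x v] /=.
- move=> H; split=> [|i].
    by have := H ord0; rewrite mxE unlift_none.
  by have := H (lift ord0 i); rewrite !mxE liftK.
- move=> -[Hx Hv] i; rewrite mxE.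
  by case: unliftP => [j|] ->//.
Qed.

Lemma measurable_row_prod n (p : 'I_n -> R -> R) :
  (forall i, measurable_fun setT (p i)) ->
  measurable_fun setT (fun v : 'rV[R]_n => \prod_i p i (v ord0 i)).
Proof.
move=> mp; apply: measurable_prod => i _.
by apply: measurableT_comp => //; exact: measurable_coord.
Qed.

Lemma prod_consv n (p : 'I_n.+1 -> R -> R) x (v : 'rV[R]_n) :
  \prod_i p i (consv (x, v) ord0 i) =
  p ord0 x * \prod_i p (lift ord0 i) (v ord0 i).
Proof.
rewrite big_ord_recl mxE unlift_none; congr (_ * _).
by apply: eq_bigr => i _; rewrite mxE liftK.
Qed.

(** Induction on the dimension by Fubini, which needs integrability of the lower
    dimensional product together with the value of its integral. *)
Lemma integrable_row_prod n (p : 'I_n -> R -> R) :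
  (forall i, leb.-integrable setT (EFin \o p i)) ->
  (lebesgue_Rn R n).-integrable setT
     (fun v : 'rV[R]_n => (\prod_i p i (v ord0 i))%:E) /\
  (\int[lebesgue_Rn R n]_v (\prod_i p i (v ord0 i))%:E =
   (\prod_i \int[leb]_x p i x)%R%:E)%E.
Proof.
elim: n p => [|n IHn] p ip.
  have -> : (fun v : 'rV[R]_0 => (\prod_i p i (v ord0 i))%:E) = cst 1%:E.
    by apply/funext => v; rewrite big_ord0.
  rewrite /= integral_dirac// diracT mul1e big_ord0; split=> //.
  by apply: (@finite_measure_integrable_cst _ _ R (\d_(0 : 'rV[R]_0))%R).
have mp i : measurable_fun setT (p i).
  by apply/measurable_EFinP; exact: measurable_int (ip i).
have [iq eq] := IHn (fun i => p (lift ord0 i)) (fun i => ip _).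
have mF : measurable_fun setT (fun z : R * 'rV[R]_n =>
     (\prod_i p i (consv z ord0 i))%:E).
  apply/measurable_EFinP.
  exact: (measurableT_comp (measurable_row_prod mp) (@measurable_consv R n)).
have iF : (leb \x lebesgue_Rn R n)%E.-integrable setT (fun z : R * 'rV[R]_n =>
     (\prod_i p i (consv z ord0 i))%:E).
  apply/integrable12ltyP => //.
  have abs_eq x : (\int[lebesgue_Rn R n]_v `|(\prod_i p i (consv (x, v) ord0 i))%:E| =
      `|(p ord0 x)%:E| * \int[lebesgue_Rn R n]_v
         `|(\prod_i p (lift ord0 i) (v ord0 i))%:E|)%E.
    under eq_integral => v _ do rewrite prod_consv EFinM abseM.
    rewrite ge0_integralZl//.
    exact: (measurable_int _ (integrable_abse iq)).
  under eq_integral => x _ do rewrite abs_eq.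
  rewrite ge0_integralZr//; last 2 first.
  - exact: (measurable_int _ (integrable_abse (ip ord0))).
  - exact: integral_ge0.
  have /integrableP[_ fp] := ip ord0.
  have /integrableP[_ fq] := iq.
  by rewrite lte_mul_pinfty// ?ge0_fin_numE// ?integral_ge0.
have mG : measurable_fun setT (fun v : 'rV[R]_n.+1 => (\prod_i p i (v ord0 i))%:E).
  by apply/measurable_EFinP; exact: measurable_row_prod.
have iG : (leb \x lebesgue_Rn R n)%E.-integrable (@consv R n @^-1` setT)
    ((fun v : 'rV[R]_n.+1 => (\prod_i p i (v ord0 i))%:E) \o @consv R n).
  by rewrite preimage_setT.
have mc : measurable_fun
    [set: (g_sigma_algebraType (R.-ocitv.-measurable) * 'rV[R]_n)%type] (@consv R n).
  exact: (@measurable_consv R n).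
split; first exact: (integrable_pushforward mc mG iG).
have -> := integral_pushforward mc mG iG measurableT.
rewrite preimage_setT -integral12_prod_meas1//.
rewrite /fubini_F /=.
have int_eq x : (\int[lebesgue_Rn R n]_v (\prod_i p i (consv (x, v) ord0 i))%:E =
    (p ord0 x)%:E * (\prod_i \int[leb]_x p (lift ord0 i) x)%R%:E)%E.
  under eq_integral => v _ do rewrite prod_consv EFinM.
  by rewrite integralZl// eq.
under eq_integral => x _ do rewrite int_eq.
rewrite integralZr//; last exact: ip.
rewrite big_ord_recl EFinM; congr (_ * _)%E.
by rewrite /Rintegral fineK//; apply: integrable_fin_num => //; exact: ip.
Qed.
End product_structure.

(** * Outer regularity *)

Section outer_regularity.
Context (R : realType) (n : nat).
Local Notation T := 'rV[R]_n.

Lemma closed_measurable_mx (C : set T) : closed C -> measurable C.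
Proof.
move=> cC; rewrite -[C]setCK; apply: measurableC; apply: open_measurable_mx.
exact: closed_openC.
Qed.

(** The points of [O] at distance at least [e] from its complement, written as a
    complement of balls so as to be visibly closed. *)
Definition shrink (O : set T) (e : R) : set T :=
  ~` \bigcup_(y in ~` O) ball y e.

Lemma closed_shrink O e : closed (shrink O e).
Proof. by apply/open_closedC/bigcup_open => y _; exact: ball_open. Qed.

Lemma shrink_sub O e : 0 < e -> shrink O e `<=` O.
Proof.
move=> e0 x Ox; apply: contrapT => nOx; apply: Ox; exists x => //.
exact: ballxx.
Qed.

Lemma shrinkS O e d : d <= e -> shrink O e `<=` shrink O d.
Proof.
move=> de x Ox [y nOy yx]; apply: Ox; exists y => //; exact: le_ball yx.
Qed.

Lemma shrinkP O e x : shrink O e x <-> ball x e `<=` O.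
Proof.
split=> [Ox y xy|xO [y nOy yx]].
  by apply: contrapT => nOy; apply: Ox; exists y => //; exact: ball_sym.
by apply/nOy/xO/ball_sym.
Qed.

Lemma bigcup_shrink O : open O -> \bigcup_k shrink O k.+1%:R^-1 = O.
Proof.
move=> oO; apply/seteqP; split=> [x [k _]|x Ox]; first exact: shrink_sub.
have /nbhs_ballP[e /= e0 xeO] : nbhs x O by apply: open_nbhs_nbhs; split.
have [k] := @ltr_add_invr R 0 e e0; rewrite add0r => ke.
exists k => //; apply/shrinkP; apply: subset_trans xeO.
exact/le_ball/ltW.
Qed.

Lemma measure_cap0_small (m : {measure set T -> \bar R}) (F : (set T)^nat) (e : R) :
  (m setT < +oo)%E -> (forall k, measurable (F k)) ->
  {homo F : i j / (i <= j)%N >-> j `<=` i} -> \bigcap_k F k = set0 -> 0 < e ->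
  exists k, (m (F k) < e%:E)%E.
Proof.
move=> mT mF F_ndc F0 e0.
have F_cvg : m (F k) @[k --> \oo] --> m (\bigcap_k F k).
  apply: nonincreasing_cvg_mu => //.
  - by apply: le_lt_trans mT; apply: le_measure; rewrite ?inE.
  - exact: bigcapT_measurable.
  - by move=> i j ij; apply/subsetPset; exact: F_ndc.
move: F_cvg; rewrite F0 measure0 => /fine_cvgP[[N1 _ fF]] /cvgrPdist_lt/(_ _ e0)[N2 _ NF].
exists (maxn N1 N2).
have := NF (maxn N1 N2) (leq_maxr _ _).
rewrite /= sub0r normrN => lt_e.
have /fineK <- := fF (maxn N1 N2) (leq_maxl _ _).
by rewrite lte_fin (le_lt_trans (ler_norm _)).
Qed.

Variables (m : {measure set T -> \bar R}) (mT : (m setT < +oo)%E).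

(** Asking for a closed set inside as well as an open set outside is what makes
    the class stable under complement. *)
Definition squeezed (E : set T) := forall e : R, 0 < e ->
  exists U C, [/\ open U, closed C, C `<=` E, E `<=` U & (m (U `\` C) < e%:E)%E].

Lemma squeezed_open O : open O -> squeezed O.
Proof.
move=> oO e e0.
have [|||k ke] := @measure_cap0_small m (fun k => O `\` shrink O k.+1%:R^-1) e mT _ _ _ e0.
- by move=> k; apply: measurableD; [exact: open_measurable_mx|
    apply: closed_measurable_mx; exact: closed_shrink].
- move=> i j ij x [Ox nx]; split=> // /shrinkS; apply: contra_not nx; apply.
  by rewrite lef_pV2 ?posrE// ler_nat.
- apply/seteqP; split=> // x Hx.
  have [Ox _] := Hx 0%N I.
  by move: (Ox); rewrite -(bigcup_shrink oO) => -[k _ Hk]; have [] := Hx k I.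
exists O, (shrink O k.+1%:R^-1); split=> //; first exact: closed_shrink.
exact: shrink_sub.
Qed.

(** A countable union of closed sets need not be closed; since [m] is finite, a
    finite part of the union carries all but [e / 2] of its measure. *)
Lemma squeezed_sigma_algebra : sigma_algebra setT squeezed.
Proof.
split.
- by apply: squeezed_open; exact: open0.
- move=> E sE e e0; have [U [C [oU cC CE EU UC]]] := sE e e0.
  exists (~` C), (~` U); split.
  + exact: closed_openC.
  + exact: open_closedC.
  + by rewrite setTD; exact: subsetC.
  + by rewrite setTD; exact: subsetC.
  + by rewrite setDE setCK setIC -setDE.
- move=> F sF e e0.
  have e20 i : 0 < e / 2 / (2 ^ i.+1)%:R by rewrite !divr_gt0// ltr0n expn_gt0.
  have /choice[U] : forall i, exists U, exists C, [/\ open U, closed C, C `<=` F i, F i `<=` U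
      & (m (U `\` C) < (e / 2 / (2 ^ i.+1)%:R)%:E)%E].
    by move=> i; exact: sF.
  move=> /choice[C UC].
  have mU i : measurable (U i) by apply: open_measurable_mx; have [] := UC i.
  have mC i : measurable (C i) by apply: closed_measurable_mx; have [] := UC i.
  pose D k := \big[setU/set0]_(i < k) C i.
  have mD k : measurable (D k) by exact: bigsetU_measurable.
  have mV : measurable (\bigcup_i U i) by exact: bigcupT_measurable.
  have mDoo : measurable (\bigcup_i C i) by exact: bigcupT_measurable.
  have small : (m (\bigcup_i U i `\` \bigcup_i C i) <= (e / 2)%:E)%E.
    apply: (@le_trans _ _ (\sum_(0 <= i <oo) m (U i `\` C i))%E).
      apply: measure_sigma_subadditive; [by move=> i; exact: measurableD|exact: measurableD|].
      move=> x [[i _ Ux] nC]; exists i => //; split=> // Cx; apply: nC; by exists i.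
    have := @epsilon_trick R (fun=> 0%E) (e / 2) xpredT (fun=> lexx _) (ltW (divr_gt0 e0 (ltr0Sn R 1))).
    rewrite [X in (_ <= X + _)%E]eseries0// add0e; apply: le_trans.
    apply: lee_nneseries => // i _; rewrite add0e; apply/ltW; by have [] := UC i.
  have [||||k ke] := @measure_cap0_small m (fun k => (\bigcup_i C i) `\` D k) (e / 2) mT.
  + by move=> k; exact: measurableD.
  + move=> i j ij x [Cx nD]; split=> //; apply: contra_not nD.
    rewrite /D -!bigcup_mkord => -[l /= li Cl]; exists l => //=; exact: leq_trans ij.
  + apply/seteqP; split=> // x Hx; have [[l _ Cl] _] := Hx 0%N I.
    have [_] := Hx l.+1 I; apply; rewrite /D -bigcup_mkord; by exists l => /=.
  + by rewrite divr_gt0.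
  exists (\bigcup_i U i), (D k); split.
  + by apply: bigcup_open => i _; have [] := UC i.
  + by apply: closed_bigsetU => i _; have [] := UC i.
  + rewrite /D -bigcup_mkord => x [i /= _ Cx]; exists i => //; have [_ _ + _ _] := UC i; exact.
  + by move=> x [i _ Fx]; exists i => //; have [_ _ _ + _] := UC i; exact.
  + apply: (@le_lt_trans _ _ (m ((\bigcup_i U i `\` \bigcup_i C i) `|` ((\bigcup_i C i) `\` D k)))).
      apply: le_measure; rewrite ?inE; [exact: measurableD|by apply: measurableU; exact: measurableD|].
      move=> x [Ux nD]; have [Cx|nC] := pselect ((\bigcup_i C i) x); by [right|left].
    apply: (le_lt_trans (measureU2 _ _ _)); [exact: measurableD|exact: measurableD|].
    rewrite [e]splitr EFinD lee_ltD// ge0_fin_numE//.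
    exact: le_lt_trans small (ltry _).
Qed.

Lemma outer_regular_finite (E : set T) (e : R) : measurable E -> 0 < e ->
  exists U, [/\ open U, E `<=` U & (m (U `\` E) < e%:E)%E].
Proof.
move=> mE e0; have [U [C [oU cC CE EU UC]]] : exists U C,
    [/\ open U, closed C, C `<=` E, E `<=` U & (m (U `\` C) < e%:E)%E].
  move: e e0; move: E mE.
  by apply: smallest_sub; [exact: squeezed_sigma_algebra|exact: squeezed_open].
exists U; split=> //; apply: le_lt_trans UC; apply: le_measure; rewrite ?inE.
- by apply: measurableD => //; exact: open_measurable_mx.
- by apply: measurableD; [exact: open_measurable_mx|exact: closed_measurable_mx].
- exact: setDS.
Qed.

End outer_regularity.

(** The finite case applies to the restriction of [m] to [V]; it is used with
    Lebesgue measure on balls and with measures [w dx] of finite mass. *)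
Lemma outer_regular (R : realType) n (m : {measure set 'rV[R]_n -> \bar R})
    (V E : set 'rV[R]_n) (e : R) :
  open V -> (m V < +oo)%E -> measurable E -> E `<=` V -> 0 < e ->
  exists U, [/\ open U, E `<=` U, U `<=` V & (m U <= m E + e%:E)%E].
Proof.
move=> oV mV mE EV e0; have meV := open_measurable_mx oV.
have [|U [oU EU UE]] := @outer_regular_finite R n (mrestr m meV) _ E e mE e0.
  by rewrite /= /mrestr setTI.
exists (U `&` V); split=> //; [exact: openI|by move=> x Ex; split; [exact: EU|exact: EV]|].
have meU := open_measurable_mx oU.
apply: (@le_trans _ _ (m (E `|` ((U `\` E) `&` V)))).
  apply: le_measure; rewrite ?inE; [exact: measurableI| |].
    by apply: measurableU => //; apply: measurableI => //; exact: measurableD.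
  by move=> x [Ux Vx]; have [Ex|nEx] := pselect (E x); [left|right].
apply: (le_trans (measureU2 _ _ _)) => //.
  by apply: measurableI => //; exact: measurableD.
by rewrite leeD2l// ltW.
Qed.

(** * Measure of images under coordinatewise Lipschitz maps *)

Lemma coord_mx_le_norm (R : realType) m n (A : 'M[R]_(m, n)) i j : `|A i j| <= `|A|.
Proof.
by rewrite [leRHS]/Num.norm /= mx_normrE; apply/bigmax_geP; right; exists (i, j).
Qed.

Section sup_norm.
Context (R : realType) (n : nat).
Local Notation T := 'rV[R]_n.

Lemma norm_le_coord (v : T) M : 0 <= M -> (forall i, `|v ord0 i| <= M) -> `|v| <= M.
Proof.
move=> M0 vM; rewrite [leLHS]/Num.norm /= mx_normrE; apply/bigmax_leP; split=> //= -[i j] _.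
by rewrite ord1.
Qed.

Lemma ball_prodset (x : T) r : 0 < r ->
  ball x r = [set v : T | forall i, ball (x ord0 i) r (v ord0 i)].
Proof.
move=> r0; apply/seteqP; split=> [v [_ xv] i|v xv]; first exact: xv.
by split=> // i j; rewrite ord1; exact: xv.
Qed.

Lemma measurable_ball_mx (x : T) r : measurable (ball x r).
Proof. by apply: open_measurable_mx; exact: ball_open. Qed.

Lemma lebesgue_Rn_ball (x : T) r : 0 < r ->
  lebesgue_Rn R n (ball x r) = ((r *+ 2) ^+ n)%:E.
Proof.
move=> r0; rewrite ball_prodset//.
rewrite (lebesgue_Rn_prodset (A := fun i => ball (x ord0 i) r)); last first.
  by move=> i; exact: measurable_ball.
under eq_bigr => i _ do rewrite lebesgue_measure_ball ?ltW//.
by rewrite prodEFin prodr_const card_ord.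
Qed.

End sup_norm.

Section grid.
Context (R : realType) (n : nat) (s : R) (s0 : 0 < s).
Local Notation T := 'rV[R]_n.

Definition grid_cell (z : 'rV[int]_n) : set T :=
  [set x | forall i, Num.floor (x ord0 i / s) = z ord0 i].

Lemma grid_cell_itv (z : int) (t : R) :
  (Num.floor (t / s) = z) <-> `[z%:~R * s, (z + 1)%:~R * s[%classic t.
Proof.
rewrite /= in_itv /= -ler_pdivlMr// -ltr_pdivrMr//; split=> [<-|].
  exact: floor_itv.
exact: floor_def.
Qed.

Lemma measurable_grid_cell z : measurable (grid_cell z).
Proof.
rewrite (_ : grid_cell z = [set v : T | forall i,
   `[(z ord0 i)%:~R * s, (z ord0 i + 1)%:~R * s[%classic (v ord0 i)]).
  by apply: (measurable_prodset (A := fun i => `[(z ord0 i)%:~R * s, (z ord0 i + 1)%:~R * s[%classic)).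
by apply/seteqP; split=> v vz i; apply/grid_cell_itv; exact: vz.
Qed.

Lemma lebesgue_Rn_grid_cell z : lebesgue_Rn R n (grid_cell z) = (s ^+ n)%:E.
Proof.
rewrite (_ : grid_cell z = [set v : T | forall i,
   `[(z ord0 i)%:~R * s, (z ord0 i + 1)%:~R * s[%classic (v ord0 i)]); last first.
  by apply/seteqP; split=> v vz i; apply/grid_cell_itv; exact: vz.
rewrite (lebesgue_Rn_prodset (A := fun i => `[(z ord0 i)%:~R * s, (z ord0 i + 1)%:~R * s[%classic))//.
rewrite (eq_bigr (fun=> s%:E)) => [|i _]; first by rewrite prodEFin prodr_const card_ord.
rewrite lebesgue_measure_itv/= lte_fin ltr_pM2r// ltr_int ltzD1 lexx.
by rewrite -EFinD -mulrBl -rmorphB /= addrAC subrr add0r mul1r.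
Qed.

Lemma grid_cell_ball z x y : grid_cell z x -> grid_cell z y -> ball x s y.
Proof.
move=> zx zy; rewrite ball_prodset// => i; rewrite /ball /=.
have := (grid_cell_itv _ _).1 (zx i); have := (grid_cell_itv _ _).1 (zy i).
rewrite /= !in_itv/= intrD mulrDl mul1r => /andP[y1 y2] /andP[x1 x2].
by rewrite ltr_norml; apply/andP; split; lra.
Qed.

Lemma grid_cell_cover x : exists z, grid_cell z x.
Proof. by exists (\row_i Num.floor (x ord0 i / s)) => i; rewrite mxE. Qed.

Lemma grid_cell_inj z z' x : grid_cell z x -> grid_cell z' x -> z = z'.
Proof. by move=> zx zx'; apply/rowP => i; rewrite -zx -zx'. Qed.

End grid.

Section anisotropic_lipschitz.
Context (R : realType) (n : nat).
Local Notation T := 'rV[R]_n.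
Local Notation mu := (lebesgue_Rn R n).

Lemma measure_bigcup_le (m : {measure set T -> \bar R}) (F : (set T)^nat) (M : \bar R) :
  (forall k, measurable (F k)) -> {homo F : i j / (i <= j)%N >-> i `<=` j} ->
  (forall k, (m (F k) <= M)%E) -> (m (\bigcup_k F k) <= M)%E.
Proof.
move=> mF ndF FM.
have /cvg_lim <- // : m (F k) @[k --> \oo] --> m (\bigcup_k F k).
  apply: nondecreasing_cvg_mu => //; first exact: bigcupT_measurable.
  by move=> i j ij; apply/subsetPset; exact: ndF.
apply: lime_le; last exact: nearW.
apply: ereal_nondecreasing_is_cvgn => i j ij.
by apply: le_measure; rewrite ?inE//; exact: ndF.
Qed.

Variables (B : set T) (h : T -> T) (c : 'I_n -> R).
Hypotheses (mB : measurable B)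
  (mh : forall E, measurable E -> E `<=` B -> measurable (h @` E))
  (c0 : forall i, 0 <= c i)
  (hc : forall x y, B x -> B y -> forall i, `|h x ord0 i - h y ord0 i| <= c i * `|x - y|).

Let C := \prod_i c i.

Let C0 : 0 <= C. Proof. exact: prodr_ge0. Qed.

Lemma lipschitz_image_box (D : set T) (s : R) : 0 < s -> D `<=` B ->
  (forall x y, D x -> D y -> `|x - y| <= s) ->
  exists2 Q, measurable Q /\ mu Q = (C * s ^+ n)%:E & h @` D `<=` Q.
Proof.
move=> s0 DB Ds.
have cs0 i : 0 <= c i * s by rewrite mulr_ge0// ltW.
pose a i := inf [set h x ord0 i | x in D].
exists [set v : T | forall i, `[a i, a i + c i * s]%classic (v ord0 i)].
  split; first by apply: (measurable_prodset (A := fun i => `[a i, a i + c i * s]%classic)).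
  rewrite (lebesgue_Rn_prodset (A := fun i => `[a i, a i + c i * s]%classic))//.
  rewrite (eq_bigr (fun i => (c i * s)%:E)) => [|i _].
    by rewrite prodEFin big_split /= prodr_const card_ord.
  rewrite lebesgue_measure_itv/= lte_fin.
  case: ltP => [_|]; first by rewrite -EFinD addrC addKr.
  by rewrite gerDl => cs; congr EFin; apply/esym/le_anti; rewrite cs cs0.
move=> _ [x Dx <-] i /=; rewrite in_itv /=.
have lbx y : D y -> h x ord0 i - c i * s <= h y ord0 i.
  move=> Dy; have := hc (DB _ Dx) (DB _ Dy) i.
  have := ler_wpM2l (c0 i) (Ds _ _ Dx Dy).
  by move=> h1 /ler_normlP[_ h2]; lra.
have lbD : lbound [set h x ord0 i | x in D] (h x ord0 i - c i * s).
  by move=> _ [y Dy <-]; exact: lbx.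
apply/andP; split.
  by apply: ge_inf; [exists (h x ord0 i - c i * s)|exists x].
rewrite -lerBlDr; apply: lb_le_inf => //.
by exists (h x ord0 i), x.
Qed.

(** The points of [B] whose ball of radius [s] stays in [U] are covered by the
    grid cells of side [s] contained in [U]; these are disjoint, so their total
    volume is at most that of [U]. *)
Lemma lipschitz_image_open U : open U -> B `<=` U ->
  (mu (h @` B) <= C%:E * mu U)%E.
Proof.
move=> oU BU.
pose Bk k := B `&` shrink U k.+1%:R^-1.
have mBk k : measurable (Bk k).
  by apply: measurableI => //; apply: closed_measurable_mx; exact: closed_shrink.
have <- : \bigcup_k (h @` Bk k) = h @` B.
  rewrite -image_bigcup; congr (_ @` _); rewrite -setI_bigcupr bigcup_shrink//.
  exact/setIidPl.
apply: measure_bigcup_le.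
- by move=> k; apply: mh => // x [].
- move=> i j ij; apply: image_subset => x [Bx sx]; split=> //.
  by apply: shrinkS sx; rewrite lef_pV2 ?posrE// ler_nat.
move=> k; set s : R := k.+1%:R^-1.
have s0 : 0 < s by rewrite invr_gt0.
have BkB : Bk k `<=` B by move=> x [].
pose V z : set T := if asbool (grid_cell s z `<=` U) then grid_cell s z else set0.
have mV z : measurable (V z).
  by rewrite /V; case: ifP => // _; exact: measurable_grid_cell.
have /choice[Q QV] z : exists Q, [/\ measurable Q, mu Q = (C%:E * mu (V z))%E
    & h @` (Bk k `&` grid_cell s z) `<=` Q].
  rewrite /V; case: ifPn => [/asboolP zU|/asboolP zU].
    have [||Q [mQ muQ] hQ] :=
        @lipschitz_image_box (Bk k `&` grid_cell s z) s s0.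
    - by move=> x [/BkB].
    - move=> x y [_ zx] [_ zy]; have := grid_cell_ball s0 zx zy.
      by rewrite mx_norm_ball /ball_ /= => /ltW.
    - by exists Q; split=> //; rewrite muQ lebesgue_Rn_grid_cell// EFinM.
  exists set0; split=> //; first by rewrite !measure0 mule0.
  move=> v [x [[Bx /shrinkP sx] zx] _]; apply: zU => y zy; apply: sx.
  exact: grid_cell_ball zx zy.
pose VN i : set T := if pickle_inv i is Some z then V z else set0.
pose QN i : set T := if pickle_inv i is Some z then Q z else set0.
have mVN i : measurable (VN i) by rewrite /VN; case: pickle_inv.
have mQN i : measurable (QN i).
  by rewrite /QN; case: pickle_inv => // z; have [] := QV z.
apply: (@le_trans _ _ (\sum_(0 <= i <oo) mu (QN i))%E).
  apply: measure_sigma_subadditive => //; first by apply: mh => // x [].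
  move=> _ [x Bkx <-]; have [z zx] := grid_cell_cover s x.
  exists (pickle z) => //; rewrite /QN pickleK_inv.
  by have [_ _] := QV z; apply; exists x.
apply: (@le_trans _ _ (\sum_(0 <= i <oo) C%:E * mu (VN i))%E).
  apply: lee_nneseries => // i _; rewrite /QN /VN.
  case: pickle_inv => [z|]; first by have [_ -> _] := QV z.
  by rewrite !measure0 mule0.
rewrite nneseriesZl//; apply: lee_wpmul2l; first by rewrite lee_fin.
have <- : mu (\bigcup_i VN i) = (\sum_(0 <= i <oo) mu (VN i))%E.
  rewrite measure_bigcup//; first by apply: eq_eseriesl => i; rewrite in_setT.
  apply/trivIsetP => i j _ _; apply: contra_neqP => /eqP/set0P[x []].
  rewrite /VN /V.
  case Ei : (pickle_inv i) => [z|//]; case: ifP => // _ zx.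
  case Ej : (pickle_inv j) => [z'|//]; case: ifP => // _ zx'.
  have zz' := grid_cell_inj zx zx'.
  have := @pickle_invK 'rV[int]_n i; have := @pickle_invK 'rV[int]_n j; rewrite Ei Ej /= zz'.
  by move=> <- <-.
apply: le_measure; rewrite ?inE; [exact: bigcupT_measurable|exact: open_measurable_mx|].
move=> x [i _]; rewrite /VN /V; case: pickle_inv => [z|//]; case: ifP => // /asboolP zU.
exact: zU.
Qed.

End anisotropic_lipschitz.

(** A small cube is sent into a box whose volume is [\prod_i c i] times larger,
    and [B] is covered by small cubes filling an open set of almost the same
    measure. Keeping one constant per coordinate matters: a single tiny [c i]
    makes the image small. *)
Lemma lipschitz_image_measure (R : realType) n (B : set 'rV[R]_n)
    (h : 'rV[R]_n -> 'rV[R]_n) (c : 'I_n -> R) :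
  measurable B ->
  (forall E, measurable E -> E `<=` B -> measurable (h @` E)) ->
  (forall i, 0 <= c i) ->
  (forall x y, B x -> B y -> forall i, `|h x ord0 i - h y ord0 i| <= c i * `|x - y|) ->
  (lebesgue_Rn R n (h @` B) <= (\prod_i c i)%:E * lebesgue_Rn R n B)%E.
Proof.
move=> mB mh c0 hc; have C0 : 0 <= \prod_i c i by exact: prodr_ge0.
have <- : \bigcup_k (h @` (B `&` ball 0 k.+1%:R)) = h @` B.
  rewrite -image_bigcup -setI_bigcupr; congr (_ @` _).
  apply/seteqP; split=> [x []//|x Bx]; split=> //.
  exists (Num.truncn `|x|) => //=.
  by rewrite mx_norm_ball /ball_ /= sub0r normrN; exact: truncnS_gt.
have mBk k : measurable (B `&` ball 0 k.+1%:R).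
  by apply: measurableI => //; exact: measurable_ball_mx.
apply: measure_bigcup_le.
- by move=> k; apply: mh => // x [].
- move=> i j ij; apply: image_subset; apply: setIS; apply: le_ball.
  by rewrite ler_nat.
move=> k; set Bk := B `&` _.
apply: (@le_trans _ _ ((\prod_i c i)%:E * lebesgue_Rn R n Bk)%E); last first.
  apply: lee_wpmul2l; rewrite ?lee_fin//; apply: le_measure; rewrite ?inE.
  - exact: mBk.
  - exact: mB.
  - exact: subIsetl.
pose V : set 'rV[R]_n := ball 0 k.+1%:R.
have finV : (lebesgue_Rn R n V < +oo)%E.
  by rewrite /V lebesgue_Rn_ball// ltry.
have finBk : lebesgue_Rn R n Bk \is a fin_num.
  rewrite ge0_fin_numE//; apply: le_lt_trans finV; apply: le_measure; rewrite ?inE.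
  - exact: mBk.
  - exact: measurable_ball_mx.
  - exact: subIsetr.
apply/lee_addgt0Pr => e e0.
have C1 : 0 < \prod_i c i + 1 by rewrite ltr_wpDl.
have [|U [oU BU _ muU]] := @outer_regular R n (lebesgue_Rn R n) V Bk
    (e / (\prod_i c i + 1)) (ball_open _ _) finV (mBk k) (@subIsetr _ _ _).
  by rewrite divr_gt0.
apply: (@le_trans _ _ ((\prod_i c i)%:E * lebesgue_Rn R n U)%E).
  apply: (lipschitz_image_open (mBk k)) => //.
  - by move=> E mE EB; apply: mh => //; exact: subset_trans EB (@subIsetl _ _ _).
  - by move=> x y [Bx _] [By _]; exact: hc.
apply: (@le_trans _ _ ((\prod_i c i)%:E *
    (lebesgue_Rn R n Bk + (e / (\prod_i c i + 1))%:E))%E).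
  by apply: lee_wpmul2l; rewrite ?lee_fin.
rewrite muleDr//; last by rewrite fin_num_adde_defr.
rewrite leeD2l// -EFinM lee_fin mulrCA ger_pMr// ler_pdivrMr// mul1r.
by rewrite lerDl.
Qed.

(** * Measure of linear images *)

Section measurable_matrix.
Context (R : realType).

Lemma measurable_fun_mx d (T : measurableType d) m n (D : set T)
    (f : T -> 'M[R]_(m, n)) : measurable D ->
  (forall i j, measurable_fun D (fun x => f x i j)) -> measurable_fun D f.
Proof.
move=> mD mf; apply: (measurability (@open 'M[R]_(m, n))) => // _ [U oU <-].
rewrite (open_bigcup_rat_ball oU) preimage_bigcup setI_bigcupr bigcup_mkcond.
apply: countable_bigcupT_measurable => [|[q k]]; first exact: countableP.
case: ifPn => // _; set c := map_mx _ _; set r := k.+1%:R^-1.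
have r0 : 0 < r :> R by rewrite invr_gt0.
rewrite /= (_ : _ `&` _ = \bigcap_(i in [set: 'I_m])
    (\bigcap_(j in [set: 'I_n]) (D `&` [set x | ball (c i j) r (f x i j)]) `&` D) `&` D).
  apply: measurableI => //; apply: fin_bigcap_measurable => // i _.
  apply: measurableI => //; apply: fin_bigcap_measurable => // j _.
  by apply: mf => //; exact: measurable_ball.
apply/seteqP; split=> [x [Dx [_ cx]]|x [cx Dx]].
  by split=> // i _; split=> // j _; split=> //; exact: cx.
by split=> //; split=> // i j; have [/(_ j I)[]] := cx i I.
Qed.

Lemma mulmxr_norm_le m n p (v : 'M[R]_(m, n)) (A : 'M[R]_(n, p)) :
  `|v *m A| <= `|v| * \sum_i \sum_j `|A i j|.
Proof.
have M0 (Q : pred 'I_n) : 0 <= \sum_(i | Q i) \sum_j `|A i j|.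
  by apply: sumr_ge0 => i _; exact: sumr_ge0.
rewrite [leLHS]/Num.norm /= mx_normrE; apply/bigmax_leP; split=> [|[i j] _ /=].
  by rewrite mulr_ge0.
rewrite mxE; apply: le_trans (ler_norm_sum _ _ _) _.
rewrite mulr_sumr; apply: ler_sum => k _; rewrite normrM; apply: ler_pM => //.
  exact: coord_mx_le_norm.
by rewrite (bigD1 j)//= lerDl sumr_ge0.
Qed.

Lemma continuous_mulmxr m n p (A : 'M[R]_(n, p)) :
  continuous (fun v : 'M[R]_(m, n) => v *m A).
Proof.
move=> v; set M := \sum_i \sum_j `|A i j|.
have M0 : 0 <= M by apply: sumr_ge0 => i _; exact: sumr_ge0.
have M1 : 0 < M + 1 by rewrite ltr_wpDl.
move=> B /nbhs_ballP[e /= e0 vB]; apply/nbhs_ballP; exists (e / (M + 1)) => /=.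
  by rewrite divr_gt0.
move=> w /=; rewrite mx_norm_ball /ball_ /= => vw; apply: vB.
rewrite mx_norm_ball /ball_ /= -mulmxBl.
apply: le_lt_trans (mulmxr_norm_le _ _) _.
apply: (@le_lt_trans _ _ (`|v - w| * (M + 1))); first by rewrite ler_wpM2l// lerDl.
by rewrite -ltr_pdivlMr.
Qed.

Lemma measurable_mulmxr m n p (A : 'M[R]_(n, p)) :
  measurable_fun setT (fun v : 'M[R]_(m, n) => v *m A).
Proof.
apply: (measurability (@open 'M[R]_(m, p))) => // _ [U oU <-]; rewrite setTI.
apply: open_measurable_mx; apply: open_comp => // v _; exact: continuous_mulmxr.
Qed.

End measurable_matrix.

Lemma prod_perturb (R : realType) (I : Type) (r : seq I) (a b : I -> R) :
  (forall i, 0 <= a i) -> (forall i, 0 <= b i) ->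
  exists2 C, 0 <= C & forall t, 0 <= t <= 1 ->
    \prod_(i <- r) (a i + t * b i) <= \prod_(i <- r) a i + t * C.
Proof.
move=> a0 b0; elim: r => [|i r [C C0 IH]].
  by exists 0 => // t _; rewrite !big_nil mulr0 addr0.
have P0 : 0 <= \prod_(j <- r) a j by exact: prodr_ge0.
exists (a i * C + b i * \prod_(j <- r) a j + b i * C).
  by rewrite !addr_ge0// mulr_ge0.
move=> t /[dup] t01 /andP[t0 t1]; rewrite !big_cons.
apply: le_trans (ler_wpM2l _ (IH _ t01)) _; first by rewrite addr_ge0// mulr_ge0.
set P := \prod_(j <- r) a j in P0 *.
have : t * t * (b i * C) <= t * (b i * C).
  by apply: ler_wpM2r; [rewrite mulr_ge0|nra].
nra.
Qed.

Section linear_image.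
Context (R : realType) (n : nat).
Local Notation T := 'rV[R]_n.
Local Notation mu := (lebesgue_Rn R n).

Definition mulmx_image (A : 'M[R]_n) (E : set T) : set T := (fun v => v *m A) @` E.

Lemma mulmx_imageE A E : A \in unitmx ->
  mulmx_image A E = (fun v => v *m invmx A) @^-1` E.
Proof.
move=> uA; apply/seteqP; split=> [_ [v Ev <-]|v Ev] /=; first by rewrite mulmxK.
by exists (v *m invmx A) => //; rewrite mulmxKV.
Qed.

Lemma measurable_mulmx_image A E : A \in unitmx -> measurable E ->
  measurable (mulmx_image A E).
Proof.
move=> uA mE; rewrite mulmx_imageE// -[X in measurable X]setTI.
exact: measurable_mulmxr.
Qed.

Lemma mulmx_imageM A B E : mulmx_image (A *m B) E = mulmx_image B (mulmx_image A E).
Proof.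
rewrite /mulmx_image image_comp; apply: eq_imagel => v _ /=.
by rewrite mulmxA.
Qed.

Definition stretch (A : 'M[R]_n) (c : R) := forall E, measurable E ->
  (mu (mulmx_image A E) <= c%:E * mu E)%E.

Lemma stretchM A B c d : A \in unitmx -> 0 <= d ->
  stretch A c -> stretch B d -> stretch (A *m B) (c * d).
Proof.
move=> uA d0 sA sB E mE; rewrite mulmx_imageM.
apply: (le_trans (sB _ (measurable_mulmx_image uA mE))).
rewrite mulrC EFinM -muleA; apply: lee_wpmul2l; first by rewrite lee_fin.
exact: sA.
Qed.

(** The coordinates of [v *m A] are Lipschitz in the supremum norm, with the
    [l^1] norms of the columns of [A] as constants. *)
Lemma stretch_col A : A \in unitmx -> stretch A (\prod_j \sum_i `|A i j|).
Proof.
move=> uA E mE; apply: lipschitz_image_measure => //.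
- by move=> F mF _; exact: measurable_mulmx_image.
- by move=> i; exact: sumr_ge0.
move=> x y _ _ j; have -> : (x *m A) ord0 j - (y *m A) ord0 j = ((x - y) *m A) ord0 j.
  by rewrite mulmxBl !mxE.
rewrite mxE; apply: le_trans (ler_norm_sum _ _ _) _; rewrite mulr_suml.
apply: ler_sum => i _; rewrite normrM mulrC ler_wpM2l//.
exact: coord_mx_le_norm.
Qed.

Lemma stretch_perm s : stretch (perm_mx s) 1.
Proof.
have := @stretch_col (perm_mx s) (unitmx_perm R s).
rewrite big1// => j _; pose i0 := invF (@perm.perm_inj _ s) j.
have si0 : s i0 = j by exact: f_invF.
rewrite (bigD1 i0)//= !mxE si0 eqxx normr1.
rewrite big1 ?addr0// => i ij; rewrite !mxE; case: eqP => [sij|]; last by rewrite normr0.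
by move: ij; rewrite -(inj_eq (@perm.perm_inj _ s)) sij si0 eqxx.
Qed.

(** Conjugating by the diagonal matrix with entries [t ^ w i], [t] small, pushes
    the off-diagonal part of a triangular matrix to zero, and the dilations of the
    two diagonal factors cancel: only the diagonal of [A] contributes. *)
Lemma stretch_trig (A : 'M[R]_n) (w : 'I_n -> nat) : A \in unitmx ->
  (forall i j, i != j -> A i j != 0 -> (w i < w j)%N) ->
  (forall j, A j j != 0) ->
  stretch A (\prod_j `|A j j|).
Proof.
move=> uA wA A0 E mE.
pose M j := \sum_(i | i != j) `|A i j|.
have M0 j : 0 <= M j by exact: sumr_ge0.
have stretch_t t : 0 < t <= 1 -> stretch A (\prod_j (`|A j j| + t * M j)).
  move=> /andP[t0 t1].
  pose d := \row_i t ^+ w i; pose d' : T := \row_i t ^- w i.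
  pose D := diag_mx d; pose D' := diag_mx d'.
  have tw k : t ^+ k != 0 by rewrite expf_neq0// gt_eqF.
  have DD' : D *m D' = 1%:M.
    rewrite mulmx_diag; apply/matrixP => i j; rewrite !mxE divff//.
  have D'D : D' *m D = 1%:M by apply: mulmx1C.
  have [uD uD'] := mulmx1_unit DD'.
  have AE : A = D *m (D' *m A *m D) *m D'.
    by rewrite !mulmxA DD' mul1mx -mulmxA DD' mulmx1.
  have uB : D' *m A *m D \in unitmx by rewrite !unitmx_mul uD uD' uA.
  have stretch_diag (f : 'I_n -> R) : diag_mx (\row_i f i) \in unitmx ->
      (forall i, 0 < f i) -> stretch (diag_mx (\row_i f i)) (\prod_j f j).
    move=> uf f0; have := stretch_col uf; congr (stretch _ _).
    apply: eq_bigr => j _; rewrite (bigD1 j)//= !mxE eqxx mulr1n.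
    rewrite gtr0_norm// big1 ?addr0// => i ij.
    by rewrite !mxE (negPf ij) mulr0n normr0.
  have -> : \prod_j (`|A j j| + t * M j) =
      \prod_j t ^+ w j * \prod_j (`|A j j| + t * M j) * \prod_j t ^- w j.
    set P := \prod_j (`|A j j| + _).
    rewrite mulrAC -big_split /= big1 ?mul1r// => j _; by rewrite divff.
  have sB : stretch (D' *m A *m D) (\prod_j (`|A j j| + t * M j)).
    move=> F mF; apply: (le_trans (stretch_col uB mF)).
    apply: lee_wpmul2r => //; rewrite lee_fin; apply: ler_prod => j _.
    rewrite sumr_ge0//= (bigD1 j)//=; apply: lerD.
      rewrite mul_mx_diag mul_diag_mx !mxE.
      by rewrite mulrAC mulVf// mul1r.
    rewrite mulr_sumr; apply: ler_sum => i ij.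
    rewrite mul_mx_diag mul_diag_mx !mxE mulrAC normrM.
    have [->|Aij] := eqVneq (A i j) 0; first by rewrite normr0 !mulr0.
    apply: ler_wpM2r => //; have wij := wA _ _ ij Aij.
    rewrite ger0_norm; last by rewrite mulr_ge0// ?invr_ge0 exprn_ge0// ltW.
    rewrite -(subnK (ltnW wij)) exprD mulrC -mulrA divff// mulr1.
    by rewrite -(subnSK wij) exprS ger_pMr// exprn_ile1// ltW.
  rewrite [X in stretch X _]AE; apply: stretchM; first by rewrite unitmx_mul uD uB.
  - by apply: prodr_ge0 => j _; rewrite invr_ge0 exprn_ge0// ltW.
  - apply: stretchM => //.
    + by apply: prodr_ge0 => j _; rewrite addr_ge0// mulr_ge0// ltW.
    + by apply: (@stretch_diag (fun i => t ^+ w i)) => // i; rewrite exprn_gt0.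
  - by apply: (@stretch_diag (fun i => t ^- w i)) => // i; rewrite invr_gt0 exprn_gt0.
have P0 : 0 < \prod_j `|A j j| by apply: prodr_gt0 => j _; rewrite normr_gt0.
have [->|Efin] := eqVneq (mu E) +oo%E; first by rewrite gt0_muley ?lte_fin ?leey.
have {}Efin : mu E \is a fin_num by rewrite ge0_fin_numE// ltey.
have [C C0 HC] := @prod_perturb R 'I_n (index_enum _) (fun j => `|A j j|) M (fun=> normr_ge0 _) M0.
apply/lee_addgt0Pr => e e0.
pose m := fine (mu E); have m0 : 0 <= m by exact: fine_ge0.
have Cm0 : 0 < C * m + e by rewrite ltr_wpDl// mulr_ge0.
pose t := Num.min 1 (e / (C * m + e)).
have t0 : 0 < t by rewrite lt_min ltr01 divr_gt0.
have t1 : t <= 1 by rewrite ge_min lexx.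
apply: (le_trans (stretch_t t _ E mE)); first by rewrite t0.
rewrite -(fineK Efin) -!EFinM -EFinD lee_fin -/m.
apply: (le_trans (ler_wpM2r m0 (HC t _))); first by rewrite ltW.
rewrite mulrDl lerD2l -mulrA.
apply: (@le_trans _ _ (e / (C * m + e) * (C * m))).
  by apply: ler_wpM2r; [rewrite mulr_ge0|rewrite ge_min lexx orbT].
by rewrite mulrAC ler_pdivrMr// ler_wpM2l ?lerDl// ltW.
Qed.

End linear_image.

Section linear_image_det.
Context (R : realType) (n : nat).
Local Notation mu := (lebesgue_Rn R n.+1).

Lemma det_upper_trig (U : 'M[R]_n.+1) :
  (forall i j : 'I_n.+1, (j < i)%N -> U i j = 0) -> \det U = \prod_i U i i.
Proof.
move=> U0; rewrite -det_tr det_trig; first by apply: eq_bigr => i _; rewrite mxE.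
by apply/is_trig_mxP => i j ij; rewrite mxE U0.
Qed.

(** In the LUP decomposition the permutation and the unitriangular factor do not
    increase measure, and [stretch_trig] evaluates the remaining factor. *)
Lemma stretch_det (A : 'M[R]_n.+1) : A \in unitmx -> stretch A `|\det A|.
Proof.
move=> uA.
have := cormen_lup_correct A; have := cormen_lup_perm A.
have := cormen_lup_detL A; have := @cormen_lup_lower _ _ A.
have := @cormen_lup_upper _ _ A.
case: (cormen_lup A) => -[P L] U /= U0 L0 detL /is_perm_mxP[s Ps] PALU.
have uP : P \in unitmx by rewrite Ps unitmx_perm.
have uL : L \in unitmx by rewrite unitmxE detL unitr1.
have AE : A = perm_mx (s^-1)%g *m L *m U.
  rewrite -mulmxA -[L *m U]PALU -[P * A]/(P *m A) Ps mulmxA -perm_mxM.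
  by rewrite mulVg perm_mx1 mul1mx.
have uU : U \in unitmx by move: uA; rewrite AE unitmx_mul => /andP[].
have U00 j : U j j != 0.
  move: uU; rewrite unitmxE det_upper_trig// unitfE.
  by apply: contraNneq => Uj; rewrite (bigD1 j)//= Uj mul0r.
have -> : `|\det A| = 1 * 1 * \prod_j `|U j j|.
  rewrite AE !det_mulmx detL det_perm normrM normrM normr1 mulr1 normr_sign.
  by rewrite det_upper_trig// normr_prod !mul1r.
rewrite AE; apply: stretchM; first by rewrite unitmx_mul unitmx_perm uL.
- exact: prodr_ge0.
- apply: stretchM => //; first exact: unitmx_perm.
    exact: stretch_perm.
  have -> : 1 = \prod_j `|L j j|.
    by rewrite big1// => j _; rewrite L0// eqxx normr1.
  (* The weights decrease with [i] because [L] is lower triangular. *)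
  apply: (@stretch_trig _ _ L (fun i => (n - i)%N)) => // [i j ij Lij|j].
    have ji : (j < i)%N.
      rewrite ltnNge; apply: contra Lij => ij'; rewrite L0//.
      by rewrite (negPf ij).
    apply: ltn_sub2l => //; exact: leq_trans ji (ltn_ord i).
  by rewrite L0// eqxx oner_neq0.
- apply: (@stretch_trig _ _ U (fun i => i)) => // i j ij Uij.
  rewrite ltnNge leq_eqVlt negb_or; apply/andP; split.
    by apply: contra ij => /eqP ji; apply/eqP/val_inj.
  by apply: contra Uij => ji; rewrite U0.
Qed.

(** [stretch_det] for [A] and for its inverse are the two inequalities. *)
Lemma lebesgue_Rn_mulmx_image (A : 'M[R]_n.+1) (E : set 'rV[R]_n.+1) :
  A \in unitmx -> measurable E ->
  mu (mulmx_image A E) = (`|\det A|%:E * mu E)%E.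
Proof.
move=> uA mE; apply/eqP; rewrite eq_le stretch_det//=.
have uA' : invmx A \in unitmx by rewrite unitmx_inv.
have d0 : 0 < `|\det A| by rewrite normr_gt0 -unitfE -unitmxE.
have := @stretch_det _ uA' _ (measurable_mulmx_image uA mE).
rewrite -mulmx_imageM mulmxV// det_inv.
rewrite {1}/mulmx_image (_ : _ @` E = E); last first.
  apply/seteqP; split=> [_ [v Ev <-]|v Ev]; first by rewrite mulmx1.
  by exists v => //; rewrite mulmx1.
move=> /(@lee_wpmul2l _ `|\det A|%:E) => /(_ (ltW d0)).
by rewrite muleA -EFinM normrV ?unitfE -?normr_gt0// divff ?gt_eqF// mul1e.
Qed.

End linear_image_det.

(** * A maximal inequality and small averages *)

Section integral_measure.
Local Open Scope ereal_scope.
Context d (T : measurableType d) (R : realType) (mu : {measure set T -> \bar R}).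
Variables (f : T -> \bar R) (mf : measurable_fun setT f) (f0 : forall x, 0 <= f x).

(** The two unnamed arguments make the measurability and the sign of [f] part of
    the term, so that the measure structure below can be inferred from it. *)
Definition integral_measure of measurable_fun setT f & (forall x, 0 <= f x) :=
  fun A : set T => \int[mu]_(x in A) f x.

Local Notation m := (integral_measure mf f0).

Let m0 : m set0 = 0. Proof. by rewrite /integral_measure integral_set0. Qed.

Let m_ge0 A : 0 <= m A. Proof. exact: integral_ge0. Qed.

Let m_sigma_additive : semi_sigma_additive m.
Proof.
exact: semi_sigma_additive_nng_induced.
Qed.

HB.instance Definition _ := isMeasure.Build _ _ _ m m0 m_ge0 m_sigma_additive.

End integral_measure.

Section finite_vitali.
Context (R : realType) (V : normedModType R).
Implicit Types (p q : V * R) (s D : seq (V * R)).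

Local Notation B p := (ball p.1 p.2).

Fixpoint disjoint_balls D : Prop := if D is p :: D' then
  (forall q, q \in D' -> B p `&` B q = set0) /\ disjoint_balls D' else True.

(** Greedy selection by decreasing radius: a ball left out meets a selected one
    that is at least as large, whose threefold enlargement contains it. *)
Lemma vitali_balls s : exists2 D, {subset D <= s} /\ disjoint_balls D &
  forall p, p \in s -> exists2 q, q \in D & B p `<=` ball q.1 (3 * q.2).
Proof.
pose le_r p q := p.2 <= q.2.
have le_r_trans : transitive le_r by move=> p q r; exact: le_trans.
wlog : s / sorted le_r s => [sort_s|].
  have [|D [Ds disjD] Dcov] := sort_s (sort le_r s).
    by apply: sort_sorted => p q; exact: le_total.
  exists D; first by split=> // p /Ds; rewrite mem_sort.
  by move=> p; rewrite -(mem_sort le_r); exact: Dcov.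
elim: s => [_|p s IH]; first by exists [::].
rewrite /= path_sortedE// => /andP[/allP ps /IH[D [Ds disjD] Dcov]].
have [disj|] := pselect (forall q, q \in D -> B p `&` B q = set0).
  exists (p :: D).
    split=> // q; rewrite !inE => /orP[->//|/Ds ->]; by rewrite orbT.
  move=> q; rewrite inE => /orP[/eqP ->|/Dcov[q' Dq' qq']].
    exists p; first by rewrite inE eqxx.
    move=> y py; apply: le_ball (py); rewrite ler_peMl ?ler1n//.
    by move: py; rewrite -ball_normE /ball_ /= => /(le_lt_trans (normr_ge0 _))/ltW.
  by exists q' => //; rewrite inE Dq' orbT.
move/existsNP => [q /not_implyP[Dq /eqP/set0P[z [pz qz]]]].
exists D; first by split=> // q' /Ds; rewrite inE => ->; rewrite orbT.
move=> p'; rewrite inE => /orP[/eqP ->|/Dcov//].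
exists q => // y py; have pq : p.2 <= q.2 by apply: ps; exact: Ds.
have -> : 3 * q.2 = q.2 + (q.2 + q.2) by lra.
apply: (ball_triangle qz); apply: (@ball_triangle _ _ p.1).
  by apply: ball_sym; exact: le_ball pz.
exact: le_ball py.
Qed.

End finite_vitali.

Section maximal_inequality.
Context (R : realType) (n : nat).
Local Notation T := 'rV[R]_n.
Local Notation mu := (lebesgue_Rn R n).
Variables (lam : {measure set T -> \bar R}) (U : set T) (t : R).
Hypotheses (mU : measurable U) (t0 : 0 < t).

Local Notation B p := (ball p.1 p.2).

Definition heavy_ball (p : T * R) :=
  [/\ 0 < p.2, B p `<=` U & (t%:E * mu (B p) <= lam (B p))%E].

Lemma disjoint_heavy_balls (D : seq (T * R)) : disjoint_balls D ->
  (forall p, p \in D -> heavy_ball p) ->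
  (t%:E * mu (\big[setU/set0]_(p <- D) ball p.1 (3 * p.2)) <=
   (3 ^+ n)%:E * lam (\big[setU/set0]_(p <- D) B p))%E.
Proof.
have mD (D' : seq (T * R)) c : measurable (\big[setU/set0]_(p <- D') ball p.1 (c * p.2)).
  by apply: bigsetU_measurable => p _; exact: measurable_ball_mx.
have mD' (D' : seq (T * R)) : measurable (\big[setU/set0]_(p <- D') B p).
  by apply: bigsetU_measurable => p _; exact: measurable_ball_mx.
elim: D => [_ _|p D IH [disj disjD] heavyD]; first by rewrite !big_nil !measure0 !mule0.
have [p0 pU hp] : heavy_ball p by apply: heavyD; rewrite inE eqxx.
rewrite !big_cons [X in (_ <= _ * X)%E]measureU//; last 2 first.
- exact: measurable_ball_mx.
- rewrite -bigcup_seq; apply/seteqP; split=> // x [px [q /= Dq qx]].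
  by have : (B p `&` B q) x by []; rewrite disj.
apply: (@le_trans _ _ (t%:E * (mu (ball p.1 (3 * p.2)) +
     mu (\big[setU/set0]_(q <- D) ball q.1 (3 * q.2))))%E).
  apply: lee_wpmul2l; first by rewrite lee_fin ltW.
  by apply: measureU2 => //; exact: measurable_ball_mx.
rewrite ge0_muleDr// ge0_muleDr//; apply: leeD; last first.
  by apply: IH => // q Dq; apply: heavyD; rewrite inE Dq orbT.
rewrite lebesgue_Rn_ball; last by rewrite mulr_gt0.
rewrite -mulrnAr exprMn EFinM muleCA -(lebesgue_Rn_ball p.1 p0).
by apply: lee_wpmul2l; rewrite ?lee_fin ?exprn_ge0.
Qed.

(** Continuity from below reduces the union to finitely many balls; these are
    covered by the threefold enlargements of a disjoint subfamily, whose members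
    carry disjoint parts of the mass of [lam]. *)
Lemma heavy_balls_measure (I : countType) (b : I -> T * R) (good : set I) :
  (forall i, good i -> heavy_ball (b i)) ->
  (t%:E * mu (\bigcup_(i in good) B (b i)) <= (3 ^+ n)%:E * lam U)%E.
Proof.
move=> gb; pose s k := [seq b i | i <- pmap (@pickle_inv I) (iota 0 k) & asbool (good i)].
pose F k := \big[setU/set0]_(p <- s k) B p.
have sP k p : p \in s k -> heavy_ball p.
  by move=> /mapP[i]; rewrite mem_filter => /andP[/asboolP /gb ? _ ->].
have mF k : measurable (F k).
  by apply: bigsetU_measurable => p _; exact: measurable_ball_mx.
have -> : \bigcup_(i in good) B (b i) = \bigcup_k F k.
  apply/seteqP; split=> [x [i gi xi]|x [k _]].
    exists (pickle i).+1 => //; rewrite /F -bigcup_seq; exists (b i) => //=.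
    apply/mapP; exists i => //; rewrite mem_filter; apply/andP; split; first exact/asboolP.
    rewrite mem_pmap; apply/mapP; exists (pickle i); last by rewrite pickleK_inv.
    by rewrite mem_iota ltnS leqnn.
  rewrite /F -bigcup_seq => -[p /= /mapP[i]]; rewrite mem_filter => /andP[/asboolP gi _] ->.
  by exists i.
have ndF : {homo F : i j / (i <= j)%N >-> i `<=` j}.
  move=> i j ij x; rewrite /F -!bigcup_seq => -[p /= si px]; exists p => //=.
  move: si => /mapP[l]; rewrite mem_filter => /andP[gl]; rewrite mem_pmap => /mapP[a].
  rewrite mem_iota => /andP[_ ai] la ->; apply/mapP; exists l => //.
  rewrite mem_filter gl mem_pmap; apply/mapP; exists a => //.
  by rewrite mem_iota /= (leq_trans ai).
suff : (mu (\bigcup_k F k) <= t^-1%:E * ((3 ^+ n)%:E * lam U))%E.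
  move/(@lee_wpmul2l _ t%:E) => /(_ (ltW t0)); rewrite muleA -EFinM divff ?mul1e//.
  by rewrite gt_eqF.
apply: measure_bigcup_le => // k.
have [D [Ds disjD] Dcov] := vitali_balls (s k).
have hD p : p \in D -> heavy_ball p by move=> /Ds /sP.
have mD3 : measurable (\big[setU/set0]_(p <- D) ball p.1 (3 * p.2)).
  by apply: bigsetU_measurable => p _; exact: measurable_ball_mx.
have mD : measurable (\big[setU/set0]_(p <- D) B p).
  by apply: bigsetU_measurable => p _; exact: measurable_ball_mx.
apply: (@le_trans _ _ (mu (\big[setU/set0]_(p <- D) ball p.1 (3 * p.2)))).
  apply: le_measure; [exact/mem_set|exact/mem_set|].
  move=> x; rewrite /F -!bigcup_seq => -[p /= /Dcov[q Dq pq] px].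
  by exists q => //; exact: pq.
have := disjoint_heavy_balls disjD hD.
move/(@lee_wpmul2l _ t^-1%:E); rewrite lee_fin invr_ge0 ltW// => /(_ isT).
rewrite muleA -EFinM mulVf ?gt_eqF// mul1e => /le_trans; apply.
apply: lee_wpmul2l; first by rewrite lee_fin invr_ge0 ltW.
apply: lee_wpmul2l; first by rewrite lee_fin exprn_ge0.
apply: le_measure; [exact/mem_set|exact/mem_set|] => x; rewrite -bigcup_seq => -[p /= Dp].
by have [_ + _] := hD p Dp; apply.
Qed.

End maximal_inequality.

Section differentiation.
Context (R : realType) (n : nat).
Local Notation T := 'rV[R]_n.
Local Notation mu := (lebesgue_Rn R n).

Definition rat_ball (q : 'rV[rat]_n * rat) : T * R := (map_mx ratr q.1, ratr q.2).

(** Rational balls form a countable family, so unions of them are measurable. *)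
Lemma rat_ball_approx (x : T) (r : R) : 0 < r ->
  exists q, [/\ 0 < (rat_ball q).2, (rat_ball q).2 <= 2 * r,
    ball x r `<=` ball (rat_ball q).1 (rat_ball q).2 &
    ball (rat_ball q).1 (rat_ball q).2 `<=` ball x (2 * r)].
Proof.
move=> r0; have r40 : 0 < r / 4 by rewrite divr_gt0.
have xr i : exists q : rat, `|x ord0 i - ratr q| < r / 4.
  have /rat_in_itvoo[q] : x ord0 i - r / 4 < x ord0 i + r / 4.
    by rewrite ltrBlDr -addrA ltrDl addr_gt0.
  rewrite in_itv /= => /andP[q1 q2]; exists q.
  by rewrite ltr_distlC q1 q2.
have /rat_in_itvoo[d] : r + r / 4 < r + r / 2 by lra.
rewrite in_itv /= => /andP[d1 d2].
pose c := \row_i projT1 (cid (xr i)) : 'rV[rat]_n.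
have cx : ball (map_mx ratr c : T) (r / 4) x.
  rewrite ball_prodset// => i; rewrite !mxE /ball /= distrC.
  exact: (projT2 (cid (xr i))).
exists (c, d); rewrite /rat_ball /=; split.
- by apply: lt_trans d1; lra.
- by apply/ltW/(lt_trans d2); lra.
- move=> y xy; apply: (@le_ball _ _ _ (r / 4 + r)); first by lra.
  exact: ball_triangle cx xy.
- move=> y cy; apply: (@le_ball _ _ _ (r / 4 + ratr d)); first by lra.
  exact: ball_triangle (ball_sym cx) cy.
Qed.

Variables (V : set T) (w : T -> R) (e : R).
Hypotheses (oV : open V) (mw : measurable_fun V w) (w0 : forall x, 0 <= w x)
  (intw : (\int[mu]_(x in V) (w x)%:E < +oo)%E) (e0 : 0 < e).

Let mV : measurable V. Proof. exact: open_measurable_mx. Qed.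

Let A := V `&` [set x | w x < e].

Let mA : measurable A.
Proof.
have -> : A = V `&` w @^-1` `]-oo, e[.
  by apply/seteqP; split=> x; rewrite /A /= in_itv.
by apply: mw.
Qed.

Let far : T -> \bar R := (EFin \o w) \_ (V `\` A).

Let mfar : measurable_fun setT far.
Proof.
have mD : measurable (V `\` A) by exact: measurableD.
apply/(measurable_restrictT _ mD)/measurable_EFinP.
by apply: measurable_funS mw => // x [].
Qed.

Let far0 x : (0 <= far x)%E.
Proof. by rewrite /far patchE; case: ifP => _ //=; rewrite lee_fin. Qed.

Let lam := integral_measure mu mfar far0.

Let lamV : (lam V < +oo)%E.
Proof.
apply: le_lt_trans intw; rewrite /lam /integral_measure.
apply: ge0_le_integral => //; first exact: measurable_funTS.
- exact/measurable_EFinP.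
- by move=> x Vx; rewrite /far patchE; case: ifP => _ //=; rewrite lee_fin.
Qed.

Let lamA : lam A = 0%E.
Proof.
rewrite /lam /integral_measure integral0_eq// => x Ax.
by rewrite /far patchE memNset// => -[].
Qed.

(** On [{w < e}] the part of [w] below [e] has averages at most [e]. The rest,
    [far], is carried by [{w >= e}]: open neighbourhoods [U] of [{w < e}] carry
    little of it, so by the maximal inequality it has average more than [e] on
    some small ball only around a null set of points. *)
Lemma ae_small_average : exists2 Z, measurable Z /\ mu Z = 0%E &
  forall x, V x -> w x < e -> ~ Z x ->
  exists2 d, 0 < d & forall r, 0 < r -> r < d -> ball x r `<=` V /\
    (\int[mu]_(y in ball x r) (w y)%:E <= (2 * e)%:E * mu (ball x r))%E.
Proof.
(* Fattening a ball to twice its radius divides its density by at most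
   [2 ^ n]; [eta] makes the exceptional set [W k] have measure [1 / (k + 1)]. *)
pose t := e / 2 ^+ n; have t0 : 0 < t by rewrite divr_gt0// exprn_gt0.
pose eta k : R := t / 3 ^+ n / k.+1%:R.
have eta0 k : 0 < eta k by rewrite !divr_gt0// exprn_gt0.
have AV : A `<=` V by move=> x [].
have /choice[U HU] k : exists U, [/\ open U, A `<=` U, U `<=` V & (lam U <= (eta k)%:E)%E].
  have [U [oU AU UV lamU]] := @outer_regular _ _ lam V A (eta k) oV lamV mA AV (eta0 k).
  exists U; split=> //; apply: (le_trans lamU).
  by rewrite [X in (X + _)%E](_ : _ = 0%E) ?add0e//; exact: lamA.
pose W k := \bigcup_(q in [set q | heavy_ball lam (U k) t (rat_ball q)])
  ball (rat_ball q).1 (rat_ball q).2.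
have mW k : measurable (W k).
  rewrite /W bigcup_mkcond; apply: countable_bigcupT_measurable => [|q]; first exact: countableP.
  by case: ifP => // _; exact: measurable_ball_mx.
have muW k : (mu (W k) <= (k.+1%:R^-1 : R)%:E)%E.
  have [oU _ _ lamU] := HU k.
  have := @heavy_balls_measure R n lam (U k) t (open_measurable_mx oU) t0 _ rat_ball
    [set q | heavy_ball lam (U k) t (rat_ball q)] (fun q hq => hq).
  rewrite -/(W k) => /le_trans /(_ (lee_wpmul2l _ lamU)).
  rewrite lee_fin exprn_ge0// => /(_ isT) /(@lee_wpmul2l _ t^-1%:E).
  rewrite lee_fin invr_ge0 ltW// => /(_ isT).
  rewrite muleA -EFinM mulVf ?gt_eqF// mul1e => /le_trans; apply.
  rewrite -!EFinM lee_fin /eta.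
  have n3 : (3 : R) ^+ n != 0 by rewrite expf_neq0.
  have k1 : k.+1%:R != 0 :> R by [].
  have t00 : t != 0 by rewrite gt_eqF.
  rewrite le_eqVlt; apply/orP; left; apply/eqP; field.
  by rewrite t00 n3 nat1r k1.
exists (\bigcap_k W k).
  split; first exact: bigcapT_measurable.
  apply/eqP; rewrite eq_le measure_ge0 andbT; apply/lee_addgt0Pr => d d0.
  rewrite add0e; have [k] := @ltr_add_invr R 0 d d0; rewrite add0r => kd.
  apply: (@le_trans _ _ (mu (W k))).
    by apply: le_measure; [exact/mem_set/bigcapT_measurable|exact/mem_set|exact: bigcap_inf].
  by apply: (le_trans (muW k)); rewrite lee_fin ltW.
move=> x Vx wx nZ.
have /existsNP[k /not_implyP[_ nW]] : ~ forall k, setT k -> W k x by [].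
have [oU AU UV _] := HU k.
have /nbhs_ballP[d /= d0 xdU] : nbhs x (U k).
  by apply: open_nbhs_nbhs; split=> //; apply: AU.
exists (d / 2); first by rewrite divr_gt0.
move=> r r0 rd.
have rU : ball x (2 * r) `<=` U k by apply: subset_trans xdU; apply: le_ball; lra.
have rV : ball x r `<=` V.
  by apply: subset_trans (subset_trans rU UV); apply: le_ball; lra.
split=> //.
have [q [q0 qr rq q2r]] := rat_ball_approx x r0.
have light : (lam (ball x r) <= e%:E * mu (ball x r))%E.
  rewrite leNgt; apply/negP => heavy; apply: nW; exists q; last by apply: rq; exact: ballxx.
  split=> //; first exact: subset_trans q2r rU.
  apply: (@le_trans _ _ (lam (ball x r))); last first.
    by apply: le_measure; [apply/mem_set; exact: measurable_ball_mx|apply/mem_set; exact: measurable_ball_mx|exact: rq].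
  apply: le_trans (ltW heavy).
  rewrite !lebesgue_Rn_ball// -!EFinM lee_fin /t mulrAC -mulrA.
  apply: ler_wpM2l; first exact: ltW.
  rewrite ler_pdivrMr ?exprn_gt0// -exprMn; apply: lerXn2r; rewrite ?nnegrE.
  - by rewrite mulrn_wge0// ltW.
  - by rewrite mulr_ge0// mulrn_wge0// ltW.
  by lra.
have mb := measurable_ball_mx x r.
have mwb : measurable_fun (ball x r) (EFin \o w).
  by apply/measurable_EFinP; exact: measurable_funS mw.
pose g y := (e%:E + far y)%E.
have wg : (\int[mu]_(y in ball x r) (w y)%:E <= \int[mu]_(y in ball x r) g y)%E.
  apply: ge0_le_integral => //.
  - by move=> y _; rewrite lee_fin.
  - by rewrite /g; apply: emeasurable_funD => //; exact: measurable_funTS.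
  - move=> y xy; rewrite /g /far patchE; case: ifPn => [_|]; first by rewrite leeDr// lee_fin ltW.
    rewrite notin_setE adde0 lee_fin => nfar; apply: contrapT => /negP; rewrite -ltNge => ew.
    apply: nfar; split; first exact: rV.
    by move=> -[_] /=; rewrite ltNge ltW.
apply: (le_trans wg); rewrite /g.
rewrite ge0_integralD//; last 2 first.
- by move=> y _; rewrite lee_fin ltW.
- exact: measurable_funTS.
have e00 : (0 <= e%:E)%E by rewrite lee_fin ltW.
rewrite integral_cst// mulrDl mul1r EFinD ge0_muleDl//.
by apply: leeD2l; exact: light.
Qed.

End differentiation.

(** * Smooth functions of one variable *)

Section smooth_real.
Context (R : realType).
Implicit Types f g : R -> R.

(** The derivative is quantified existentially rather than being [derive1 f]: the
    closure properties are then plain inductions with explicit derivatives. *)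
Fixpoint times_derivable (k : nat) f : Prop := if k is k'.+1 then
  exists2 f', forall x, is_derive x (1 : R) f (f' x) & times_derivable k' f'
  else True.

Definition smooth f := forall k, times_derivable k f.

Lemma times_derivableW k f : times_derivable k.+1 f -> times_derivable k f.
Proof.
by elim: k f => [//|k IH] f [f' ff' f'k]; exists f' => //; exact: IH.
Qed.

Lemma times_derivable_cst k c : times_derivable k (cst c).
Proof.
elim: k c => [//|k IH] c.
by exists (cst 0); [move=> x; exact: is_derive_cst|exact: IH].
Qed.

Lemma times_derivableD k f g : times_derivable k f -> times_derivable k g ->
  times_derivable k (f \+ g).
Proof.
elim: k f g => [//|k IH] f g [f' ff' f'k] [g' gg' g'k].
by exists (f' \+ g'); [move=> x; apply: is_deriveD|exact: IH].
Qed.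

Lemma times_derivableM k f g : times_derivable k f -> times_derivable k g ->
  times_derivable k (f \* g).
Proof.
elim: k f g => [//|k IH] f g fk gk; move: (fk) (gk) => [f' ff' f'k] [g' gg' g'k].
exists ((f \* g') \+ (g \* f')).
  by move=> x; apply: is_deriveM.
by apply: times_derivableD; apply: IH => //; exact: times_derivableW.
Qed.

Lemma times_derivableV k f : (forall x, f x != 0) -> times_derivable k f ->
  times_derivable k (fun x => (f x)^-1).
Proof.
move=> f0; elim: k => [//|k IH] fk; move: (fk) => [f' ff' f'k].
exists ((f' \* cst (-1)) \* ((fun x => (f x)^-1) \* (fun x => (f x)^-1))).
  move=> x; split; first by apply: derivableV.
  rewrite deriveV// (derive_val (is_derive := ff' x)) /GRing.scale /=.
  by rewrite -exprVn expr2 mulrN1 mulNr mulNr mulrC.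
apply: times_derivableM.
  by apply: times_derivableM => //; exact: times_derivable_cst.
by apply: times_derivableM; apply: IH; exact: times_derivableW.
Qed.

Lemma is_derive1_affine f (a b x df : R) : is_derive (a * x + b) (1 : R) f df ->
  is_derive x (1 : R) (fun t => f (a * t + b)) (a * df).
Proof.
move=> fdf; have dg : is_derive x (1 : R) (fun t : R => a * t + b) a.
  have dZ : is_derive x (1 : R) (a *: (@id R)) (a *: 1) by exact: is_deriveZ.
  have := is_deriveD dZ (is_derive_cst b x (1 : R)).
  by rewrite addr0 /GRing.scale /= mulr1.
rewrite mulrC; exact: (is_derive1_comp (f := f) (g := fun t => a * t + b)).
Qed.

Lemma smooth_affine f (a b : R) : smooth f -> smooth (fun t => f (a * t + b)).
Proof.
move=> + k; elim: k f => [//|k IH] f sf.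
have [f' ff' f'k] := sf k.+1.
have sf' : smooth f'.
  move=> l; have [f2 ff2 f2l] := sf l.+1; rewrite (_ : f' = f2)//; apply/funext => x.
  by rewrite -(derive_val (is_derive := ff' x)) -(derive_val (is_derive := ff2 x)).
exists (cst a \* (fun t => f' (a * t + b))).
  by move=> x; apply: is_derive1_affine.
by apply: times_derivableM; [exact: times_derivable_cst|exact: IH].
Qed.

Lemma smooth_derive1 f : smooth f ->
  (forall x, is_derive x (1 : R) f (derive1 f x)) /\ smooth (derive1 f).
Proof.
move=> sf; have fE l f2 : (forall x, is_derive x (1 : R) f (f2 x)) ->
    times_derivable l f2 -> times_derivable l (derive1 f).
  move=> ff2; rewrite (_ : f2 = derive1 f)//; apply/funext => x.
  by rewrite derive1E (derive_val (is_derive := ff2 x)).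
split=> [x|k]; last by have [f2 ff2 f2k] := sf k.+1; exact: fE f2k.
have [f2 ff2 _] := sf 1%N.
by rewrite derive1E; apply: derivableP; exact: ex_derive.
Qed.

Lemma smooth_continuous f : smooth f -> continuous f.
Proof.
move=> sf x; have [f2 ff2 _] := sf 1%N.
by apply: differentiable_continuous; apply/derivable1_diffP; exact: ex_derive.
Qed.

Lemma smoothM f g : smooth f -> smooth g -> smooth (f \* g).
Proof. by move=> sf sg k; exact: times_derivableM. Qed.

Lemma smoothD f g : smooth f -> smooth g -> smooth (f \+ g).
Proof. by move=> sf sg k; exact: times_derivableD. Qed.

Lemma smooth_cst c : smooth (cst c).
Proof. by move=> k; exact: times_derivable_cst. Qed.

(** The functions [p(1/t) exp(-1/t)], extended by [0] to [t <= 0]: a class closed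
    under derivation, since an exponential beats every polynomial. *)
Definition flat (p : {poly R}) (t : R) : R :=
  if 0 < t then p.[t^-1] * expR (- t^-1) else 0.

(** The difference quotient of [flat p] at [0] is [flat ('X * p)], which therefore
    tends to [0]. *)
Lemma flat_lin_bound p : exists2 C, 0 <= C &
  forall t, 0 < t -> t <= 1 -> `|flat p t| <= C * t.
Proof.
pose m := size p; pose A := \sum_(i < size p) `|p`_i|.
have A0 : 0 <= A by exact: sumr_ge0.
exists (A * (m.+1)`!%:R); first by rewrite mulr_ge0.
move=> t t0 t1; rewrite /flat t0 normrM (ger0_norm (expR_ge0 _)).
have tV1 : 1 <= t^-1 by rewrite invf_ge1.
have p_le : `|p.[t^-1]| <= A * t^-1 ^+ m.
  rewrite horner_coef; apply: le_trans (ler_norm_sum _ _ _) _.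
  rewrite mulr_suml; apply: ler_sum => i _; rewrite normrM; apply: ler_wpM2l => //.
  rewrite ger0_norm ?exprn_ge0//; last by rewrite invr_ge0 ltW.
  by apply: ler_weXn2l => //; exact: ltnW.
have exp_le : expR (- t^-1) <= (m.+1)`!%:R / t^-1 ^+ m.+1.
  rewrite expRN -[leRHS]invrK lef_pV2 ?posrE ?expR_gt0//; last first.
    by rewrite invr_gt0 divr_gt0// ?exprn_gt0 ?invr_gt0// ltr0n fact_gt0.
  rewrite invf_div; apply: le_trans (expR_ge1Dxn m _); first by rewrite lerDr.
  by rewrite invr_ge0 ltW.
apply: (le_trans (ler_pM (normr_ge0 _) (expR_ge0 _) p_le exp_le)).
have t0' : t != 0 by rewrite gt_eqF.
rewrite exprS invfM invrK.
have gen (a b c u v : R) : a * u * (c * (b * v)) = a * c * b * (u * v) by ring.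
rewrite gen.
by rewrite divff ?mulr1// expf_neq0// invr_eq0.
Qed.

Definition flat_deriv (p : {poly R}) := 'X^2 * (p - p^`()).

Lemma is_derive_flat p t : is_derive t (1 : R) (flat p) (flat (flat_deriv p) t).
Proof.
have [t0|t0|->] := ltgtP t 0.
- have -> : flat (flat_deriv p) t = 0 by rewrite /flat ltNge (ltW t0).
  apply: (near_eq_is_derive (f := cst 0)).
  near=> s; rewrite /flat ltNge (_ : s <= 0)//= ltW//.
  by near: s; exact: lt_nbhsl.
- have t00 : t != 0 by rewrite gt_eqF.
  have dV : is_derive t (1 : R) (fun s : R => s^-1) (- t ^- 2).
    split; first by apply: derivableV.
    by rewrite (deriveV (f := id))// derive_id /GRing.scale /= mulr1.
  have dp : is_derive t (1 : R) (fun s => p.[s^-1]) (p^`().[t^-1] * - t ^- 2).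
    exact: (is_derive1_comp (f := horner p) (g := fun s => s^-1)).
  have de : is_derive t (1 : R) (fun s : R => expR (- s^-1)) (expR (- t^-1) * t ^- 2).
    apply: (is_derive1_comp (f := expR) (g := fun s => - s^-1)).
    by rewrite -[t ^- 2]opprK; exact: is_deriveN.
  have near_flat : \near t, (fun s => p.[s^-1]) t * (fun s => expR (- s^-1)) t = flat p t.
    near=> s; rewrite /flat ifT//; near: s; exact: lt_nbhsr.
  have dflat := near_eq_is_derive near_flat (is_deriveM dp de).
  apply: (is_derive_eq dflat).
  have gen (a b c u : R) : a * (b * (u * u)) + b * (c * - (u * u)) = u * u * (a - c) * b by ring.
  have tV2 : t ^- 2 = t^-1 * t^-1 by rewrite -exprVn expr2.
  by rewrite /flat t0 /flat_deriv hornerM hornerXn hornerD hornerN expr2 tV2; exact: gen.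
have [C C0 HC] := flat_lin_bound ('X * p).
have cvg0 : (fun h : R => h^-1 *: ((flat p \o shift 0) (h *: 1) - flat p 0)) @ 0^' --> (0 : R).
  apply/cvgrPdist_le => e e0; near=> h.
  have flat0 : flat p 0 = 0 by rewrite /flat ltxx.
  rewrite sub0r normrN /= /GRing.scale /= addr0 mulr1 flat0 subr0.
  have h0 : h != 0 by near: h; exact: nbhs_dnbhs_neq.
  have [hle|hgt] := leP h 0; first by rewrite /flat ltNge hle /= mulr0 normr0 ltW.
  have -> : h^-1 * flat p h = flat ('X * p) h.
    by rewrite /flat hgt hornerM hornerX mulrA.
  have h1 : h <= Num.min 1 (e / (C + 1)).
    rewrite (le_trans (ler_norm _))//; near: h; apply: dnbhs0_le.
    by rewrite lt_min ltr01 divr_gt0// ltr_wpDl.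
  move: h1; rewrite le_min => /andP[h1 h2].
  apply: le_trans (HC _ hgt h1) _.
  have C1 : 0 < C + 1 by rewrite ltr_wpDl.
  apply: le_trans (ler_wpM2l C0 h2) _.
  by rewrite mulrCA ger_pMr// ler_pdivrMr// mul1r lerDl.
have -> : flat (flat_deriv p) 0 = 0 by rewrite /flat ltxx.
split.
  by apply/cvg_ex; exists 0.
exact: cvg_lim cvg0.
Unshelve. all: by end_near. Qed.

Lemma smooth_flat p : smooth (flat p).
Proof.
move=> k; elim: k p => [//|k IH] p.
by exists (flat (flat_deriv p)) => //; exact: is_derive_flat.
Qed.

End smooth_real.

Section smooth_step.
Context (R : realType).

Lemma flat1_gt0 (t : R) : 0 < t -> 0 < flat 1 t.
Proof. by move=> t0; rewrite /flat t0 hornerC mul1r expR_gt0. Qed.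

Lemma flat1_le0 (t : R) : t <= 0 -> flat 1 t = 0.
Proof. by move=> t0; rewrite /flat ltNge t0. Qed.

Lemma flat1_ge0 (t : R) : 0 <= flat 1 t.
Proof. by have [/flat1_le0 ->|/flat1_gt0/ltW] := leP t 0. Qed.

(** A smooth transition from [0] to [1] across [[-1, 1]]; its derivative is a
    smooth bump of mass [1]. The coefficients [1] and [-1] are explicit so that
    the lemma on affine changes of variable applies. *)
Definition step (t : R) : R :=
  flat 1 (1 * t + 1) / (flat 1 (1 * t + 1) + flat 1 (-1 * t + 1)).

Let step_den (t : R) : 0 < flat 1 (1 * t + 1) + flat 1 (-1 * t + 1).
Proof.
have [t0|t0] := leP t 0.
  by rewrite ltr_wpDl ?flat1_ge0// flat1_gt0//; lra.
by rewrite ltr_pwDl ?flat1_ge0// flat1_gt0//; lra.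
Qed.

Lemma smooth_step_fun : smooth step.
Proof.
apply: (@smoothM R (fun t => flat 1 (1 * t + 1))
  (fun t => (flat 1 (1 * t + 1) + flat 1 (-1 * t + 1))^-1)).
  by apply: smooth_affine; exact: smooth_flat.
move=> k; apply: times_derivableV => [t|]; first by rewrite gt_eqF.
by apply: times_derivableD; apply: smooth_affine; exact: smooth_flat.
Qed.

Lemma step_le0 (t : R) : t <= -1 -> step t = 0.
Proof. by move=> t1; rewrite /step flat1_le0 ?mul0r//; lra. Qed.

Lemma step_ge1 (t : R) : 1 <= t -> step t = 1.
Proof.
move=> t1; have := step_den t; rewrite /step (@flat1_le0 (-1 * t + 1)); last by lra.
by rewrite addr0 => t0; rewrite divff// gt_eqF.
Qed.

Lemma step_ge0 (t : R) : 0 <= step t.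
Proof. by rewrite divr_ge0 ?flat1_ge0// ltW. Qed.

Lemma step_le1 (t : R) : step t <= 1.
Proof. by rewrite /step ler_pdivrMr// [leRHS]mul1r lerDl flat1_ge0. Qed.

Lemma derive1_out (f : R -> R) (a b t : R) : (forall s, f s != 0 -> a <= s <= b) ->
  ~~ (a <= t <= b) -> derive1 f t = 0.
Proof.
move=> fab tab; rewrite derive1E.
have near0 : \near t, cst 0 t = f t.
  move: tab; rewrite negb_and -!ltNge => /orP[ta|bt]; near=> s; apply/esym/eqP;
    apply/negPn/negP => /fab /andP[sa sb].
    by move: sa; rewrite leNgt => /negP; apply; near: s; exact: lt_nbhsl.
  by move: sb; rewrite leNgt => /negP; apply; near: s; exact: lt_nbhsr.
have := near_eq_is_derive near0 (is_derive_cst (0 : R) t (1 : R)).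
by move=> /(@derive_val _ _ _ _ _ _ _).
Unshelve. all: by end_near. Qed.

Lemma derive1_supp (f : R -> R) (a b t : R) : (forall s, f s != 0 -> a <= s <= b) ->
  derive1 f t != 0 -> a <= t <= b.
Proof. by move=> fab; apply: contraNT => /(derive1_out fab) ->. Qed.

Lemma derive1_step_supp (t : R) : derive1 step t != 0 -> -1 <= t <= 1.
Proof.
apply: contraNT; rewrite negb_and -!ltNge => /orP[t1|t1]; apply/eqP; rewrite derive1E.
- have near0 : \near t, cst 0 t = step t.
    near=> s; rewrite step_le0//; apply/ltW; near: s; exact: lt_nbhsl.
  by have := near_eq_is_derive near0 (is_derive_cst (0 : R) t (1 : R)) => /(@derive_val _ _ _ _ _ _ _).
- have near0 : \near t, cst 1 t = step t.
    near=> s; rewrite step_ge1//; apply/ltW; near: s; exact: lt_nbhsr.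
  by have := near_eq_is_derive near0 (is_derive_cst (1 : R) t (1 : R)) => /(@derive_val _ _ _ _ _ _ _).
Unshelve. all: by end_near. Qed.

Lemma derive1_step_bound : exists2 C : R, 0 < C & forall t, `|derive1 step t| <= C.
Proof.
have cn : continuous (fun t => `|derive1 step t|).
  move=> t; apply: continuous_comp; last exact: norm_continuous.
  by apply: smooth_continuous; have [] := smooth_derive1 smooth_step_fun.
have [|c _ Hc] := @EVT_max R (fun t => `|derive1 step t|) (-1) 1 _ (continuous_subspaceT cn).
  by lra.
exists (`|derive1 step c| + 1) => [|t]; first by rewrite ltr_wpDl.
have [->|/derive1_step_supp t1] := eqVneq (derive1 step t) 0.
  by rewrite normr0 addr_ge0.
by rewrite (le_trans (Hc t _)) ?lerDl// in_itv.
Qed.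

End smooth_step.

Section compactly_supported_1d.
Context (R : realType).
Local Notation leb := (@lebesgue_measure R).

Lemma supp_integralE (f : R -> R) (M : R) : (forall s, f s != 0 -> - M <= s <= M) ->
  (\int[leb]_t (f t)%:E = \int[leb]_(t in `[(- M)%R, M]) (f t)%:E)%E.
Proof.
move=> fM; rewrite [RHS]integral_mkcond; apply: eq_integral => t _.
rewrite patchE; case: ifPn => //; rewrite notin_setE /= in_itv /= => tM.
congr EFin; apply/eqP; apply/negPn/negP => /fM; exact/negP/negP.
Qed.

Lemma integrable_supp (f : R -> R) (a b : R) : continuous f ->
  (forall s, f s != 0 -> a <= s <= b) -> leb.-integrable setT (EFin \o f).
Proof.
move=> cf fab.
have : leb.-integrable `[a, b] (EFin \o f).
  apply: continuous_compact_integrable; first exact: segment_compact.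
  exact: continuous_subspaceT.
move=> /integrable_mkcond => /(_ (measurable_itv _)).
apply: eq_integrable => // t _.
rewrite patchE /=; case: ifPn => //; rewrite notin_setE /= in_itv /= => tM.
congr EFin; apply/esym/eqP; apply/negPn/negP => /fab; exact/negP/negP.
Qed.

Lemma integral_derive1 (F : R -> R) (M : R) : smooth F -> 0 < M ->
  (forall s, derive1 F s != 0 -> - M <= s <= M) ->
  \int[leb]_t derive1 F t = F M - F (- M).
Proof.
move=> sF M0 F'M; have [dF sF'] := smooth_derive1 sF.
have cF := smooth_continuous sF.
have MM : - M < M by lra.
have cF' := continuous_subspaceT (smooth_continuous sF') : {within `[- M, M], continuous (derive1 F)}.
have dLR : derivable_oo_LRcontinuous F (- M) M.
  split; first by move=> x _; exact: (ex_derive (is_derive := dF x)).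
  - by apply: cvg_at_right_filter; exact: cF.
  - by apply: cvg_at_left_filter; exact: cF.
rewrite /Rintegral (supp_integralE F'M).
by rewrite (continuous_FTC2 MM cF' dLR).
Qed.

End compactly_supported_1d.

(** * Products of functions of one variable as test functions *)

Section row_products.
Context (R : realType) (n : nat).
Local Notation T := 'rV[R]_n.
Implicit Types (p : 'I_n -> R -> R).

Definition rowprod p (z : T) : R := \prod_i p i (z ord0 i).

Definition upd p (j : 'I_n) (f : R -> R) : 'I_n -> R -> R :=
  fun i => if i == j then f else p i.

Lemma rowprod_upd p j f (z : T) :
  rowprod (upd p j f) z = f (z ord0 j) * \prod_(i | i != j) p i (z ord0 i).
Proof.
rewrite /rowprod (bigD1 j)//= /upd eqxx; congr (_ * _).
by apply: eq_bigr => i /negPf ->.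
Qed.

Lemma rowprod_split p j (z : T) :
  rowprod p z = p j (z ord0 j) * \prod_(i | i != j) p i (z ord0 i).
Proof. by rewrite /rowprod (bigD1 j). Qed.

Lemma continuous_rowprod p : (forall i, continuous (p i)) -> continuous (rowprod p).
Proof.
move=> cp; rewrite /rowprod; elim: (index_enum _) => [|i s IH].
  rewrite (_ : (fun _ => _) = cst 1); first exact: cst_continuous.
  by apply/funext => w; rewrite big_nil.
rewrite (_ : (fun _ => _) = (fun w : T => p i (w ord0 i)) \* (fun w : T => \prod_(i <- s) p i (w ord0 i))).
  move=> z; apply: continuousM; last exact: IH.
  apply: (@continuous_comp _ _ _ (fun w : T => w ord0 i) (p i)); last exact: cp.
  exact: coord_continuous.
by apply/funext => w; rewrite big_cons.
Qed.

Lemma is_derive_rowprod p j (z : T) (df : R) : is_derive (z ord0 j) (1 : R) (p j) df ->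
  is_derive z (delta_mx ord0 j : T) (rowprod p)
    (df * \prod_(i | i != j) p i (z ord0 i)).
Proof.
move=> [dp <-]; set c := \prod_(i | i != j) _.
have quotE : (fun h : R => h^-1 *: ((rowprod p \o shift z) (h *: delta_mx ord0 j) - rowprod p z)) =
    (fun h : R => h^-1 *: ((p j \o shift (z ord0 j)) (h *: 1) - p j (z ord0 j))) \* cst c.
  apply/funext => h /=; rewrite !(rowprod_split p j) /= -/c.
  rewrite (_ : \prod_(i | i != j) p i ((h *: delta_mx ord0 j + z) ord0 i) = c); last first.
    by apply: eq_bigr => i ij; rewrite !mxE (negPf ij) andbF mulr0 add0r.
  by rewrite !mxE !eqxx /= /GRing.scale /= -mulrBl mulrA.
have quot_cvg : (fun h : R => h^-1 *: ((rowprod p \o shift z) (h *: delta_mx ord0 j) - rowprod p z))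
    @ 0^' --> 'D_1 (p j) (z ord0 j) * c.
  rewrite quotE; apply: cvgM; [exact: dp|exact: cvg_cst].
split; first by apply/cvg_ex; eexists; exact: quot_cvg.
exact: cvg_lim quot_cvg.
Qed.

Lemma partial_deriv_rowprod p j : (forall i, smooth (p i)) ->
  partial_deriv j (rowprod p) = rowprod (upd p j (derive1 (p j))).
Proof.
move=> sp; apply/funext => z; rewrite /partial_deriv rowprod_upd.
have [dp _] := smooth_derive1 (sp j).
exact: (derive_val (is_derive := is_derive_rowprod (dp _))).
Qed.

Lemma smooth_upd p j f : (forall i, smooth (p i)) -> smooth f ->
  forall i, smooth (upd p j f i).
Proof. by move=> sp sf i; rewrite /upd; case: ifP. Qed.

Lemma Ck_rowprod p k : (forall i, smooth (p i)) -> Ck k (rowprod p).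
Proof.
elim: k p => [|k IH] p sp.
  by apply: continuous_rowprod => i; exact: smooth_continuous.
split; first by apply: continuous_rowprod => i; exact: smooth_continuous.
move=> j; have [dp sp'] := smooth_derive1 (sp j); split=> [z|].
  exact: (ex_derive (is_derive := is_derive_rowprod (dp _))).
by rewrite partial_deriv_rowprod//; apply: IH; exact: smooth_upd.
Qed.

Definition box (a b : 'I_n -> R) : set T := [set z | forall i, a i <= z ord0 i <= b i].

Lemma compact_box a b : compact (box a b).
Proof.
rewrite (_ : box a b = [set v | forall i, `[a i, b i]%classic (v ord0 i)]).
  by apply: (@rV_compact _ _ (fun i => `[a i, b i]%classic)) => i; exact: segment_compact.
by apply/seteqP; split=> v vab i; have := vab i; rewrite /= in_itv.
Qed.

Lemma closed_box a b : closed (box a b).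
Proof. by apply: compact_closed; [exact: norm_hausdorff|exact: compact_box]. Qed.

Lemma measurable_box a b : measurable (box a b).
Proof. by apply: closed_measurable_mx; exact: closed_box. Qed.

Definition supp_in p (a b : 'I_n -> R) := forall i t, p i t != 0 -> a i <= t <= b i.

Lemma rowprod_supp p a b z : supp_in p a b -> rowprod p z != 0 -> box a b z.
Proof.
move=> pab pz i; apply: pab; apply: contraNneq pz => pi0.
by rewrite (rowprod_split p i) pi0 mul0r.
Qed.

Lemma test_function_rowprod (Omega : set T) p a b : (forall i, smooth (p i)) ->
  supp_in p a b -> box a b `<=` Omega -> test_function Omega (rowprod p).
Proof.
move=> sp pab abO.
have supp_box : closure [set z | rowprod p z != 0] `<=` box a b.
  rewrite [X in _ `<=` X](closure_id _).1; last exact: closed_box.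
  by apply: closureS => z; exact: rowprod_supp.
split; first by move=> k; exact: Ck_rowprod.
- apply: subclosed_compact (@compact_box a b) supp_box; exact: closed_closure.
- exact: subset_trans supp_box abO.
Qed.

Lemma supp_in_upd p a b j f : supp_in p a b -> (forall t, f t != 0 -> a j <= t <= b j) ->
  supp_in (upd p j f) a b.
Proof. move=> pab fab i t; rewrite /upd; have [->|_] := eqVneq i j; [exact: fab|exact: pab]. Qed.

Definition hybrid (p q : 'I_n -> R -> R) (j : 'I_n) : 'I_n -> R -> R :=
  fun i => if (i < j)%N then q i else p i.

End row_products.

(** Passing from one product to the other one factor at a time gives products in
    which exactly one factor is a difference. *)
Lemma prod_telescope (R : comPzRingType) n (a b : 'I_n -> R) :
  \prod_i a i - \prod_i b i =
  \sum_j (a j - b j) * \prod_(i | i != j) (if (i < j)%N then b i else a i).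
Proof.
elim: n a b => [|n IH] a b; first by rewrite !big_ord0 subrr.
rewrite !big_ord_recl.
have -> : \prod_(i | i != ord0) (if (i < @ord0 n)%N then b i else a i) =
    \prod_(i < n) a (lift ord0 i).
  rewrite big_mkcond big_ord_recl eqxx /= mul1r.
  by apply: eq_bigr => i _.
under [X in _ = _ + X]eq_bigr => j _.
  rewrite big_mkcond big_ord_recl /= mulrCA.
  rewrite (eq_bigr (fun i => if i != j then if (i < j)%N then b (lift ord0 i) else a (lift ord0 i) else 1)).
    rewrite -big_mkcond; over.
  by move=> i _; rewrite (inj_eq lift_inj).
rewrite -mulr_sumr -(IH (fun i => a (lift ord0 i)) (fun i => b (lift ord0 i))).
ring.
Qed.

(** * Weak derivatives tested on products *)

Section weak_derivatives.
Context (R : realType) (n : nat).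
Local Notation T := 'rV[R]_n.
Local Notation mu := (lebesgue_Rn R n).
Local Notation leb := (@lebesgue_measure R).
Variables (Omega : set T) (oO : open Omega).
Implicit Types (u : T -> R) (Du : 'I_n -> T -> R).

Let mO : measurable Omega. Proof. exact: open_measurable_mx. Qed.

Lemma continuous_measurable_mx (g : T -> R) : continuous g -> measurable_fun setT g.
Proof.
move=> cg; apply: (measurability _ (RGenOpens.measurableE R)).
move=> _ [_ [a [b ->] <-]]; rewrite setTI; apply: open_measurable_mx.
by apply: open_comp => [x _|]; [exact: cg|exact: interval_open].
Qed.

Lemma continuous_bounded_box (g : T -> R) a b : continuous g ->
  exists2 M, 0 <= M & forall z, box a b z -> `|g z| <= M.
Proof.
move=> cg; have cgb : compact (g @` box a b).
  by apply: continuous_compact; [exact: continuous_subspaceT|exact: compact_box].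
have [M [_ HM]] := compact_bounded cgb.
exists (Num.max 0 (M + 1)) => [|z zab]; first by rewrite le_max lexx.
rewrite le_max; apply/orP; right; apply: HM; [by rewrite ltrDl|by exists z].
Qed.

(** On the box supporting [g], [u] is integrable and [g] is bounded. *)
Lemma integrable_mul_supp u (g : T -> R) a b : L1loc Omega u -> continuous g ->
  box a b `<=` Omega -> (forall z, g z != 0 -> box a b z) ->
  mu.-integrable Omega (EFin \o (fun z => u z * g z)).
Proof.
move=> [mu_ Lu] cg abO gab; have mb := @measurable_box R n a b.
have ub := Lu _ abO (@compact_box R n a b).
have [M M0 gM] := continuous_bounded_box a b cg.
have mg := continuous_measurable_mx cg.
have ugb : mu.-integrable (box a b) (EFin \o (fun z => u z * g z)).
  have uMb : mu.-integrable (box a b) (fun z => M%:E * (u z)%:E)%E by exact: integrableZl.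
  apply: le_integrable uMb => //.
    apply/measurable_EFinP; apply: measurable_funM.
      by apply: measurable_funS mu_.
    exact: measurable_funTS.
  move=> z zab; rewrite /= normrM lee_fin mulrC normrM (ger0_norm M0).
  by apply: ler_wpM2r => //; exact: gM.
apply/integrable_mkcond => //; move/integrable_mkcond : ugb => /(_ mb).
apply: eq_integrable => // z _; rewrite !patchE.
have [zab|zab] := boolP (z \in box a b).
  by rewrite ifT//; apply/mem_set/abO/set_mem.
case: ifP => // _ /=; have [->|/gab /mem_set] := eqVneq (g z) 0; first by rewrite mulr0.
by rewrite (negbTE zab).
Qed.

Lemma le_integral_mul_supp u (g : T -> R) a b M : L1loc Omega u -> continuous g ->
  box a b `<=` Omega -> (forall z, g z != 0 -> box a b z) -> 0 <= M ->
  (forall z, `|g z| <= M) ->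
  (`|\int[mu]_(z in Omega) (u z * g z)|%:E <= M%:E * \int[mu]_(z in box a b) `|(u z)%:E|)%E.
Proof.
move=> Lu cg abO gab M0 gM; have mb := @measurable_box R n a b.
have iug := integrable_mul_supp Lu cg abO gab.
rewrite EFin_normr_Rintegral//.
have /integrableP[mug _] := iug.
apply: (le_trans (le_abse_integral mu mO mug)).
have -> : (\int[mu]_(z in Omega) `|(EFin \o (fun z => (u z * g z)%R)) z| =
    \int[mu]_(z in box a b) `|(u z * g z)%:E|)%E.
  rewrite integral_mkcond [RHS]integral_mkcond; apply: eq_integral => z _.
  rewrite !patchE; have [zab|zab] := boolP (z \in box a b).
    by rewrite ifT//; apply/mem_set/abO/set_mem.
  case: ifP => // _ /=; have [->|/gab /mem_set] := eqVneq (g z) 0.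
    by rewrite mulr0 normr0.
  by rewrite (negbTE zab).
have mub : measurable_fun (box a b) u by case: Lu => + _; exact: measurable_funS.
rewrite -ge0_integralZl//; last first.
  by apply: measurableT_comp => //; exact/measurable_EFinP.
apply: ge0_le_integral => //.
- apply: measurableT_comp => //; apply/measurable_EFinP.
  apply: measurable_funS mO abO _; exact/measurable_EFinP.
- apply: emeasurable_funM => //; apply: measurableT_comp => //; exact/measurable_EFinP.
- by move=> z _; rewrite /= lee_fin normrM mulrC; apply: ler_wpM2r.
Qed.

(** Weak differentiability tested on products of one-variable functions only: these
    include every test function used below, and their partial derivatives and
    integrals are explicit. *)
Definition prod_weak_deriv u Du := forall j p a b, (forall i, smooth (p i)) ->
  supp_in p a b -> box a b `<=` Omega ->
  \int[mu]_(z in Omega) (u z * rowprod (upd p j (derive1 (p j))) z) =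
  - \int[mu]_(z in Omega) (Du j z * rowprod p z).

Lemma continuous_rowprod_smooth (p : 'I_n -> R -> R) :
  (forall i, smooth (p i)) -> continuous (rowprod p).
Proof. by move=> sp; apply: continuous_rowprod => i; exact: smooth_continuous. Qed.

Lemma smooth_upd1 (p : 'I_n -> R -> R) j : (forall i, smooth (p i)) ->
  forall i, smooth (upd p j (derive1 (p j)) i).
Proof. by move=> sp; apply: smooth_upd => //; have [] := smooth_derive1 (sp j). Qed.

Lemma supp_in_upd1 (p : 'I_n -> R -> R) j a b : supp_in p a b ->
  supp_in (upd p j (derive1 (p j))) a b.
Proof. by move=> pab; apply: supp_in_upd => // t; apply: derive1_supp; exact: pab. Qed.

Lemma L1locD u v : L1loc Omega u -> L1loc Omega v -> L1loc Omega (u \+ v).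
Proof.
move=> [mu_ Lu] [mv Lv]; split; first exact: measurable_funD.
move=> K KO cK; have := integrableD _ (Lu K KO cK) (Lv K KO cK).
by apply; apply: closed_measurable_mx; apply: compact_closed => //; exact: norm_hausdorff.
Qed.

Lemma L1locZ (c : R) u : L1loc Omega u -> L1loc Omega (fun z => c * u z).
Proof.
move=> [mu_ Lu]; split; first exact: measurable_funM.
move=> K KO cK; have := integrableZl _ c (Lu K KO cK).
by apply; apply: closed_measurable_mx; apply: compact_closed => //; exact: norm_hausdorff.
Qed.

Lemma prod_weak_derivD u Du v Dv : L1loc Omega u -> (forall j, L1loc Omega (Du j)) ->
  L1loc Omega v -> (forall j, L1loc Omega (Dv j)) ->
  prod_weak_deriv u Du -> prod_weak_deriv v Dv ->
  prod_weak_deriv (u \+ v) (fun j => Du j \+ Dv j).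
Proof.
move=> Lu LDu Lv LDv wu wv j p a b sp pab abO.
have test w : L1loc Omega w -> mu.-integrable Omega (EFin \o (fun z => w z * rowprod p z)).
  move=> Lw; apply: (integrable_mul_supp Lw _ abO) => [|z]; last exact: rowprod_supp.
  exact: continuous_rowprod_smooth.
have testD w : L1loc Omega w -> mu.-integrable Omega
    (EFin \o (fun z => w z * rowprod (upd p j (derive1 (p j))) z)).
  move=> Lw; apply: (integrable_mul_supp Lw _ abO) => [|z].
    by apply: continuous_rowprod_smooth; exact: smooth_upd1.
  by apply: rowprod_supp; exact: supp_in_upd1.
under eq_Rintegral => z _ do rewrite /= mulrDl.
under [in RHS]eq_Rintegral => z _ do rewrite /= mulrDl.
rewrite !RintegralD//; [|exact: test..|exact: testD|exact: testD].
by rewrite opprD (wu j p a b)// (wv j p a b).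
Qed.

Lemma prod_weak_derivZ (c : R) u Du : L1loc Omega u -> (forall j, L1loc Omega (Du j)) ->
  prod_weak_deriv u Du ->
  prod_weak_deriv (fun z => c * u z) (fun j z => c * Du j z).
Proof.
move=> Lu LDu wu j p a b sp pab abO.
under eq_Rintegral => z _ do rewrite -mulrA.
under [in RHS]eq_Rintegral => z _ do rewrite -mulrA.
rewrite !RintegralZl//; last 2 first.
- apply: (integrable_mul_supp (LDu j) _ abO) => [|z]; last exact: rowprod_supp.
  exact: continuous_rowprod_smooth.
- apply: (integrable_mul_supp Lu _ abO) => [|z].
    by apply: continuous_rowprod_smooth; exact: smooth_upd1.
  by apply: rowprod_supp; exact: supp_in_upd1.
by rewrite (wu j p a b)// mulrN.
Qed.

Lemma prod_weak_deriv0 : prod_weak_deriv (cst 0) (fun=> cst 0).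
Proof.
move=> j p a b _ _ _.
by under eq_Rintegral => z _ do rewrite mul0r; under [in RHS]eq_Rintegral => z _ do rewrite mul0r; rewrite Rintegral_cst// mul0r oppr0.
Qed.

Lemma Rintegral_supp (g : T -> R) a b : box a b `<=` Omega ->
  (forall z, g z != 0 -> box a b z) ->
  \int[mu]_(z in Omega) g z = \int[mu]_z g z.
Proof.
move=> abO gab; rewrite Rintegral_mkcond; apply: eq_Rintegral => z _.
rewrite patchE; case: ifPn => // zO; apply/esym/eqP; apply: contraNT zO => /gab /abO.
by move=> /mem_set.
Qed.

Lemma Rintegral_rowprod (p : 'I_n -> R -> R) a b : (forall i, continuous (p i)) ->
  supp_in p a b -> \int[mu]_z rowprod p z = \prod_i \int[leb]_t p i t.
Proof.
move=> cp pab; rewrite /Rintegral.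
have [|_ ->//] := @integrable_row_prod R n p.
by move=> i; apply: (integrable_supp (cp i)); exact: pab.
Qed.

End weak_derivatives.

Section derivative_of_combinations.
Context (R : realType) (n : nat).
Local Notation T := 'rV[R]_n.
Local Notation mu := (lebesgue_Rn R n).
Local Notation leb := (@lebesgue_measure R).
Variables (Omega : set T) (oO : open Omega).

Lemma smooth_id : smooth (@id R).
Proof.
case=> [//|k]; exists (cst 1) => [x|]; [exact: is_derive_id|exact: times_derivable_cst].
Qed.

Lemma integral_derive1_supp (F : R -> R) (a b : R) : smooth F ->
  (forall t, F t != 0 -> a <= t <= b) -> \int[leb]_t derive1 F t = 0.
Proof.
move=> sF Fab; pose M := `|a| + `|b| + 1.
have aM : - M < a by rewrite ltrNl /M; have := ler_norm (- a); have := normr_ge0 b; rewrite normrN; lra.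
have bM : b < M by rewrite /M; have := ler_norm b; have := normr_ge0 a; lra.
have M0 : 0 < M by rewrite /M ltr_wpDl// addr_ge0.
have F0 t : ~~ (a <= t <= b) -> F t = 0.
  by move=> tab; apply/eqP; apply: contraNT tab => /Fab.
rewrite (integral_derive1 sF M0) => [|t /(derive1_supp Fab) /andP[ta tb]].
  by rewrite !F0 ?subrr// negb_and -!ltNge ?aM ?bM// orbT.
by rewrite (ltW (lt_le_trans aM ta)) (le_trans tb (ltW bM)).
Qed.

Lemma integral_id_derive1 (p : R -> R) (a b : R) : smooth p ->
  (forall t, p t != 0 -> a <= t <= b) ->
  \int[leb]_t (t * derive1 p t) = - \int[leb]_t p t.
Proof.
move=> sp pab; have [dp sp'] := smooth_derive1 sp.
have iab (g : R -> R) : continuous g -> (forall t, g t != 0 -> a <= t <= b) ->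
    leb.-integrable setT (EFin \o g) by move=> cg gab; exact: integrable_supp cg gab.
have ip := iab _ (smooth_continuous sp) pab.
have idp : leb.-integrable setT (EFin \o (fun t => t * derive1 p t)).
  apply: iab; first exact/smooth_continuous/(smoothM smooth_id).
  move=> t; apply: contraNT => /(derive1_out pab) ->; by rewrite mulr0.
have dE : derive1 (@id R \* p) = p \+ (fun t => t * derive1 p t).
  apply/funext => t; rewrite derive1E.
  have := is_deriveM (is_derive_id t (1 : R)) (dp t) => /(@derive_val _ _ _ _ _ _ _) ->.
  by rewrite /GRing.scale /= mulr1 addrC.
have : \int[leb]_t derive1 (@id R \* p) t = 0.
  apply: (@integral_derive1_supp _ a b); first exact: (smoothM smooth_id).
  by move=> t /=; apply: contraNT => tab; rewrite mulf_eq0; apply/orP; right;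
    apply: contraNT tab => /pab.
rewrite dE RintegralD// => /eqP; rewrite addrC addr_eq0 => /eqP; exact.
Qed.

Lemma L1loc_continuous (u : T -> R) : continuous u -> L1loc Omega u.
Proof.
move=> cu; split; first by apply: measurable_funTS; exact: continuous_measurable_mx.
move=> K KO cK.
have mK : measurable K.
  by apply: closed_measurable_mx; apply: compact_closed => //; exact: norm_hausdorff.
have [M [_ HM]] := compact_bounded cK.
have K_ball : K `<=` ball (0 : T) (`|M| + 2).
  move=> x /(HM (`|M| + 1)) xM; rewrite mx_norm_ball /ball_ /= sub0r normrN.
  have := xM _; rewrite (le_lt_trans (ler_norm _))// ?ltrDl// => /(_ isT) => xM1.
  by apply: le_lt_trans xM1 _; rewrite ltrD2l ltr1n.
have muK : (mu K < +oo)%E.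
  apply: (@le_lt_trans _ _ (mu (ball (0 : T) (`|M| + 2))%R)).
    by apply: le_measure; [apply/mem_set; exact: mK|apply/mem_set; exact: measurable_ball_mx|exact: K_ball].
  by rewrite lebesgue_Rn_ball ?ltry// ltr_wpDl.
apply: measurable_bounded_integrable => //.
  by apply: measurable_funTS; exact: continuous_measurable_mx.
have cuK : compact (u @` K) by apply: continuous_compact => //; exact: continuous_subspaceT.
have [B [Br HB]] := compact_bounded cuK.
exists B; split=> // x Bx y Ky; apply: HB => //; by exists y.
Qed.

(** Both integrals factor into integrals over the line; the coordinate [k] is
    integrated by parts, and for [j != k] a factor is the integral of a derivative
    of a compactly supported function. *)
Lemma prod_weak_deriv_coord k :
  prod_weak_deriv Omega (fun z : T => z ord0 k) (fun j => cst (j == k)%:R).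
Proof.
move=> j p a b sp pab abO.
have spU := smooth_upd1 j sp; have pabU := supp_in_upd1 pab (j:=j).
pose q := upd (upd p j (derive1 (p j))) k (fun t => t * upd p j (derive1 (p j)) k t).
have qE (z : T) : z ord0 k * rowprod (upd p j (derive1 (p j))) z = rowprod q z.
  by rewrite [RHS]rowprod_upd [X in _ * X](rowprod_split _ k) mulrA.
have sq i : smooth (q i).
  by apply: smooth_upd => //; apply: (smoothM smooth_id); exact: spU.
have qab : supp_in q a b.
  apply: supp_in_upd => // t; rewrite mulf_eq0 negb_or => /andP[_]; exact: pabU.
under eq_Rintegral => z _ do rewrite qE.
rewrite (Rintegral_supp abO) => [|z]; last exact: rowprod_supp.
rewrite (Rintegral_rowprod (a := a) (b := b))// => [|i]; last exact: smooth_continuous.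
have [jk|jk] := eqVneq j k.
  under [in RHS]eq_Rintegral => z _ do rewrite mul1r.
  rewrite (Rintegral_supp abO) => [|z]; last exact: rowprod_supp.
  rewrite (Rintegral_rowprod (a := a) (b := b))// => [|i]; last exact: smooth_continuous.
  rewrite (bigD1 j)//= [in RHS](bigD1 j)//= -mulNr; congr (_ * _).
    rewrite /q /upd -jk eqxx; apply: integral_id_derive1 => //; exact: pab.
  by apply: eq_bigr => i ij; rewrite /q /upd -jk (negPf ij).
under [in RHS]eq_Rintegral => z _ do rewrite mul0r.
rewrite Rintegral_cst ?mul0r ?oppr0//; last exact: open_measurable_mx.
rewrite (bigD1 j)//= [X in X * _](_ : _ = 0) ?mul0r//.
rewrite /q /upd (negPf jk) eqxx; apply: integral_derive1_supp => //; exact: pab.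
Qed.

Lemma prod_weak_deriv_sum (I : Type) (s : seq I) (c : I -> R) (u : I -> T -> R)
    (Du : I -> 'I_n -> T -> R) :
  (forall i, L1loc Omega (u i)) -> (forall i j, L1loc Omega (Du i j)) ->
  (forall i, prod_weak_deriv Omega (u i) (Du i)) ->
  [/\ L1loc Omega (fun z => \sum_(i <- s) c i * u i z),
      forall j, L1loc Omega (fun z => \sum_(i <- s) c i * Du i j z) &
      prod_weak_deriv Omega (fun z => \sum_(i <- s) c i * u i z)
        (fun j z => \sum_(i <- s) c i * Du i j z)].
Proof.
move=> Lu LDu wu; have sumE (w : I -> T -> R) i s' : (fun z => \sum_(i <- i :: s') c i * w i z) =
    (fun z => c i * w i z) \+ (fun z => \sum_(i <- s') c i * w i z).
  by apply/funext => z; rewrite big_cons.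
have sum0 (w : I -> T -> R) : (fun z => \sum_(i <- [::]) c i * w i z) = cst 0.
  by apply/funext => z; rewrite big_nil.
elim: s => [|i s [L1 L2 W]].
  split=> [|j|]; rewrite ?sum0; [exact/L1loc_continuous/cst_continuous..|].
  rewrite (_ : (fun j z => _) = (fun=> cst 0)); first exact: prod_weak_deriv0.
  by apply/funext => j; rewrite sum0.
split=> [|j|]; rewrite ?sumE.
- by apply: L1locD => //; exact: L1locZ.
- by apply: L1locD => //; exact: L1locZ.
rewrite (_ : (fun j z => _) = (fun j => (fun z => c i * Du i j z) \+
    (fun z => \sum_(i <- s) c i * Du i j z))); last first.
  by apply/funext => j; rewrite -sumE.
apply: prod_weak_derivD => //; [exact: L1locZ|by move=> j; exact: L1locZ|].
exact: prod_weak_derivZ.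
Qed.

Lemma weak_derivative_prod (f : T -> T) (Df : T -> 'M[R]_n) i :
  weak_derivative Omega f Df ->
  prod_weak_deriv Omega (fun x => f x ord0 i) (fun j x => Df x i j).
Proof.
move=> wf j p a b sp pab abO.
by rewrite -partial_deriv_rowprod//; apply: wf; exact: (test_function_rowprod sp pab abO).
Qed.

(** With [v] and [t] rows of matrices [S] and [T], this is a component of
    [S f - T x]. *)
Definition lincomb (v t : 'I_n -> R) (f : T -> T) (x : T) : R :=
  \sum_i v i * f x ord0 i - \sum_j t j * x ord0 j.

Lemma lincomb_weak_deriv (f : T -> T) (Df : T -> 'M[R]_n) (v t : 'I_n -> R) :
  W11loc Omega f Df ->
  let Du j x := \sum_i v i * Df x i j - t j in
  [/\ L1loc Omega (lincomb v t f), forall j, L1loc Omega (Du j) &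
      prod_weak_deriv Omega (lincomb v t f) Du].
Proof.
move=> [Lf LDf wf] Du.
have [L1 L2 W] := @prod_weak_deriv_sum _ (index_enum 'I_n) v (fun i x => f x ord0 i)
  (fun i j x => Df x i j) Lf LDf (fun i => weak_derivative_prod i wf).
have Lcoord k : L1loc Omega (fun x : T => x ord0 k).
  by apply: L1loc_continuous; exact: coord_continuous.
have Lcst (c : R) : L1loc Omega (cst c : T -> R).
  by apply: L1loc_continuous; exact: cst_continuous.
have [L1' L2' W'] := @prod_weak_deriv_sum _ (index_enum 'I_n) (fun k => - t k)
  (fun k x => x ord0 k) (fun k j => cst (j == k)%:R)
  Lcoord (fun k j => Lcst _) prod_weak_deriv_coord.
have uE : lincomb v t f = (fun x => \sum_i v i * f x ord0 i) \+
    (fun x => \sum_k (- t k) * x ord0 k).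
  apply/funext => x; rewrite /lincomb /= -sumrN; congr (_ + _).
  by apply: eq_bigr => k _; rewrite mulNr.
have DuE : Du = (fun j => (fun x => \sum_i v i * Df x i j) \+
    (fun x => \sum_k (- t k) * (j == k)%:R)).
  apply/funext => j; apply/funext => x; rewrite /Du /=; congr (_ + _).
  rewrite (bigD1 j)//= eqxx mulr1 big1 ?addr0// => k kj.
  by rewrite eq_sym (negPf kj) mulr0.
rewrite uE DuE; split=> [|j|].
- exact: (L1locD L1 L1').
- exact: (L1locD (L2 j) (L2' j)).
- exact: (prod_weak_derivD oO L1 L2 L1' L2' W W').
Qed.

End derivative_of_combinations.

(** * Mollification and the pointwise gradient estimate *)

Section kernels.
Context (R : realType).
Local Notation leb := (@lebesgue_measure R).

(** A primitive of the bump of mass [1] supported in [[c - r, c + r]]. *)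
Definition scaled_step (c r t : R) : R := step (r^-1 * t + - (c / r)).

Lemma smooth_scaled_step (c r : R) : smooth (scaled_step c r).
Proof. by apply: smooth_affine; exact: smooth_step_fun. Qed.

Lemma scaled_step_arg (c r t : R) : 0 < r -> r^-1 * t + - (c / r) = (t - c) / r.
Proof. by move=> r0; rewrite mulrC -mulrBl. Qed.

Lemma scaled_step0 (c r t : R) : 0 < r -> t <= c - r -> scaled_step c r t = 0.
Proof.
move=> r0 tcr; rewrite /scaled_step scaled_step_arg// step_le0//.
by rewrite ler_pdivrMr// mulN1r; lra.
Qed.

Lemma scaled_step1 (c r t : R) : 0 < r -> c + r <= t -> scaled_step c r t = 1.
Proof.
move=> r0 tcr; rewrite /scaled_step scaled_step_arg// step_ge1//.
by rewrite ler_pdivlMr// mul1r; lra.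
Qed.

Lemma scaled_step_diff_le (c r d s t : R) : `|scaled_step c r t - scaled_step d s t| <= 1.
Proof.
have := step_ge0 (r^-1 * t + - (c / r)); have := step_le1 (r^-1 * t + - (c / r)).
have := step_ge0 (s^-1 * t + - (d / s)); have := step_le1 (s^-1 * t + - (d / s)).
rewrite -!/(scaled_step _ _ _) => h1 h2 h3 h4.
by rewrite ler_norml; apply/andP; split; lra.
Qed.

Lemma derive1_scaled_step (c r t : R) :
  derive1 (scaled_step c r) t = r^-1 * derive1 (@step R) (r^-1 * t + - (c / r)).
Proof.
have [dS _] := smooth_derive1 (@smooth_step_fun R).
rewrite derive1E.
exact: (derive_val (is_derive := is_derive1_affine (dS (r^-1 * t + - (c / r))))).
Qed.

Lemma kernel_supp (c r t : R) : 0 < r -> derive1 (scaled_step c r) t != 0 -> c - r <= t <= c + r.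
Proof.
move=> r0; rewrite derive1_scaled_step mulf_eq0 negb_or => /andP[_ /derive1_step_supp].
rewrite scaled_step_arg// ler_pdivlMr// ler_pdivrMr// mulN1r mul1r => /andP[h1 h2].
by apply/andP; split; lra.
Qed.

Lemma kernel_integral (c r : R) : 0 < r -> \int[leb]_t derive1 (scaled_step c r) t = 1.
Proof.
move=> r0; pose M := `|c| + r.
have cM : - M <= c - r /\ c + r <= M.
  by rewrite /M; have := ler_norm c; have := ler_norm (- c); rewrite normrN; split; lra.
have M0 : 0 < M by rewrite /M ltr_wpDl.
have -> := integral_derive1 (smooth_scaled_step c r) M0.
  by rewrite scaled_step1 ?scaled_step0 ?subr0//; have [] := cM.
move=> t /kernel_supp => /(_ r0) /andP[h1 h2]; have [h3 h4] := cM.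
by apply/andP; split; lra.
Qed.

End kernels.

Section averages.
Context (R : realType) (n : nat).
Local Notation T := 'rV[R]_n.+1.
Local Notation mu := (lebesgue_Rn R n.+1).
Local Notation leb := (@lebesgue_measure R).

Definition mollifier (x : T) (r : R) : 'I_n.+1 -> R -> R :=
  fun i => derive1 (scaled_step (x ord0 i) r).

Definition cube (x : T) (r : R) : set T :=
  box (fun i => x ord0 i - r) (fun i => x ord0 i + r).

Lemma cubeP (x : T) r z : 0 <= r -> cube x r z <-> `|z - x| <= r.
Proof.
move=> r0; split=> [xz|zx i].
  apply: norm_le_coord => // i; rewrite !mxE ler_distl; exact: xz.
have := le_trans (coord_mx_le_norm (z - x) ord0 i) zx; by rewrite !mxE ler_distl.
Qed.

Lemma smooth_mollifier x r i : smooth (mollifier x r i).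
Proof. by have [] := smooth_derive1 (smooth_scaled_step (x ord0 i) r). Qed.

Lemma continuous_mollifier x r : continuous (rowprod (mollifier x r)).
Proof. by apply: continuous_rowprod_smooth; exact: smooth_mollifier. Qed.

Lemma mollifier_supp_in x r : 0 < r ->
  supp_in (mollifier x r) (fun i => x ord0 i - r) (fun i => x ord0 i + r).
Proof. by move=> r0 i t; exact: kernel_supp. Qed.

Lemma mollifier_supp_cube x r z : 0 < r -> rowprod (mollifier x r) z != 0 -> cube x r z.
Proof. by move=> r0; apply: rowprod_supp; exact: mollifier_supp_in. Qed.

Lemma Rintegral_mollifier x r : 0 < r -> \int[mu]_z rowprod (mollifier x r) z = 1.
Proof.
move=> r0; rewrite (Rintegral_rowprod _ (mollifier_supp_in (x := x) r0)) => [|i].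
  by rewrite big1// => i _; exact: kernel_integral.
by apply: smooth_continuous; exact: smooth_mollifier.
Qed.

Variables (C : R) (C0 : 0 < C) (stepC : forall t : R, `|derive1 (@step R) t| <= C).

Lemma kernel1_bound (c r t : R) : 0 < r -> `|derive1 (scaled_step c r) t| <= C / r.
Proof.
move=> r0; rewrite derive1_scaled_step normrM [leLHS]mulrC [X in _ * X]gtr0_norm ?invr_gt0//.
by apply: ler_wpM2r => //; rewrite invr_ge0 ltW.
Qed.

Lemma mollifier_bound x r z : 0 < r -> `|rowprod (mollifier x r) z| <= (C / r) ^+ n.+1.
Proof.
move=> r0; rewrite /rowprod normr_prod -[n.+1 in leRHS]card_ord -prodr_const.
by apply: ler_prod => i _; rewrite normr_ge0 /=; exact: kernel1_bound.
Qed.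

(** The factor in direction [j] is the difference of two steps, a compactly
    supported primitive of the difference of the two kernels. *)
Definition transport (x y : T) (r s : R) (j : 'I_n.+1) : 'I_n.+1 -> R -> R :=
  upd (hybrid (mollifier x r) (mollifier y s) j) j
    (fun t => scaled_step (x ord0 j) r t - scaled_step (y ord0 j) s t).

Lemma smooth_transport x y r s j i : smooth (transport x y r s j i).
Proof.
apply: smooth_upd => [k|].
  by rewrite /hybrid; case: ifP => _; exact: smooth_mollifier.
rewrite (_ : (fun t => _) = scaled_step (x ord0 j) r \+
    (cst (-1) \* scaled_step (y ord0 j) s)).
  apply: smoothD; first exact: smooth_scaled_step.
  by apply: smoothM; [exact: smooth_cst|exact: smooth_scaled_step].
by apply/funext => t /=; rewrite mulN1r.
Qed.

Lemma derive1_transport x y r s j :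
  derive1 (transport x y r s j j) = (fun t => mollifier x r j t - mollifier y s j t).
Proof.
rewrite /transport /upd eqxx; apply/funext => t; rewrite derive1E.
have [dx _] := smooth_derive1 (smooth_scaled_step (x ord0 j) r).
have [dy _] := smooth_derive1 (smooth_scaled_step (y ord0 j) s).
exact: (derive_val (is_derive := is_deriveB (dx t) (dy t))).
Qed.

(** The difference of two mollifiers is a sum of partial derivatives of compactly
    supported products, so that its integral against [u] only involves the weak
    derivatives of [u]. *)
Lemma mollifier_diff x y r s z :
  rowprod (mollifier x r) z - rowprod (mollifier y s) z =
  \sum_j rowprod (upd (transport x y r s j) j (derive1 (transport x y r s j j))) z.
Proof.
rewrite /rowprod prod_telescope; apply: eq_bigr => j _.
rewrite -/(rowprod _ z) rowprod_upd derive1_transport; congr (_ * _).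
by apply: eq_bigr => i ij; rewrite /transport /upd (negPf ij) /hybrid; case: ifP.
Qed.

Section nearby.
Variables (x y : T) (r s : R).
Hypotheses (s0 : 0 < s) (sr : s <= r) (rs : r <= 2 * s) (xy : `|x - y| <= r).

Let r0 : 0 < r. Proof. exact: lt_le_trans s0 sr. Qed.

Let xyi i : x ord0 i - r <= y ord0 i <= x ord0 i + r.
Proof. by have := le_trans (coord_mx_le_norm (x - y) ord0 i) xy; rewrite !mxE distrC ler_distl. Qed.

Lemma transport_supp_in j : supp_in (transport x y r s j)
  (fun i => x ord0 i - 2 * r) (fun i => x ord0 i + 2 * r).
Proof.
apply: supp_in_upd => [i t|t].
  have /andP[h1 h2] := xyi i.
  rewrite /hybrid /=; case: ifP => _ kt.
    have /andP[h3 h4] : y ord0 i - s <= t <= y ord0 i + s by exact: kernel_supp s0 kt.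
    have A1 : x ord0 i - 2 * r <= t by move: sr r0; lra.
    have A2 : t <= x ord0 i + 2 * r by move: sr r0; lra.
    by rewrite A1.
  have /andP[h3 h4] : x ord0 i - r <= t <= x ord0 i + r by exact: kernel_supp r0 kt.
  have A1 : x ord0 i - 2 * r <= t by move: sr r0; lra.
  have A2 : t <= x ord0 i + 2 * r by move: sr r0; lra.
  by rewrite A1.
have /andP[h1 h2] := xyi j.
apply: contraNT; rewrite negb_and -!ltNge => /orP[h|h].
  by rewrite !scaled_step0 ?subrr//; move: sr r0; lra.
by rewrite !scaled_step1 ?subrr//; move: sr r0; lra.
Qed.

Lemma transport_bound j z : `|rowprod (transport x y r s j) z| <= (2 * C / r) ^+ n.
Proof.
rewrite rowprod_upd normrM -[leRHS]mul1r; apply: ler_pM => //.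
  exact: scaled_step_diff_le.
rewrite normr_prod.
have -> : (2 * C / r) ^+ n = \prod_(i < n.+1 | i != j) (2 * C / r).
  rewrite prodr_const; congr (_ ^+ _).
  transitivity #|predC1 j|; first by rewrite cardC1 card_ord.
  by apply: eq_card => i; rewrite !inE.
apply: ler_prod => i _; rewrite normr_ge0 /= /hybrid; case: ifP => _.
  apply: (le_trans (kernel1_bound _ _ s0)).
  rewrite ler_pdivrMr// mulrAC ler_pdivlMr//; move: rs C0; nra.
apply: (le_trans (kernel1_bound _ _ r0)); rewrite ler_pM2r ?invr_gt0//; move: C0; lra.
Qed.

End nearby.

End averages.

Section pointwise_estimate.
Context (R : realType) (n : nat).
Local Notation T := 'rV[R]_n.+1.
Local Notation mu := (lebesgue_Rn R n.+1).
Variables (C : R) (C0 : 0 < C) (stepC : forall t : R, `|derive1 (@step R) t| <= C).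
Variables (Omega : set T) (oO : open Omega).
Variables (u : T -> R) (Du : 'I_n.+1 -> T -> R).
Hypotheses (Lu : L1loc Omega u) (LDu : forall j, L1loc Omega (Du j))
  (wu : prod_weak_deriv Omega u Du).

Let mO : measurable Omega. Proof. exact: open_measurable_mx. Qed.

Definition mean (x : T) (r : R) := \int[mu]_(z in Omega) (u z * rowprod (mollifier x r) z).

Definition abs_sum (z : T) : R := \sum_j `|Du j z|.

Lemma Rintegral_sum (I : Type) (s : seq I) (g : I -> T -> R) :
  (forall i, mu.-integrable Omega (EFin \o g i)) ->
  \int[mu]_(z in Omega) (\sum_(i <- s) g i z) = \sum_(i <- s) \int[mu]_(z in Omega) g i z.
Proof.
move=> ig; elim: s => [|i s IH].
  by under eq_Rintegral => z _ do rewrite big_nil; rewrite big_nil Rintegral_cst// mul0r.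
under eq_Rintegral => z _ do rewrite big_cons.
rewrite big_cons RintegralD// ?IH//.
have := integrable_sum mO s (P := xpredT) (fun i _ => ig i).
by apply: eq_integrable => // z _ /=; rewrite sumEFin.
Qed.

Lemma cube_sub_ball (x : 'rV[R]_n.+1) (r d : R) : 0 <= r -> r < d -> cube x r `<=` ball x d.
Proof.
move=> r0 rd z /(cubeP _ _ r0) zx.
by rewrite mx_norm_ball /ball_ /= distrC (le_lt_trans zx).
Qed.

Lemma measurable_cube (x : T) r : measurable (cube x r).
Proof. exact: measurable_box. Qed.

(** By [mollifier_diff], moving the mollifier costs an integral of the weak
    derivatives against the functions [transport], which are of size [r ^ -n] on a
    cube of side [4 r]. *)
Lemma mean_diff (x y : T) (r s : R) : 0 < s -> s <= r -> r <= 2 * s -> `|x - y| <= r ->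
  cube x (2 * r) `<=` Omega ->
  (`|mean x r - mean y s|%:E <=
   ((2 * C / r) ^+ n)%:E * \int[mu]_(z in cube x (2 * r)) (abs_sum z)%:E)%E.
Proof.
move=> s0 sr rs xy xO; have r0 := lt_le_trans s0 sr.
have xr : cube x r `<=` Omega.
  apply: subset_trans xO => z xz i; have := xz i; move=> /andP[h1 h2].
  by apply/andP; split; move: r0 h1 h2; lra.
have ys : cube y s `<=` Omega.
  apply: subset_trans xO => z /(cubeP _ _ (ltW s0)) zy; apply/(cubeP _ _ _); first by lra.
  rewrite -(subrKA y) (le_trans (ler_normD _ _))// distrC [X in _ + X]distrC.
  by rewrite distrC in zy; move: zy xy sr; lra.
have ik (x' : T) r' : 0 < r' -> cube x' r' `<=` Omega ->
    mu.-integrable Omega (EFin \o (fun z => u z * rowprod (mollifier x' r') z)).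
  move=> r'0 xr'; apply: (integrable_mul_supp oO Lu _ xr'); first exact: continuous_mollifier.
  by move=> z; exact: mollifier_supp_cube.
have tsupp j := @transport_supp_in R n x y r s s0 sr xy j.
pose tr := transport x y r s.
have st j i : smooth (tr j i) by exact: smooth_transport.
have it j : mu.-integrable Omega (EFin \o
    (fun z => u z * rowprod (upd (tr j) j (derive1 (tr j j))) z)).
  apply: (integrable_mul_supp oO Lu _ xO).
    by apply: continuous_rowprod_smooth; exact: smooth_upd1.
  by move=> z; apply: rowprod_supp; exact: supp_in_upd1.
have -> : mean x r - mean y s = - \sum_j \int[mu]_(z in Omega) (Du j z * rowprod (tr j) z).
  rewrite /mean -RintegralB//; [|exact: ik|exact: ik].
  under eq_Rintegral => z _ do rewrite -mulrBr mollifier_diff mulr_sumr.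
  rewrite (Rintegral_sum _ it) -sumrN; apply: eq_bigr => j _.
  exact: (wu _ (st j) (tsupp j) xO).
rewrite normrN; apply: (@le_trans _ _ (\sum_j
    `|\int[mu]_(z in Omega) (Du j z * rowprod (tr j) z)|)%:E).
  by rewrite lee_fin; exact: ler_norm_sum.
have mb := @measurable_cube x (2 * r).
have mDu j : measurable_fun (cube x (2 * r)) (fun z => `|(Du j z)%:E|)%E.
  apply: measurableT_comp => //; apply/measurable_EFinP.
  by case: (LDu j) => + _; exact: measurable_funS.
rewrite -sumEFin /abs_sum.
under [in leRHS]eq_integral => z _ do rewrite -sumEFin.
rewrite ge0_integral_sum//.
rewrite ge0_sume_distrr; last by move=> j _; apply: integral_ge0 => z _; rewrite lee_fin.
apply: lee_sum => j _.
have tb z : `|rowprod (tr j) z| <= (2 * C / r) ^+ n.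
  exact: (transport_bound C0 stepC).
apply: (le_integral_mul_supp oO (LDu j) _ xO _ _ tb).
- exact: continuous_rowprod_smooth.
- by move=> z; exact: rowprod_supp.
- by rewrite exprn_ge0// divr_ge0 ?ltW// mulr_gt0.
Qed.

Definition good_point (e d : R) (x : T) := forall r, 0 < r -> r < d ->
  ball x r `<=` Omega /\
  (\int[mu]_(z in ball x r) (abs_sum z)%:E <= e%:E * mu (ball x r))%E.

(* The cube of [mean_diff] lies in a ball of volume [(6 r) ^ n.+1]. *)
Let A : R := (2 * C) ^+ n * 6 ^+ n.+1.

Lemma mean_diff_good (e d : R) (x y : T) (r s : R) : 0 <= e -> good_point e d x ->
  0 < s -> s <= r -> r <= 2 * s -> `|x - y| <= r -> 3 * r < d ->
  `|mean x r - mean y s| <= A * e * r.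
Proof.
move=> e0 gx s0 sr rs xy rd; have r0 := lt_le_trans s0 sr.
have r30 : 0 < 3 * r by rewrite mulr_gt0.
have [bO be] := gx _ r30 rd.
have cb : cube x (2 * r) `<=` ball x (3 * r).
  by apply: cube_sub_ball; move: r0; lra.
have := mean_diff s0 sr rs xy (subset_trans cb bO).
have mAbs : measurable_fun (ball x (3 * r)) (fun z => (abs_sum z)%:E).
  apply/measurable_EFinP; apply: measurable_sum => j; apply: measurableT_comp => //.
  by case: (LDu j) => + _; apply: measurable_funS.
have C20 : 0 <= (2 * C / r) ^+ n by rewrite exprn_ge0// divr_ge0 ?ltW// mulr_gt0.
have abs0 z : (0 <= (abs_sum z)%:E)%E by rewrite lee_fin sumr_ge0.
move=> /le_trans => /(_ (((2 * C / r) ^+ n)%:E * (e%:E * mu (ball x (3 * r))))%E).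
rewrite -lee_fin => H; apply: (le_trans (H _)).
  apply: lee_wpmul2l; first by rewrite lee_fin.
  apply: le_trans be; apply: ge0_subset_integral => //; [exact: measurable_cube|exact: measurable_ball_mx].
rewrite lebesgue_Rn_ball// -!EFinM lee_fin le_eqVlt; apply/orP; left; apply/eqP.
have -> : (3 * r) *+ 2 = 6 * r by rewrite -mulr_natr; ring.
rewrite expr_div_n [(6 * r) ^+ _]exprMn [r ^+ n.+1]exprS /A.
have rn0 : r ^+ n != 0 by rewrite expf_neq0// gt_eqF.
move: (r ^+ n) ((2 * C) ^+ n) (6 ^+ n.+1) rn0 => q c k q0.
by field.
Qed.

(** Halving the radius [k] times costs a geometric series, dominated by its first
    term. *)
Lemma mean_near (e d : R) (x : T) (r : R) : 0 <= e -> good_point e d x ->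
  0 < r -> 3 * r < d -> forall k, `|mean x r - mean x (r / 2 ^+ k)| <= 2 * A * e * r * (1 - (2 ^+ k)^-1).
Proof.
move=> e0 gx r0 rd; have A0 : 0 <= A.
  by rewrite /A mulr_ge0 ?exprn_ge0// mulr_ge0// ltW.
elim=> [|k IH]; first by rewrite expr0 invr1 mulr1 !subrr normr0 mulr0.
have p0 : 0 < (2 : R) ^+ k by rewrite exprn_gt0.
have rk0 : 0 < r / 2 ^+ k.+1 by rewrite divr_gt0// exprn_gt0.
have rkE : r / 2 ^+ k = 2 * (r / 2 ^+ k.+1).
  by rewrite exprS; field; rewrite gt_eqF.
rewrite -(subrKA (mean x (r / 2 ^+ k))); apply: le_trans (ler_normD _ _) _.
have rkr : r / 2 ^+ k <= r.
  rewrite ler_pdivrMr//; apply: ler_peMr; [exact: ltW|by apply: exprn_ege1; rewrite ler1n].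
have := @mean_diff_good e d x x (r / 2 ^+ k) (r / 2 ^+ k.+1) e0 gx rk0.
rewrite subrr normr0 => /(_ _ _ _ _) H.
have {}H : `|mean x (r / 2 ^+ k) - mean x (r / 2 ^+ k.+1)| <= A * e * (r / 2 ^+ k).
  apply: H; first by rewrite rkE ler_peMl ?ler1n// ltW.
  - by rewrite rkE.
  - by rewrite divr_ge0 ?ltW.
  - by apply: le_lt_trans rd; rewrite ler_pM2l.
apply: le_trans (lerD IH H) _.
rewrite le_eqVlt; apply/orP; left; apply/eqP; rewrite exprS.
by field; rewrite gt_eqF.
Qed.

(** The mollifiers have mass [1] and [L^1] norms bounded independently of [r], so
    the means of a continuous function converge to its value. *)
Lemma mean_cvg (x : T) : Omega x -> {within Omega, continuous u} ->
  forall e, 0 < e -> exists2 d, 0 < d & forall r, 0 < r -> r < d -> `|mean x r - u x| <= e.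
Proof.
move=> Ox cu e e0.
have cux : {for x, continuous u}.
  by move: cu; rewrite continuous_open_subspace// => /(_ x); apply; exact/mem_set.
(* [M] is the bound [(C / r) ^ n.+1] on the mollifier times the volume
   [(4 r) ^ n.+1] of a ball containing its support. *)
pose M := (4 * C) ^+ n.+1; have M0 : 0 < M by rewrite exprn_gt0// mulr_gt0.
have /nbhs_ballP[d1 /= d10 xd1] : nbhs x Omega by apply: open_nbhs_nbhs; split.
move/cvgrPdist_le : cux => /(_ (e / M) (divr_gt0 e0 M0)) /nbhs_ballP[d2 /= d20 xd2].
exists (Num.min d1 d2); first by rewrite lt_min d10.
move=> r r0; rewrite lt_min => /andP[rd1 rd2].
have xrO : cube x r `<=` Omega.
  by apply: subset_trans xd1; apply: cube_sub_ball => //; exact: ltW.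
have Lcst (c : R) : L1loc Omega (cst c).
  by apply: L1loc_continuous; exact: cst_continuous.
have Lc := Lcst (- u x).
have Luc : L1loc Omega (u \+ cst (- u x)) by exact: L1locD.
have mk w : L1loc Omega w -> mu.-integrable Omega (EFin \o (fun z => w z * rowprod (mollifier x r) z)).
  move=> Lw; apply: (integrable_mul_supp oO Lw _ xrO); first exact: continuous_mollifier.
  by move=> z; exact: mollifier_supp_cube.
have ->: mean x r - u x = \int[mu]_(z in Omega) ((u \+ cst (- u x)) z * rowprod (mollifier x r) z).
  under [in RHS]eq_Rintegral => z _ do rewrite /= mulrDl.
  rewrite RintegralD//; [|exact: mk|exact: (mk (cst (- u x)))].
  congr (_ + _); rewrite RintegralZl//.
    by rewrite (Rintegral_supp xrO) ?Rintegral_mollifier ?mulr1// => z; exact: mollifier_supp_cube.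
  have := mk (cst 1) (Lcst 1).
  by apply: eq_integrable => // z _ /=; rewrite mul1r.
have kb z : `|rowprod (mollifier x r) z| <= (C / r) ^+ n.+1 by exact: mollifier_bound.
have C00 : 0 <= (C / r) ^+ n.+1 by rewrite exprn_ge0// divr_ge0// ltW.
rewrite -lee_fin; apply: (le_trans (le_integral_mul_supp oO Luc _ xrO _ C00 kb)).
- exact: continuous_mollifier.
- by move=> z; exact: mollifier_supp_cube.
apply: (@le_trans _ _ (((C / r) ^+ n.+1)%:E * ((e / M)%:E * mu (cube x r)))%E).
  apply: lee_wpmul2l; first by rewrite lee_fin.
  rewrite -integral_cst; last exact: measurable_cube.
  apply: ge0_le_integral => //; first exact: measurable_cube.
  - apply: measurableT_comp => //; apply/measurable_EFinP.
    by case: Luc => + _; apply: measurable_funS.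
  - move=> z xz; rewrite /= lee_fin distrC; apply: xd2.
    by apply: (cube_sub_ball (ltW r0) rd2).
apply: (@le_trans _ _ (((C / r) ^+ n.+1)%:E * ((e / M)%:E * mu (ball x (2 * r))%R))%E).
  apply: lee_wpmul2l; first by rewrite lee_fin.
  apply: lee_wpmul2l; first by rewrite lee_fin divr_ge0// ltW.
  apply: le_measure; [apply/mem_set; exact: measurable_cube|apply/mem_set; exact: measurable_ball_mx|].
  by apply: cube_sub_ball; [exact: ltW|move: r0; lra].
rewrite lebesgue_Rn_ball ?mulr_gt0// -!EFinM lee_fin.
have -> : (2 * r) *+ 2 = 4 * r by rewrite -mulr_natr; ring.
rewrite expr_div_n /M !exprMn le_eqVlt; apply/orP; left; apply/eqP.
have rn0 : r ^+ n.+1 != 0 by rewrite expf_neq0// gt_eqF.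
have Cn0 : C ^+ n.+1 != 0 by rewrite expf_neq0// gt_eqF.
have n0 : (4 : R) ^+ n.+1 != 0 by rewrite expf_neq0.
move: (r ^+ n.+1) (C ^+ n.+1) (4 ^+ n.+1) rn0 Cn0 n0 => q c k q0 c0 k0.
by field; rewrite q0 c0 k0.
Qed.

Lemma mean_good (e d : R) (x : T) (r : R) : 0 <= e -> good_point e d x -> Omega x ->
  {within Omega, continuous u} ->
  0 < r -> 3 * r < d -> `|mean x r - u x| <= 2 * A * e * r.
Proof.
move=> e0 gx Ox cu r0 rd.
have A0 : 0 <= A by rewrite /A mulr_ge0 ?exprn_ge0// mulr_ge0// ltW.
apply/ler_addgt0Pr => h h0.
have [d' d'0 Hd'] := mean_cvg Ox cu h0.
have [k] := @ltr_add_invr R 0 (d' / r) (divr_gt0 d'0 r0); rewrite add0r => kd.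
have p0 : 0 < (2 : R) ^+ k by rewrite exprn_gt0.
have k2 : (k.+1%:R : R) <= 2 ^+ k.
  by rewrite -natrX ler_nat ltn_expl.
have rk0 : 0 < r / 2 ^+ k by rewrite divr_gt0.
have rkd : r / 2 ^+ k < d'.
  rewrite mulrC -ltr_pdivlMr//; apply: le_lt_trans kd.
  by rewrite lef_pV2 ?posrE.
rewrite -(subrKA (mean x (r / 2 ^+ k))); apply: le_trans (ler_normD _ _) _.
apply: lerD; last exact: Hd'.
apply: (le_trans (mean_near e0 gx r0 rd k)).
have K0 : 0 <= 2 * A * e * r.
  by apply: mulr_ge0; [apply: mulr_ge0 => //; exact: mulr_ge0|exact: ltW].
have i0 : 0 <= ((2 : R) ^+ k)^-1 by rewrite invr_ge0 ltW.
by rewrite -[leRHS]mulr1; apply: ler_wpM2l => //; rewrite gerBl.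
Qed.

(** Two means at scale [|x - y|] are compared with each other and with the values
    [u x] and [u y], which costs [1 + 2 + 2] times the same quantity. *)
Lemma good_points_lipschitz_step (e d : R) (x y : T) : 0 <= e ->
  good_point e d x -> good_point e d y -> Omega x -> Omega y ->
  {within Omega, continuous u} -> 3 * `|x - y| < d ->
  `|u x - u y| <= (5 * ((2 * C) ^+ n * 6 ^+ n.+1)) * e * `|x - y|.
Proof.
move=> e0 gx gy Ox Oy cu xyd.
have A0 : 0 <= A by rewrite /A mulr_ge0 ?exprn_ge0// mulr_ge0// ltW.
have [->|xy] := eqVneq x y; first by rewrite !(subrr, normr0) mulr0.
have r0 : 0 < `|x - y| by rewrite normr_gt0 subr_eq0.
have h1 := mean_good e0 gx Ox cu r0 xyd.
have h2 := mean_good e0 gy Oy cu r0 xyd.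
have h3 : `|mean x `|x - y| - mean y `|x - y| | <= A * e * `|x - y|.
  by apply: mean_diff_good gx _ _ _ _ _ => //; move: r0; lra.
have split4 (a b c k : R) : a - b = - (c - a) + (c - k) + (k - b) by ring.
rewrite (split4 _ _ (mean x `|x - y|) (mean y `|x - y|)).
apply: le_trans (ler_normD _ _) _; apply: le_trans (lerD (ler_normD _ _) (lexx _)) _.
rewrite normrN.
have gen (a er p q s : R) : p <= 2 * a * er -> q <= a * er -> s <= 2 * a * er -> p + q + s <= 5 * a * er by lra.
rewrite -/A -(mulrA _ e); apply: gen; rewrite (mulrA _ e).
- exact: h1.
- exact: h3.
- exact: h2.
Qed.

End pointwise_estimate.

(** The constant is shared by all domains and functions, so that it is known
    before the tolerances [e] of the pieces, which depend on it, are chosen. *)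
Definition gradient_lipschitz_constant (R : realType) n (B : R) :=
  forall (Omega : set 'rV[R]_n.+1) u Du, open Omega ->
  L1loc Omega u -> (forall j, L1loc Omega (Du j)) -> prod_weak_deriv Omega u Du ->
  {within Omega, continuous u} -> forall (e d : R) (x y : 'rV[R]_n.+1), 0 <= e ->
  good_point Omega Du e d x -> good_point Omega Du e d y -> Omega x -> Omega y ->
  3 * `|x - y| < d -> `|u x - u y| <= B * e * `|x - y|.

Lemma good_points_lipschitz (R : realType) n :
  exists2 B : R, 0 < B & gradient_lipschitz_constant n B.
Proof.
have [C C0 stepC] := @derive1_step_bound R.
exists (5 * ((2 * C) ^+ n * 6 ^+ n.+1)).
  by rewrite !mulr_gt0 ?exprn_gt0// mulr_gt0.
move=> Omega u Du oO Lu LDu wu cu e d x y e0 gx gy Ox Oy xyd.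
apply: (good_points_lipschitz_step C0 stepC oO Lu LDu wu e0 gx gy Ox Oy cu xyd).
Qed.

(** * Decomposition into Lipschitz pieces *)

Section lipschitz_pieces.
Context (R : realType) (n : nat).
Local Notation T := 'rV[R]_n.+1.
Local Notation mu := (lebesgue_Rn R n.+1).
Variables (Omega : set T) (oO : open Omega).

(** The set of good points need not be Borel; its relative closure is. *)
Lemma closure_lipschitz (u : T -> R) (D : set T) (L : R) : 0 <= L ->
  {within Omega, continuous u} -> D `<=` Omega ->
  (forall x y, D x -> D y -> `|u x - u y| <= L * `|x - y|) ->
  forall x y, (closure D `&` Omega) x -> (closure D `&` Omega) y ->
  `|u x - u y| <= L * `|x - y|.
Proof.
move=> L0 cu DO uD.
have near x (h : R) : (closure D `&` Omega) x -> 0 < h ->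
    exists x', [/\ D x', `|u x - u x'| <= h & `|x - x'| <= h].
  move=> [clx Ox] h0.
  have cux : {for x, continuous u}.
    by move: cu; rewrite continuous_open_subspace// => /(_ x); apply; exact/mem_set.
  move/cvgrPdist_le : cux => /(_ h h0) /nbhs_ballP[d /= d0 xd].
  have hd0 : 0 < Num.min d h by rewrite lt_min d0.
  have [x' [Dx']] := clx _ (nbhsx_ballx x _ hd0).
  rewrite mx_norm_ball /ball_ /= lt_min => /andP[xx'd xx'h].
  exists x'; split=> //; last exact: ltW.
  by apply: xd; rewrite mx_norm_ball.
move=> x y cx cy; apply/ler_addgt0Pr => e e0.
pose h := e / (2 + 2 * L); have L1 : 0 < 2 + 2 * L by rewrite ltr_pwDl// mulr_ge0.
have h0 : 0 < h by rewrite divr_gt0.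
have [x' [Dx' ux xx']] := near _ _ cx h0; have [y' [Dy' uy yy']] := near _ _ cy h0.
have uxy := uD _ _ Dx' Dy'.
have xy' : `|x' - y'| <= h + `|x - y| + h.
  have -> : x' - y' = (x' - x) + (x - y) + (y - y') by rewrite !subrKA.
  apply: le_trans (ler_normD _ _) _; apply: lerD => //.
  by apply: le_trans (ler_normD _ _) _; apply: lerD => //; rewrite distrC.
have split3 (a b c k : R) : a - b = (a - c) + (c - k) - (b - k) by ring.
rewrite (split3 _ _ (u x') (u y')).
apply: le_trans (ler_normB _ _) _; apply: le_trans (lerD (ler_normD _ _) (lexx _)) _.
have eE : e = 2 * h + 2 * (L * h) by rewrite /h; field; rewrite gt_eqF.
have := ler_wpM2l L0 xy'; rewrite !mulrDr => h1.
move: ux uy uxy h1; rewrite eE.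
by move: `|u x - u x'| `|u y - u y'| `|u x' - u y'| (L * `|x' - y'|) (L * `|x - y|) (L * h) => *; lra.
Qed.

(** Rational balls with closure in [Omega]: countably many sets that cover [Omega]
    and on which locally integrable functions are integrable. *)
Definition inner_ball (q : 'rV[rat]_n.+1 * rat) : set T :=
  if asbool (cube (rat_ball R q).1 (rat_ball R q).2 `<=` Omega)
  then ball (rat_ball R q).1 (rat_ball R q).2 else set0.

Lemma open_inner_ball q : open (inner_ball q).
Proof.
rewrite /inner_ball; case: ifP => _; last exact: open0.
exact: (ball_open (rat_ball R q).1 (rat_ball R q).2).
Qed.

Lemma inner_ball_sub q : inner_ball q `<=` Omega.
Proof.
rewrite /inner_ball; case: ifPn => [/asboolP qO z zq|_ z []]; apply: qO; move: zq.
rewrite mx_norm_ball /ball_ /= => zq; have q0 := le_lt_trans (normr_ge0 _) zq.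
by apply/cubeP; [exact: ltW|rewrite distrC ltW].
Qed.

Lemma inner_ball_cover x : Omega x -> exists q, inner_ball q x.
Proof.
move=> Ox; have /nbhs_ballP[d /= d0 xd] : nbhs x Omega by apply: open_nbhs_nbhs; split.
have d8 : 0 < d / 8 by rewrite divr_gt0.
have [q [q0 qr xq qx]] := rat_ball_approx x d8.
exists q; rewrite /inner_ball ifT; first by apply: xq; exact: ballxx.
apply/asboolP; apply: subset_trans xd => z /(cubeP _ _ (ltW q0)) zq.
have := qx _ (ballxx _ q0); rewrite mx_norm_ball /ball_ /= => cx.
rewrite -(subrKA (rat_ball R q).1) (le_lt_trans (ler_normD _ _))//.
by rewrite distrC in zq; move: cx zq qr d0; lra.
Qed.

Lemma L1loc_inner_ball (w : T -> R) q : L1loc Omega w -> (forall x, 0 <= w x) ->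
  (\int[mu]_(x in inner_ball q) (w x)%:E < +oo)%E.
Proof.
move=> [mw Lw] w0; rewrite /inner_ball; case: ifPn => [/asboolP qO|_]; last first.
  by rewrite integral_set0 ltry.
have /integrableP[mwq] := Lw _ qO (@compact_box R n.+1 _ _); apply: le_lt_trans.
have cmeas := @measurable_box R n.+1.
apply: (@le_trans _ _ (\int[mu]_(x in cube (rat_ball R q).1 (rat_ball R q).2) (w x)%:E)%E).
  apply: ge0_subset_integral => //; [exact: measurable_ball_mx|exact: cmeas|by move=> x _; rewrite lee_fin|].
  move=> z; rewrite mx_norm_ball /ball_ /= => zq; have q0 := le_lt_trans (normr_ge0 _) zq.
  by apply/cubeP; [exact: ltW|rewrite distrC ltW].
apply: ge0_le_integral => //; [exact: cmeas|by move=> x _; rewrite lee_fin| |].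
- by apply: measurableT_comp.
- by move=> x _ /=; rewrite lee_fin ler_norm.
Qed.

Lemma null_bigcup (I : countType) (Z : I -> set T) :
  (forall i, measurable (Z i) /\ mu (Z i) = 0%E) ->
  measurable (\bigcup_i Z i) /\ mu (\bigcup_i Z i) = 0%E.
Proof.
move=> HZ; pose ZN k := if @pickle_inv I k is Some i then Z i else set0.
have mZN k : measurable (ZN k) /\ mu (ZN k) = 0%E.
  by rewrite /ZN; case: pickle_inv => [i|]; [exact: HZ|rewrite measure0].
have -> : \bigcup_i Z i = \bigcup_k ZN k.
  apply/seteqP; split=> [x [i _ Zx]|x [k _]].
    by exists (pickle i) => //; rewrite /ZN pickleK_inv.
  by rewrite /ZN; case: pickle_inv => // i Zx; exists i.
split; first by apply: bigcupT_measurable => k; have [] := mZN k.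
apply/eqP; rewrite eq_le measure_ge0 andbT.
apply: (le_trans (measure_sigma_subadditive _ (fun k => (mZN k).1) _ (@subset_refl _ _))).
  by apply: bigcupT_measurable => k; have [] := mZN k.
by rewrite eseries0// => k _ _; have [] := mZN k.
Qed.

Definition piece_index := (nat * 'rV[int]_n.+1)%type.

(** Almost every point with gradient less than [e] is a good point for [2 * e] up
    to some radius [1 / (m + 1)]; such points are sorted by [m] and by a grid cell
    so fine that the estimate for nearby good points applies inside it. *)
Lemma lipschitz_pieces (B : R) : 0 < B ->
  gradient_lipschitz_constant n B ->
  forall u Du, L1loc Omega u -> (forall j, L1loc Omega (Du j)) ->
  prod_weak_deriv Omega u Du -> {within Omega, continuous u} ->
  forall e, 0 < e -> exists F : piece_index -> set T, exists Z : set T,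
  [/\ forall i, measurable (F i) /\ F i `<=` Omega,
      measurable Z /\ mu Z = 0%E,
      forall x, Omega x -> abs_sum Du x < e -> ~ Z x -> exists i, F i x &
      forall i x y, F i x -> F i y -> `|u x - u y| <= B * (2 * e) * `|x - y|].
Proof.
move=> B0 HB u Du Lu LDu wu cu e e0.
have e20 : 0 <= 2 * e by rewrite mulr_ge0// ltW.
have w0 x : 0 <= abs_sum Du x by exact: sumr_ge0.
have Lw : L1loc Omega (abs_sum Du).
  have L1 (g : T -> R) : L1loc Omega g -> L1loc Omega (fun x => `|g x|).
    move=> [mg Lg]; split; first by apply: measurableT_comp.
    move=> K KO cK.
    have mK : measurable K.
      by apply: closed_measurable_mx; apply: compact_closed => //; exact: norm_hausdorff.
    have := integrable_abse (Lg K KO cK).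
    by apply: eq_integrable.
  have Ls (s : seq 'I_n.+1) : L1loc Omega (fun x => \sum_(j <- s) `|Du j x|).
    elim: s => [|j s IH].
      rewrite (_ : (fun _ => _) = cst 0); last by apply/funext => x; rewrite big_nil.
      by apply: L1loc_continuous; exact: cst_continuous.
    rewrite (_ : (fun _ => _) = (fun x => `|Du j x|) \+ (fun x => \sum_(j <- s) `|Du j x|)).
      by apply: L1locD => //; apply: L1; exact: LDu.
    by apply/funext => x; rewrite big_cons.
  exact: Ls.
have mO := open_measurable_mx oO.
have /choice[Z HZ] q : exists Z, (measurable Z /\ mu Z = 0%E) /\
    forall x, inner_ball q x -> abs_sum Du x < e -> ~ Z x ->
    exists2 d, 0 < d & forall r, 0 < r -> r < d -> ball x r `<=` inner_ball q /\
      (\int[mu]_(y in ball x r) (abs_sum Du y)%:E <= (2 * e)%:E * mu (ball x r))%E.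
  have [|Z [mZ Z0] HZ] := @ae_small_average R n.+1 (inner_ball q) (abs_sum Du) e
     (@open_inner_ball q) _ w0 (L1loc_inner_ball q Lw w0) e0.
    by case: Lw => + _; apply: measurable_funS => // z; exact: inner_ball_sub.
  by exists Z.
pose G (m : nat) := [set x | Omega x /\ good_point Omega Du (2 * e) m.+1%:R^-1 x].
(* The estimate needs [3 * |x - y| < 1 / (m + 1)]. *)
pose s (m : nat) : R := (4 * m.+1%:R)^-1.
have s0 m : 0 < s m by rewrite invr_gt0 mulr_gt0.
pose D (i : piece_index) := G i.1 `&` grid_cell (s i.1) i.2.
exists (fun i => closure (D i) `&` Omega), (\bigcup_q Z q); split.
- move=> i; split; last by move=> x [].
  by apply: measurableI => //; apply: closed_measurable_mx; exact: closed_closure.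
- by apply: null_bigcup => q; have [] := HZ q.
- move=> x Ox wx nZ; have [q qx] := inner_ball_cover Ox.
  have nZq : ~ Z q x by move=> Zx; apply: nZ; exists q.
  have [_ /(_ x qx wx nZq)[d d0 Hd]] := HZ q.
  have [m] := @ltr_add_invr R 0 d d0; rewrite add0r => md.
  have [z zx] := grid_cell_cover (s m) x.
  exists (m, z); split=> //; apply: subset_closure; split=> //; split=> // r r0 rm.
  have [H1 H2] := Hd r r0 (lt_trans rm md).
  by split=> //; exact: subset_trans H1 (@inner_ball_sub q).
- move=> i; apply: closure_lipschitz => //.
  + by rewrite mulr_ge0// ltW.
  + by move=> x [[]].
  + move=> x y [[Ox gx] zx] [[Oy gy] zy].
    apply: (HB Omega u Du oO Lu LDu wu cu (2 * e) _ x y e20 gx gy Ox Oy).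
    have := grid_cell_ball (s0 i.1) zx zy; rewrite mx_norm_ball /ball_ /= /s => xy.
    have m0 : (0 : R) < i.1.+1%:R by [].
    have : 4 * `|x - y| < i.1.+1%:R^-1.
      by rewrite mulrC -ltr_pdivlMr// -invfM mulrC.
    by apply: le_lt_trans; rewrite ler_wpM2r// ler_nat.
Qed.

End lipschitz_pieces.

(** * Maps and matrices close to the identity *)

Lemma continuous_within_measurable (R : realType) m n (O : set 'rV[R]_m)
    (g : 'rV[R]_m -> 'rV[R]_n) : open O -> {within O, continuous g} ->
  measurable_fun O g.
Proof.
move=> oO; rewrite continuous_open_subspace// => cg.
apply: (measurability (@open 'rV[R]_n)) => //.
move=> _ [U oU <-]; apply: open_measurable_mx; rewrite openE => x [Ox Ux].
have nO : nbhs x O by apply: open_nbhs_nbhs; split.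
have nU : nbhs (g x) U by apply: open_nbhs_nbhs; split.
have nV : nbhs x (g @^-1` U) by apply: (cg x); [exact/mem_set|exact: nU].
exact: filterI nO nV.
Qed.

Section near_identity.
Context (R : realType) (n : nat).
Local Notation T := 'rV[R]_n.+1.
Local Notation mu := (lebesgue_Rn R n.+1).

(** If the increments of [h] differ from those of the identity by at most the
    factor [k], then [h] is Lipschitz with constant [1 + k] and its inverse with
    constant [(1 - k)^-1]. *)
Lemma near_identity_measure (E : set T) (h hinv : T -> T) (k : R) :
  0 <= k -> k < 1 -> measurable E ->
  (forall F, measurable F -> F `<=` E -> measurable (h @` F)) ->
  (forall F, measurable F -> F `<=` h @` E -> measurable (hinv @` F)) ->
  (forall x, E x -> hinv (h x) = x) ->
  (forall x y, E x -> E y -> forall a,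
    `|(h x ord0 a - h y ord0 a) - (x ord0 a - y ord0 a)| <= k * `|x - y|) ->
  (mu (h @` E) <= ((1 + k) ^+ n.+1)%:E * mu E)%E /\
  (((1 - k) ^+ n.+1)%:E * mu E <= mu (h @` E))%E.
Proof.
move=> k0 k1 mE mh mhinv hK hk; have k10 : 0 < 1 - k by rewrite subr_gt0.
have prodE (c : R) : c ^+ n.+1 = \prod_(i < n.+1) c by rewrite prodr_const card_ord.
have mhE : measurable (h @` E) by exact: mh.
split.
  rewrite prodE; apply: lipschitz_image_measure => // [_|x y Ex Ey a].
    by rewrite addr_ge0.
  have := hk x y Ex Ey a; have := coord_mx_le_norm (x - y) ord0 a; rewrite !mxE.
  have := ler_normD ((h x ord0 a - h y ord0 a) - (x ord0 a - y ord0 a)) (x ord0 a - y ord0 a).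
  by rewrite subrK mulrDl mul1r; lra.
have hE : hinv @` (h @` E) = E.
  apply/seteqP; split=> [_ [_ [x Ex <-] <-]|x Ex]; first by rewrite hK.
  by exists (h x); [exists x|exact: hK].
have := @lipschitz_image_measure R n.+1 (h @` E) hinv (fun=> (1 - k)^-1) mhE mhinv.
rewrite hE -prodE => inv_lip.
have : (mu E <= ((1 - k)^-1 ^+ n.+1)%:E * mu (h @` E))%E.
  apply: inv_lip => [_|_ _ [x Ex <-] [y Ey <-] a]; first by rewrite invr_ge0 ltW.
  rewrite !hK// mulrC ler_pdivlMr//.
  have := coord_mx_le_norm (x - y) ord0 a; rewrite !mxE => xya.
  suff : `|x - y| * (1 - k) <= `|h x - h y|.
    by apply: le_trans; rewrite ler_wpM2r// ltW.
  rewrite mulrBr mulr1 lerBlDr; apply: norm_le_coord; first by rewrite addr_ge0// mulr_ge0.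
  move=> b; rewrite !mxE.
  have := hk x y Ex Ey b; have := coord_mx_le_norm (h x - h y) ord0 b; rewrite !mxE.
  have := ler_normB (h x ord0 b - h y ord0 b)
    ((h x ord0 b - h y ord0 b) - (x ord0 b - y ord0 b)).
  by rewrite subKr mulrC; lra.
have q0 : (0 <= ((1 - k) ^+ n.+1)%:E)%E by rewrite lee_fin exprn_ge0// ltW.
move=> /(lee_wpmul2l q0); rewrite muleA -EFinM.
by rewrite -exprMn divff ?gt_eqF// expr1n mul1e.
Qed.

Definition row_dist (A B : 'M[R]_n.+1) a := \sum_j `|(A - B) a j|.

Lemma near_identity_unitmx (A : 'M[R]_n.+1) (k : R) : k < 1 ->
  (forall a, row_dist A 1%:M a <= k) -> A \in unitmx.
Proof.
move=> k1 Ak; rewrite unitmxE unitfE -det_tr; apply/negP => /eqP/eqP/det0P[v v0 vA].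
have : `|v| <= k * `|v|.
  have k0 : 0 <= k by apply: le_trans (Ak ord0); exact: sumr_ge0.
  apply: norm_le_coord; first by rewrite mulr_ge0.
  move=> a; have : (v *m (A - 1%:M)^T) ord0 a = - v ord0 a.
    by rewrite linearB /= trmx1 mulmxBr vA mulmx1 sub0r mxE.
  move=> va; rewrite -[`|v ord0 a|]normrN -va mxE; apply: le_trans (ler_norm_sum _ _ _) _.
  apply: le_trans (ler_wpM2r _ (Ak a)) => //; rewrite mulr_suml.
  apply: ler_sum => j _; rewrite normrM mulrC !mxE; apply: ler_wpM2l => //.
  exact: coord_mx_le_norm.
rewrite -subr_le0 -[X in X - _]mul1r -mulrBl pmulr_rle0 ?subr_gt0// normr_le0.
exact/negP.
Qed.

Lemma mulmx_row_diff (A : 'M[R]_n.+1) (v : T) a k :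
  row_dist A 1%:M a <= k -> `|(v *m A^T) ord0 a - v ord0 a| <= k * `|v|.
Proof.
move=> Ak; have -> : (v *m A^T) ord0 a - v ord0 a = (v *m (A - 1%:M)^T) ord0 a.
  by rewrite linearB /= trmx1 mulmxBr mulmx1 !mxE.
rewrite mxE; apply: le_trans (ler_norm_sum _ _ _) _.
apply: le_trans (ler_wpM2r _ Ak) => //; rewrite mulr_suml.
apply: ler_sum => j _; rewrite normrM mulrC !mxE; apply: ler_wpM2l => //.
exact: coord_mx_le_norm.
Qed.

Lemma mu_unit_ball : (0 < mu (ball (0 : T) 1)%R)%E /\ mu (ball (0 : T) 1)%R \is a fin_num.
Proof. by rewrite lebesgue_Rn_ball// lte_fin exprn_gt0. Qed.

(** The determinant is the dilation of measure, which [near_identity_measure]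
    estimates on the unit ball. *)
Lemma near_identity_det (A : 'M[R]_n.+1) (k : R) : 0 <= k -> k < 1 ->
  (forall a, row_dist A 1%:M a <= k) ->
  (1 - k) ^+ n.+1 <= `|\det A| <= (1 + k) ^+ n.+1.
Proof.
move=> k0 k1 Ak; have uA := near_identity_unitmx k1 Ak.
have uAT : A^T \in unitmx by rewrite unitmx_tr.
have uAT' : invmx A^T \in unitmx by rewrite unitmx_inv.
have mB : measurable (ball (0 : T) 1) by exact: measurable_ball_mx.
have [] := @near_identity_measure (ball 0 1) (fun v => v *m A^T) (fun v => v *m invmx A^T) k k0 k1 mB.
- by move=> F mF _; exact: (measurable_mulmx_image uAT mF).
- by move=> F mF _; exact: (measurable_mulmx_image uAT' mF).
- by move=> x _; rewrite mulmxK.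
- move=> x y _ _ a; have := mulmx_row_diff (x - y) (Ak a).
  by rewrite mulmxBl !mxE; apply: le_trans; rewrite le_eqVlt; apply/orP; left; apply/eqP; congr (`| _ |); ring.
rewrite -/(mulmx_image A^T _) lebesgue_Rn_mulmx_image// det_tr.
have [b0 bfin] := mu_unit_ball.
by rewrite !lee_pmul2r// !lee_fin => -> ->.
Qed.

(** Both sides bound the dilation of measure, the left one exactly. *)
Lemma det_le_colsum (A : 'M[R]_n.+1) : A \in unitmx ->
  `|\det A| <= \prod_j \sum_i `|A i j|.
Proof.
move=> uA; have mB : measurable (ball (0 : T) 1) by exact: measurable_ball_mx.
have := stretch_col uA mB; rewrite lebesgue_Rn_mulmx_image//.
by have [b0 bfin] := mu_unit_ball; rewrite lee_pmul2r// lee_fin.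
Qed.

Lemma rat_mx_approx p q (A : 'M[R]_(p, q)) (d : R) : 0 < d ->
  exists S : 'M[rat]_(p, q), forall i j, `|A i j - ratr (S i j)| < d.
Proof.
move=> d0; have xr i j : exists q : rat, `|A i j - ratr q| < d.
  have /rat_in_itvoo[r] : A i j - d < A i j + d by rewrite ltrBlDr -addrA ltrDl addr_gt0.
  rewrite in_itv /= => /andP[q1 q2]; exists r.
  by rewrite ltr_distlC q1 q2.
by exists (\matrix_(i, j) projT1 (cid (xr i j))) => i j; rewrite mxE; exact: projT2 (cid (xr i j)).
Qed.

End near_identity.

(** * The two kinds of pieces of a Sobolev homeomorphism *)

Section area.
Context (R : realType) (n : nat).
Local Notation T := 'rV[R]_n.+1.
Local Notation mu := (lebesgue_Rn R n.+1).
Variables (Omega1 Omega2 : set T) (f g : T -> T) (Df : T -> 'M[R]_n.+1).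
Hypotheses (oO1 : open Omega1) (oO2 : open Omega2)
  (bijf : set_bij Omega1 Omega2 f) (cf : {within Omega1, continuous f})
  (cg : {within Omega2, continuous g}) (gf : forall x, Omega1 x -> g (f x) = x)
  (sobf : W11loc Omega1 f Df).

Let mO1 : measurable Omega1. Proof. exact: open_measurable_mx. Qed.
Let mO2 : measurable Omega2. Proof. exact: open_measurable_mx. Qed.
Let mf : measurable_fun Omega1 f. Proof. exact: continuous_within_measurable. Qed.
Let mg : measurable_fun Omega2 g. Proof. exact: continuous_within_measurable. Qed.

Let fO2 x : Omega1 x -> Omega2 (f x).
Proof. by case: bijf => + _ _; apply. Qed.

Lemma homeo_imageE (E : set T) : E `<=` Omega1 -> f @` E = Omega2 `&` g @^-1` E.
Proof.
move=> EO; apply/seteqP; split=> [_ [x Ex <-]|y [Oy Ey]].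
  by split=> /=; [apply/fO2/EO|rewrite gf//; exact: EO].
have [_ _ /(_ y Oy)[x Ox xy]] := bijf.
by exists (g y) => //; rewrite -xy gf.
Qed.

Lemma measurable_homeo_image (E : set T) : measurable E -> E `<=` Omega1 ->
  measurable (f @` E).
Proof. by move=> mE EO; rewrite homeo_imageE//; exact: mg. Qed.

Lemma continuous_lincomb (v t : 'I_n.+1 -> R) :
  {within Omega1, continuous (lincomb v t f)}.
Proof.
move: cf; rewrite !continuous_open_subspace// => cf' x xO.
pose V : 'M[R]_(n.+1, 1) := \col_i v i; pose W : 'M[R]_(n.+1, 1) := \col_i t i.
have -> : lincomb v t f = (fun x => (f x *m V) ord0 ord0) \- (fun x => (x *m W) ord0 ord0).
  apply/funext => z; rewrite /lincomb /= !mxE; congr (_ - _).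
    by apply: eq_bigr => i _; rewrite mxE mulrC.
  by apply: eq_bigr => i _; rewrite mxE mulrC.
apply: continuousB.
  apply: (@continuous_comp _ _ _ f (fun y => (y *m V) ord0 ord0)); first exact: cf'.
  apply: (@continuous_comp _ _ _ (fun y : T => y *m V) (fun M : 'M[R]_(1, 1) => M ord0 ord0)).
    exact: continuous_mulmxr.
  exact: coord_continuous.
apply: (@continuous_comp _ _ _ (fun y : T => y *m W) (fun M : 'M[R]_(1, 1) => M ord0 ord0)).
  exact: continuous_mulmxr.
exact: coord_continuous.
Qed.

(** One piece is chosen for each row of the matrices. *)
Definition multi_index := {ffun 'I_n.+1 -> piece_index n}.

Lemma row_distE (S Tm : 'M[R]_n.+1) x a : row_dist (S *m Df x) Tm a =
  abs_sum (fun j x => \sum_i S a i * Df x i j - Tm a j) x.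
Proof. by rewrite /row_dist /abs_sum; apply: eq_bigr => j _; rewrite !mxE. Qed.

(** The weak derivative of [S f - T x] is [S Df - T]. Its rows have separate
    tolerances [e a], because in the singular case only one of them is small. *)
Lemma matrix_pieces : exists2 B : R, 0 < B & forall (S Tm : 'M[R]_n.+1) (e : 'I_n.+1 -> R),
  (forall a, 0 < e a) -> exists F : multi_index -> set T, exists Z : set T,
  [/\ forall i, measurable (F i) /\ F i `<=` Omega1,
      measurable Z /\ mu Z = 0%E,
      forall x, Omega1 x -> (forall a, row_dist (S *m Df x) Tm a < e a) -> ~ Z x ->
        exists i, F i x &
      forall i x y, F i x -> F i y -> forall a,
        `|lincomb (S a) (Tm a) f x - lincomb (S a) (Tm a) f y| <= B * e a * `|x - y|].
Proof.
have [B B0 HB] := good_points_lipschitz R n.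
exists (B * 2) => [|S Tm e e0]; first by rewrite mulr_gt0.
have /choice[F HF] a : exists F : piece_index n -> set T, exists Z : set T,
  [/\ forall i, measurable (F i) /\ F i `<=` Omega1,
      measurable Z /\ mu Z = 0%E,
      forall x, Omega1 x -> row_dist (S *m Df x) Tm a < e a -> ~ Z x -> exists i, F i x &
      forall i x y, F i x -> F i y ->
       `|lincomb (S a) (Tm a) f x - lincomb (S a) (Tm a) f y| <= B * (2 * e a) * `|x - y|].
  have [Lu LDu wu] := lincomb_weak_deriv oO1 (S a) (Tm a) sobf.
  have [F [Z [H1 H2 H3 H4]]] := lipschitz_pieces oO1 B0 HB Lu LDu wu
    (@continuous_lincomb (S a) (Tm a)) (e0 a).
  exists F, Z; split=> // x Ox; rewrite row_distE; exact: H3.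
have {HF}/choice[Z HZ] := HF.
exists (fun k : multi_index => \bigcap_(a in [set: 'I_n.+1]) F a (k a)), (\bigcup_a Z a); split.
- move=> k; split; last by move=> x /(_ ord0 I); have [H _ _ _] := HZ ord0; apply: (H _).2.
  by apply: fin_bigcap_measurable => // a _; have [H _ _ _] := HZ a; exact: (H _).1.
- by apply: null_bigcup => a; have [] := HZ a.
- move=> x Ox dx nZ.
  have /choice[k Hk] a : exists i, F a i x.
    have [_ _ H _] := HZ a; apply: H => //; by move=> Zx; apply: nZ; exists a.
  by exists [ffun a => k a] => a _; rewrite ffunE.
- move=> k x y Fx Fy a; have [_ _ _ H] := HZ a.
  by rewrite -(mulrA B); apply: (H (k a)); [exact: Fx|exact: Fy].
Qed.

Definition jac x : R := `|\det (Df x)|.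

Lemma measurable_Df i j : measurable_fun Omega1 (fun x => Df x i j).
Proof. by case: sobf => _ /(_ i j)[]. Qed.

Lemma measurable_det (A : T -> 'M[R]_n.+1) (O : set T) :
  (forall i j, measurable_fun O (fun x => A x i j)) ->
  measurable_fun O (fun x => \det (A x)).
Proof.
move=> mA; rewrite /determinant; apply: measurable_sum => s.
apply: measurable_funM; first exact: measurable_cst.
by apply: measurable_prod => i _.
Qed.

Lemma measurable_jac : measurable_fun Omega1 jac.
Proof.
by apply: measurableT_comp => //; apply: measurable_det; exact: measurable_Df.
Qed.

Lemma measurable_row_dist (S Tm : 'M[R]_n.+1) a :
  measurable_fun Omega1 (fun x => row_dist (S *m Df x) Tm a).
Proof.
apply: measurable_sum => j; apply: measurableT_comp => //.
rewrite (_ : (fun _ => _) = (fun x => \sum_i S a i * Df x i j - Tm a j)).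
  apply: measurable_funB; last exact: measurable_cst.
  apply: measurable_sum => i; apply: measurable_funM; first exact: measurable_cst.
  exact: measurable_Df.
by apply/funext => x; rewrite !mxE.
Qed.

Definition close_set (S Tm : 'M[R]_n.+1) (e : 'I_n.+1 -> R) : set T :=
  Omega1 `&` [set x | forall a, row_dist (S *m Df x) Tm a < e a].

Lemma measurable_close_set S Tm e : measurable (close_set S Tm e).
Proof.
rewrite (_ : close_set S Tm e = Omega1 `&` \bigcap_(a in [set: 'I_n.+1])
    (Omega1 `&` (fun x => row_dist (S *m Df x) Tm a) @^-1` `]-oo, e a[)).
  apply: measurableI => //; apply: fin_bigcap_measurable => // a _.
  by apply: measurable_row_dist.
apply/seteqP; split=> [x [Ox Hx]|x [Ox Hx]]; split=> //.
  by move=> a _; split=> //; rewrite /= in_itv /=; exact: Hx.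
by move=> a; have [_] := Hx a I; rewrite /= in_itv.
Qed.

Lemma homeo_linear_image (S : 'M[R]_n.+1) (E : set T) : S \in unitmx -> measurable E ->
  E `<=` Omega1 ->
  mu ((fun x => f x *m S^T) @` E) = (`|\det S|%:E * mu (f @` E))%E.
Proof.
move=> uS mE EO; have uST : S^T \in unitmx by rewrite unitmx_tr.
rewrite -(det_tr S) -(lebesgue_Rn_mulmx_image uST); last exact: measurable_homeo_image.
by rewrite /mulmx_image image_comp.
Qed.

Lemma lincomb_row (S Tm : 'M[R]_n.+1) a x :
  lincomb (S a) (Tm a) f x = (f x *m S^T) ord0 a - (x *m Tm^T) ord0 a.
Proof. by rewrite /lincomb !mxE; congr (_ - _); apply: eq_bigr => i _; rewrite mxE mulrC. Qed.

Lemma jac_ge0 x : 0 <= jac x. Proof. exact: normr_ge0. Qed.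

Lemma measurable_jacE (E : set T) : measurable E -> E `<=` Omega1 ->
  measurable_fun E (EFin \o jac).
Proof. by move=> mE EO; apply/measurable_EFinP; exact: measurable_funS measurable_jac. Qed.

(** On [E] the map [S f] is almost isometric, so it preserves measure up to a factor
    close to [1]; the matrix [S Df] is close to the identity, so [|det S| * jac] is
    close to [1]; and [S] dilates measure by [|det S|]. *)
Lemma invertible_piece (S : 'M[R]_n.+1) (k : R) (E : set T) : 0 <= k -> k < 1 ->
  S \in unitmx -> measurable E -> E `<=` Omega1 ->
  (forall x, E x -> forall a, row_dist (S *m Df x) 1%:M a <= k) ->
  (forall x y, E x -> E y -> forall a,
    `|lincomb (S a) ((1%:M : 'M[R]_n.+1) a) f x - lincomb (S a) ((1%:M : 'M[R]_n.+1) a) f y| <= k * `|x - y|) ->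
  (((1 - k) ^+ n.+1)%:E * mu (f @` E) <= ((1 + k) ^+ n.+1)%:E * \int[mu]_(x in E) (jac x)%:E)%E /\
  (((1 - k) ^+ n.+1)%:E * \int[mu]_(x in E) (jac x)%:E <= ((1 + k) ^+ n.+1)%:E * mu (f @` E))%E.
Proof.
move=> k0 k1 uS mE EO Ek lipE.
have uST : S^T \in unitmx by rewrite unitmx_tr.
pose h x := f x *m S^T; pose hinv y := g (y *m invmx S^T).
have hK x : Omega1 x -> hinv (h x) = x by move=> Ox; rewrite /hinv /h mulmxK// gf.
have mh : measurable_fun Omega1 h.
  exact: (measurableT_comp (@measurable_mulmxr R 1 n.+1 n.+1 S^T) mf).
have D0 : 0 < `|\det S| by rewrite normr_gt0 -unitfE -unitmxE.
have [] := @near_identity_measure R n E h hinv k k0 k1 mE.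
- move=> F mF FE; rewrite /h -(image_comp f (fun v => v *m S^T)).
  by apply: (measurable_mulmx_image uST); apply: measurable_homeo_image => //; exact: subset_trans EO.
- move=> F mF FhE; rewrite (_ : hinv @` F = Omega1 `&` h @^-1` F); first exact: mh.
  apply/seteqP; split=> [_ [y Fy <-]|x [Ox Fhx]].
    by have [x Ex xy] := FhE y Fy; rewrite -xy in Fy *; rewrite hK; [split=> //|]; exact: EO.
  by exists (h x) => //; rewrite hK.
- by move=> x Ex; rewrite hK//; exact: EO.
- move=> x y Ex Ey a; apply: le_trans (lipE x y Ex Ey a).
  rewrite !lincomb_row trmx1 !mulmx1 le_eqVlt; apply/orP; left; apply/eqP; congr (`| _ |).
  by rewrite /h; ring.
rewrite homeo_linear_image// => up low.
set X := mu (f @` E); set Y := (\int[mu]_(x in E) (jac x)%:E)%E.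
have DJ x : E x -> (1 - k) ^+ n.+1 <= `|\det S| * jac x <= (1 + k) ^+ n.+1.
  by move=> Ex; have := near_identity_det k0 k1 (Ek x Ex); rewrite det_mulmx normrM.
have DYE : (`|\det S|%:E * Y = \int[mu]_(x in E) (`|\det S| * jac x)%:E)%E.
  rewrite -ge0_integralZl//; [exact: measurable_jacE|by move=> x _; rewrite lee_fin jac_ge0].
have mDJ : measurable_fun E (fun x => (`|\det S| * jac x)%:E).
  apply/measurable_EFinP; apply: measurable_funM; first exact: measurable_cst.
  exact: measurable_funS measurable_jac.
have upY : (`|\det S|%:E * Y <= ((1 + k) ^+ n.+1)%:E * mu E)%E.
  rewrite DYE -integral_cst//; apply: ge0_le_integral => //.
  - by move=> x _; rewrite lee_fin mulr_ge0// jac_ge0.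
  - by move=> x /DJ /andP[_ H]; rewrite lee_fin.
have lowY : (((1 - k) ^+ n.+1)%:E * mu E <= `|\det S|%:E * Y)%E.
  rewrite DYE -integral_cst//; apply: ge0_le_integral => //.
  - by move=> x _; rewrite lee_fin exprn_ge0// subr_ge0 ltW.
  - by move=> x /DJ /andP[H _]; rewrite lee_fin.
have p0 : (0 <= ((1 + k) ^+ n.+1)%:E)%E by rewrite lee_fin exprn_ge0// addr_ge0.
have q0 : (0 <= ((1 - k) ^+ n.+1)%:E)%E by rewrite lee_fin exprn_ge0// subr_ge0 ltW.
have key (V W : \bar R) : (`|\det S|%:E * V <= ((1 + k) ^+ n.+1)%:E * mu E)%E ->
    (((1 - k) ^+ n.+1)%:E * mu E <= `|\det S|%:E * W)%E ->
    (((1 - k) ^+ n.+1)%:E * V <= ((1 + k) ^+ n.+1)%:E * W)%E.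
  move=> hV hW; rewrite -(@lee_pmul2l _ `|\det S|%:E)//.
  rewrite muleCA; apply: (le_trans (lee_wpmul2l q0 hV)).
  by rewrite muleCA [leRHS]muleCA; exact: lee_wpmul2l.
by split; apply: key.
Qed.

(** Multiplication on the left adds to the row [i0] the combination of the rows
    with coefficients [r]. *)
Definition row_add (i0 : 'I_n.+1) (r : 'rV[R]_n.+1) : 'M[R]_n.+1 :=
  1%:M + delta_mx i0 ord0 *m r.

Lemma row_addE i0 r a j : row_add i0 r a j = (a == j)%:R + (a == i0)%:R * r ord0 j.
Proof.
by rewrite /row_add !mxE big_ord_recl big_ord0 addr0 !mxE eqxx andbT.
Qed.

Lemma row_addK i0 (r : 'rV[R]_n.+1) : r ord0 i0 = 0 -> row_add i0 (- r) *m row_add i0 r = 1%:M.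
Proof.
move=> r0; rewrite /row_add mulmxDl mul1mx mulmxDr mulmx1 mulmxN mulNmx.
rewrite -mulmxA (mulmxA r) (_ : r *m delta_mx i0 ord0 = 0); last first.
  apply/matrixP => i j; rewrite !mxE (bigD1 i0)//= !mxE !ord1 r0 mul0r add0r big1// => l li.
  by rewrite !mxE (negPf li) mulr0.
by rewrite mul0mx mulmx0 subr0 addrK.
Qed.

Lemma det_row_add_le i0 (r : 'rV[R]_n.+1) : r ord0 i0 = 0 -> (forall j, `|r ord0 j| <= 2) ->
  row_add i0 r \in unitmx /\ `|\det (row_add i0 (- r))| <= 3 ^+ n.+1.
Proof.
move=> r0 r2; have [u' u] := mulmx1_unit (row_addK r0); split=> //.
apply: (le_trans (det_le_colsum u')).
rewrite -[n.+1 in leRHS]card_ord -prodr_const; apply: ler_prod => j _.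
rewrite sumr_ge0//=; apply: (@le_trans _ _ (\sum_i ((i == j)%:R + (i == i0)%:R * 2))).
  apply: ler_sum => i _; rewrite row_addE !mxE; apply: le_trans (ler_normD _ _) _.
  apply: lerD; first by rewrite normr_nat.
  by rewrite normrM normr_nat normrN; apply: ler_wpM2l.
rewrite big_split /= (bigD1 j)//= eqxx big1; last by move=> i /negPf ->.
rewrite (bigD1 i0)//= eqxx mul1r big1; last by move=> i /negPf ->; rewrite mul0r.
by rewrite !addr0; lra.
Qed.

(** The coordinates of [f] in the basis adapted to [row_add i0 r] are Lipschitz with
    the constants [c], one of which will be tiny; changing the basis back costs a
    bounded factor. *)
Lemma singular_piece i0 (r : 'rV[R]_n.+1) (c : 'I_n.+1 -> R) (E : set T) :
  r ord0 i0 = 0 -> (forall j, `|r ord0 j| <= 2) -> measurable E -> E `<=` Omega1 ->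
  (forall a, 0 <= c a) ->
  (forall x y, E x -> E y -> forall a,
    `|lincomb (row_add i0 r a) ((0 : 'M[R]_n.+1) a) f x -
      lincomb (row_add i0 r a) ((0 : 'M[R]_n.+1) a) f y| <= c a * `|x - y|) ->
  (mu (f @` E) <= (3 ^+ n.+1 * \prod_a c a)%:E * mu E)%E.
Proof.
move=> r0 r2 mE EO c0 lipE; have [uS detS'] := det_row_add_le r0 r2.
set S := row_add i0 r in uS lipE *; pose S' := row_add i0 (- r).
have uST : S^T \in unitmx by rewrite unitmx_tr.
pose h x := f x *m S^T.
have mhF F : measurable F -> F `<=` E -> measurable (h @` F).
  move=> mF FE; rewrite /h -(image_comp f (fun v => v *m S^T)).
  by apply: (measurable_mulmx_image uST); apply: measurable_homeo_image => //; exact: subset_trans EO.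
have hE_le : (mu (h @` E) <= (\prod_a c a)%:E * mu E)%E.
  apply: lipschitz_image_measure => // x y Ex Ey a.
  by have := lipE x y Ex Ey a; rewrite !lincomb_row trmx0 !mulmx0 !mxE !subr0.
have S'S : S' *m S = 1%:M by exact: row_addK.
have DD' : `|\det S'| * `|\det S| = 1 by rewrite -normrM -det_mulmx S'S det1 normr1.
have -> : mu (f @` E) = (`|\det S'|%:E * mu (h @` E))%E.
  by rewrite homeo_linear_image// muleA -EFinM DD' mul1e.
apply: (@le_trans _ _ ((3 ^+ n.+1)%:E * mu (h @` E))%E).
  by apply: lee_wpmul2r => //; rewrite lee_fin.
by rewrite EFinM -muleA; apply: lee_wpmul2l => //; rewrite lee_fin exprn_ge0.
Qed.

End area.

Lemma small_distortion (R : realType) N (t : R) : 0 < t ->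
  exists k : R, [/\ 0 < k, k < 1 & (1 + k) ^+ N <= (1 + t) * (1 - k) ^+ N].
Proof.
move=> t0; have [C C0 HC] := @prod_perturb R 'I_N (index_enum _) (fun=> 1) (fun=> 1)
  (fun=> ler01) (fun=> ler01).
have C1 : 0 < 4 * (C + 1) by rewrite mulr_gt0// ltr_wpDl.
pose k := Num.min (1 / 4) (t / (4 * (C + 1))).
have k0 : 0 < k by rewrite lt_min !divr_gt0.
have k4 : k <= 1 / 4 by rewrite ge_min lexx.
have kt : k <= t / (4 * (C + 1)) by rewrite ge_min lexx orbT.
exists k; split=> //; first by lra.
apply: (@le_trans _ _ ((1 + 4 * k) ^+ N * (1 - k) ^+ N)).
  rewrite -exprMn; apply: lerXn2r; rewrite ?nnegrE; [by lra|by apply: mulr_ge0; lra|by nra].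
apply: ler_wpM2r; first by apply: exprn_ge0; lra.
have := HC (4 * k); rewrite !prodr_const card_ord expr1n mulr1 => H.
apply: (le_trans (H _)); first by apply/andP; split; lra.
rewrite lerD2l; apply: le_trans (_ : t / (4 * (C + 1)) * (4 * (C + 1)) <= t).
  rewrite mulrAC mulrC; nra.
by rewrite divfK// gt_eqF.
Qed.

(** * The area formula *)

Section covering.
Context (R : realType) (n : nat).
Implicit Types (A : 'M[R]_n.+1).

(** Rational matrices approximate the inverse of [A]; being countably many, they
    can index pieces. *)
Lemma rational_left_inverse A (d : R) : \det A != 0 -> 0 < d -> d < 1 ->
  exists S : 'M[rat]_n.+1, (map_mx ratr S : 'M[R]_n.+1) \in unitmx /\
    forall a, row_dist (map_mx ratr S *m A) 1%:M a < d.
Proof.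
move=> dA d0 d1; have uA : A \in unitmx by rewrite unitmxE unitfE.
pose M := \sum_i \sum_j `|A i j|.
have M0 : 0 <= M by apply: sumr_ge0 => i _; exact: sumr_ge0.
have M1 : 0 < M + 1 by rewrite ltr_wpDl.
have [S HS] := rat_mx_approx (invmx A) (divr_gt0 d0 M1).
have dist a : row_dist (map_mx ratr S *m A) 1%:M a < d.
  rewrite /row_dist -(mulVmx uA) -mulmxBl.
  apply: (@le_lt_trans _ _ (d / (M + 1) * M)); last first.
    by rewrite mulrAC ltr_pdivrMr// ltr_pM2l// ltrDl.
  apply: (@le_trans _ _ (\sum_j \sum_i d / (M + 1) * `|A i j|)).
    apply: ler_sum => j _; rewrite mxE; apply: le_trans (ler_norm_sum _ _ _) _.
    apply: ler_sum => i _; rewrite normrM; apply: ler_wpM2r => //.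
    by rewrite !mxE distrC ltW.
  by rewrite exchange_big /= mulr_sumr; apply: ler_sum => i _; rewrite mulr_sumr.
exists S; split=> //.
have := near_identity_unitmx d1 (fun a => ltW (dist a)).
by rewrite unitmx_mul => /andP[].
Qed.

(** A singular matrix has a left null vector whose entry of largest modulus is [1],
    at some position [i0]; its other entries are then rounded to rationals. *)
Lemma rational_row_relation A (d : R) : \det A = 0 -> 0 < d ->
  exists i0 : 'I_n.+1, exists r : 'rV[rat]_n.+1,
  [/\ (map_mx ratr r : 'rV[R]_n.+1) ord0 i0 = 0,
      forall j, `|(map_mx ratr r : 'rV[R]_n.+1) ord0 j| <= 2 &
      row_dist (row_add i0 (map_mx ratr r) *m A) 0 i0 < d].
Proof.
move=> /eqP/det0P[v v0 vA] d0.
have [i0 _ Hi0] := @arg_maxP _ _ 'I_n.+1 ord0 xpredT (fun i => `|v ord0 i|) isT.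
have vi0 : v ord0 i0 != 0.
  apply: contraNneq v0 => vi0; apply/eqP/rowP => j; rewrite mxE; apply/eqP.
  by rewrite -normr_le0; have := Hi0 j isT; rewrite vi0 normr0.
pose w := (v ord0 i0)^-1 *: v.
have wi0 : w ord0 i0 = 1 by rewrite mxE mulVf.
have w1 j : `|w ord0 j| <= 1.
  rewrite mxE normrM normfV mulrC ler_pdivrMr ?normr_gt0// mul1r; exact: Hi0.
have wA : w *m A = 0 by rewrite -scalemxAl vA scaler0.
pose M := \sum_i \sum_j `|A i j|.
have M0 : 0 <= M by apply: sumr_ge0 => i _; exact: sumr_ge0.
have M1 : 0 < M + 1 by rewrite ltr_wpDl.
(* An error at most [1] keeps the rounded entries at most [2]. *)
pose d' := Num.min 1 (d / (M + 1)).
have d'0 : 0 < d' by rewrite lt_min ltr01 divr_gt0.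
have [S HS] := rat_mx_approx w d'0.
pose r := \row_j (if j == i0 then 0 else S ord0 j) : 'rV[rat]_n.+1.
have rE j : (map_mx ratr r : 'rV[R]_n.+1) ord0 j = if j == i0 then 0 else ratr (S ord0 j).
  by rewrite !mxE; case: ifP => // _; rewrite rmorph0.
have wr j : `|(j == i0)%:R + (map_mx ratr r : 'rV[R]_n.+1) ord0 j - w ord0 j| <= d'.
  rewrite rE; have [->|ji] := eqVneq j i0; first by rewrite addr0 wi0 subrr normr0 ltW.
  by rewrite add0r distrC ltW.
exists i0, r; split; first by rewrite rE eqxx.
- move=> j; rewrite rE; case: ifPn => [_|_]; first by rewrite normr0.
  have := HS ord0 j; have := w1 j; have := ler_normB (w ord0 j) (w ord0 j - ratr (S ord0 j)).
  rewrite subKr; have : d' <= 1 by rewrite ge_min lexx.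
  lra.
rewrite /row_dist subr0.
apply: (@le_lt_trans _ _ (d / (M + 1) * M)); last first.
  by rewrite mulrAC ltr_pdivrMr// ltr_pM2l// ltrDl.
apply: (@le_trans _ _ (\sum_j \sum_i d / (M + 1) * `|A i j|)); last first.
  by rewrite exchange_big /= mulr_sumr; apply: ler_sum => i _; rewrite mulr_sumr.
apply: ler_sum => j _.
have -> : (row_add i0 (map_mx ratr r) *m A) i0 j =
    \sum_i ((i == i0)%:R + (map_mx ratr r : 'rV[R]_n.+1) ord0 i - w ord0 i) * A i j.
  have wAj : \sum_i w ord0 i * A i j = 0.
    by have /matrixP/(_ ord0 j) := wA; rewrite !mxE.
  rewrite mxE; under [RHS]eq_bigr => i _ do rewrite mulrBl.
  rewrite sumrB wAj subr0; apply: eq_bigr => i _.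
  by rewrite row_addE eqxx mul1r eq_sym.
apply: le_trans (ler_norm_sum _ _ _) _; apply: ler_sum => i _; rewrite normrM.
by apply: ler_wpM2r => //; apply: (le_trans (wr i)); rewrite ge_min lexx orbT.
Qed.

End covering.

Section area_formula.
Context (R : realType) (n : nat).
Local Notation T := 'rV[R]_n.+1.
Local Notation mu := (lebesgue_Rn R n.+1).
Variables (Omega1 Omega2 : set T) (f g : T -> T) (Df : T -> 'M[R]_n.+1).
Hypotheses (oO1 : open Omega1) (oO2 : open Omega2)
  (bijf : set_bij Omega1 Omega2 f) (cf : {within Omega1, continuous f})
  (cg : {within Omega2, continuous g}) (gf : forall x, Omega1 x -> g (f x) = x)
  (sobf : W11loc Omega1 f Df).

Local Notation J := (jac Df).

Let mO1 : measurable Omega1. Proof. exact: open_measurable_mx. Qed.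

Let mfE (E : set T) : measurable E -> E `<=` Omega1 -> measurable (f @` E).
Proof. exact: (measurable_homeo_image oO2 bijf cg gf). Qed.

(** The area formula up to relative errors [t]. The additive term absorbs the image
    of the points where [J] vanishes; both bounds pass to countable disjoint
    unions. *)
Definition area_bounds (t : R) (E : set T) :=
  (mu (f @` E) <= (1 + t)%:E * \int[mu]_(x in E) (J x)%:E + t%:E * mu E)%E /\
  (\int[mu]_(x in E) (J x)%:E <= (1 + t)%:E * mu (f @` E))%E.

Lemma area_bounds0 (t : R) : area_bounds t set0.
Proof. by rewrite /area_bounds image_set0 integral_set0 !measure0 !mule0 adde0. Qed.

Lemma area_bounds_invertible (t k : R) (S : 'M[R]_n.+1) (E : set T) :
  0 < t -> 0 < k -> k < 1 -> (1 + k) ^+ n.+1 <= (1 + t) * (1 - k) ^+ n.+1 ->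
  S \in unitmx -> measurable E -> E `<=` Omega1 ->
  (forall x, E x -> forall a, row_dist (S *m Df x) 1%:M a <= k) ->
  (forall x y, E x -> E y -> forall a,
    `|lincomb (S a) ((1%:M : 'M[R]_n.+1) a) f x - lincomb (S a) ((1%:M : 'M[R]_n.+1) a) f y| <= k * `|x - y|) ->
  area_bounds t E.
Proof.
move=> t0 k0 k1 kt uS mE EO Ek lipE.
have [H1 H2] := invertible_piece oO1 oO2 bijf cf cg gf sobf (ltW k0) k1 uS mE EO Ek lipE.
have q0 : 0 < (1 - k) ^+ n.+1 by rewrite exprn_gt0// subr_gt0.
have cancel (X Y : \bar R) : (0 <= Y)%E ->
    (((1 - k) ^+ n.+1)%:E * X <= ((1 + k) ^+ n.+1)%:E * Y)%E -> (X <= (1 + t)%:E * Y)%E.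
  move=> Y0 XY; rewrite -(@lee_pmul2l _ ((1 - k) ^+ n.+1)%:E)//.
  apply: (le_trans XY); rewrite muleA -EFinM; apply: lee_wpmul2r => //.
  by rewrite lee_fin mulrC.
have J0 : (0 <= \int[mu]_(x in E) (J x)%:E)%E.
  by apply: integral_ge0 => x _; rewrite lee_fin jac_ge0.
split; last exact: cancel H2.
apply: (le_trans (cancel _ _ J0 H1)); rewrite leeDl//.
by rewrite mule_ge0// lee_fin ltW.
Qed.

Lemma integral_jac0 (E : set T) : (forall x, E x -> J x = 0) ->
  (\int[mu]_(x in E) (J x)%:E = 0)%E.
Proof. by move=> E0; rewrite integral0_eq// => x Ex; rewrite E0. Qed.

(** Pieces of the first kind are indexed by a rational matrix [S] almost inverse to
    [Df]. Those of the second kind, where [Df] is singular, are indexed by an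
    almost vanishing rational combination of the rows of [Df], with coefficient [1]
    on the row [i0], and by a bound [m] on the entries of [Df]. *)
Lemma area_pieces (t : R) : 0 < t ->
  exists (I : countType) (G : I -> set T) (Z : set T),
  [/\ forall i, measurable (G i) /\ G i `<=` Omega1,
      measurable Z /\ mu Z = 0%E,
      forall x, Omega1 x -> ~ Z x -> exists i, G i x &
      forall i E, measurable E -> E `<=` G i -> area_bounds t E].
Proof.
move=> t0; have [B B0 HB] := matrix_pieces oO1 cf sobf.
have [k [k0 k1 kt]] := small_distortion n.+1 t0.
pose idx := ('M[rat]_n.+1 + 'I_n.+1 * 'rV[rat]_n.+1 * nat)%type.
pose k' := Num.min k (k / B).
have k'0 : 0 < k' by rewrite lt_min k0 divr_gt0.
have k'k : k' <= k by rewrite ge_min lexx.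
have Bk' : B * k' <= k by rewrite mulrC -ler_pdivlMr// ge_min lexx orbT.
(* Chosen so that [3 ^ n.+1 * (B * eps m) * (B * m.+1) ^ n = t], the factor that
   [singular_piece] produces. *)
pose eps (m : nat) := t / (3 ^+ n.+1 * (B ^+ n.+1 * m.+1%:R ^+ n)).
have eps0 m : 0 < eps m by rewrite divr_gt0// !mulr_gt0// ?exprn_gt0.
pose Sx (q : idx) : 'M[R]_n.+1 := match q with
  | inl A => map_mx ratr A | inr (i0, r, _) => row_add i0 (map_mx ratr r) end.
pose Tx (q : idx) : 'M[R]_n.+1 := if q is inl _ then 1%:M else 0.
pose ex (q : idx) (a : 'I_n.+1) : R := match q with
  | inl _ => k' | inr (i0, _, m) => if a == i0 then eps m else m.+1%:R end.
have ex0 q a : 0 < ex q a by case: q => [A|[[i0 r] m]] //=; case: ifP.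
have /choice[F HF] q : exists F : multi_index n -> set T, exists Z : set T,
  [/\ forall i, measurable (F i) /\ F i `<=` Omega1,
      measurable Z /\ mu Z = 0%E,
      forall x, Omega1 x -> (forall a, row_dist (Sx q *m Df x) (Tx q) a < ex q a) -> ~ Z x ->
        exists i, F i x &
      forall i x y, F i x -> F i y -> forall a,
        `|lincomb (Sx q a) (Tx q a) f x - lincomb (Sx q a) (Tx q a) f y| <= B * ex q a * `|x - y|].
  exact: HB.
have {HF}/choice[Z HZ] := HF.
pose sing := Omega1 `&` [set x | J x = 0].
have msing : measurable sing.
  rewrite (_ : sing = Omega1 `&` J @^-1` [set 0]); first exact: (measurable_jac sobf).
  by apply/seteqP; split.
pose ok (i0 : 'I_n.+1) (r : 'rV[rat]_n.+1) :=
  ((map_mx ratr r : 'rV[R]_n.+1) ord0 i0 == 0) &&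
  [forall j, `|(map_mx ratr r : 'rV[R]_n.+1) ord0 j| <= 2].
pose G (p : idx * multi_index n) : set T := match p.1 with
  | inl A => if (map_mx ratr A : 'M[R]_n.+1) \in unitmx then
      F p.1 p.2 `&` close_set Omega1 Df (Sx p.1) (Tx p.1) (ex p.1) else set0
  | inr (i0, r, m) => if ok i0 r then F p.1 p.2 `&` sing else set0 end.
exists (idx * multi_index n)%type, G, (\bigcup_q Z q); split.
- move=> [q p]; have [HF _ _ _] := HZ q; have [mF FO] := HF p.
  rewrite /G /=; case: q HF mF FO => [S|[[i0 r] m]] HF mF FO; case: ifP => _; try by split=> // x [].
    split; last by move=> x [/FO].
    by apply: measurableI => //; exact: (measurable_close_set oO1 sobf).
  split; last by move=> x [/FO].
  exact: measurableI.
- by apply: null_bigcup => q; have [] := HZ q.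
- move=> x Ox nZ; have nZq q : ~ Z q x by move=> Zx; apply: nZ; exists q.
  have [dx|dx] := eqVneq (\det (Df x)) 0.
    pose m := Num.truncn (\sum_a \sum_j `|Df x a j|).
    have [i0 [r [r0 r2 rd]]] := rational_row_relation dx (eps0 m).
    pose q : idx := inr (i0, r, m).
    have [_ _ /(_ x Ox) Hq _] := HZ q.
    have [||p Fp] := Hq; last 1 first.
    + exists (q, p); rewrite /G /= ifT; last first.
        by rewrite /ok r0 eqxx; apply/forallP.
      by split=> //; split=> //=; rewrite /jac dx normr0.
    + move=> a /=; case: eqVneq => [->//|ai].
      rewrite /row_dist subr0; apply: (@le_lt_trans _ _ (\sum_j `|Df x a j|)).
        rewrite le_eqVlt; apply/orP; left; apply/eqP; apply: eq_bigr => j _.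
        congr (`| _ |); rewrite mxE (bigD1 a)//= row_addE eqxx (negPf ai) mul0r addr0 mul1r.
        rewrite big1 ?addr0// => i ia.
        by rewrite row_addE eq_sym (negPf ia) (negPf ai) !mul0r addr0 mul0r.
      apply: (le_lt_trans _ (truncnS_gt _)).
      by rewrite [leRHS](bigD1 a)//= lerDl sumr_ge0// => i _; exact: sumr_ge0.
    + exact: nZq.
  have k'1 : k' < 1 by exact: le_lt_trans k'k k1.
  have [S [uS dS]] := rational_left_inverse dx k'0 k'1.
  pose q : idx := inl S.
  have [_ _ /(_ x Ox dS (nZq q)) [p Fp] _] := HZ q.
  exists (q, p); rewrite /G /= uS; split=> //; split=> //.
- move=> [q p] E mE; have [HF _ _ lipF] := HZ q; have [mF FO] := HF p.
  rewrite /G /=; case: q HF mF FO lipF => [S|[[i0 r] m]] HF mF FO lipF.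
    case: ifP => [uS EG|_ E0]; last first.
      have -> : E = set0 by apply/seteqP; split.
      exact: area_bounds0.
    apply: (area_bounds_invertible t0 k0 k1 kt uS mE).
    + by move=> x /EG[/FO].
    + move=> x /EG[_ [_ Hx]] a; apply: le_trans k'k; exact/ltW/Hx.
    + move=> x y /EG[Fx _] /EG[Fy _] a; apply: (le_trans (lipF p x y Fx Fy a)).
      by apply: ler_wpM2r.
  case: ifP => [/andP[/eqP r0 /forallP r2] EG|_ E0]; last first.
    have -> : E = set0 by apply/seteqP; split.
    exact: area_bounds0.
  have J0 : (\int[mu]_(x in E) (J x)%:E = 0)%E.
    by apply: integral_jac0 => x /EG[_ []].
  rewrite /area_bounds J0 mule0 add0e; split; last first.
    by rewrite mule_ge0// lee_fin addr_ge0// ltW.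
  have EO : E `<=` Omega1 by move=> x /EG[/FO].
  have Bex0 a : 0 <= B * ex (inr (i0, r, m)) a by rewrite mulr_ge0 ?ltW.
  have := singular_piece oO2 bijf cg gf r0 r2 mE EO Bex0.
  move=> H; apply: (le_trans (H _)).
    by move=> x y /EG[Fx _] /EG[Fy _] a; exact: (lipF p x y Fx Fy a).
  apply: lee_wpmul2r => //; rewrite lee_fin (bigD1 i0)//= eqxx.
  rewrite (eq_bigr (fun=> B * m.+1%:R)) => [|a /negPf ->//].
  rewrite prodr_const (_ : #|_| = n); last first.
    transitivity #|predC1 i0|; first by apply: eq_card => i; rewrite !inE.
    by rewrite cardC1 card_ord.
  rewrite /eps exprMn [B ^+ n.+1]exprS le_eqVlt; apply/orP; left; apply/eqP.
  have b0 : B != 0 by rewrite gt_eqF.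
  have bn : B ^+ n != 0 by rewrite expf_neq0.
  have mn : (m.+1%:R : R) ^+ n != 0 by rewrite expf_neq0.
  have tn : (3 : R) ^+ n.+1 != 0 by rewrite expf_neq0.
  move: (B ^+ n) ((m.+1%:R : R) ^+ n) ((3 : R) ^+ n.+1) bn mn tn => bb mm tt bn mn tn.
  by field; rewrite b0 bn mn tn.
Qed.

End area_formula.

Section area_formula_global.
Context (R : realType) (n : nat).
Local Notation T := 'rV[R]_n.+1.
Local Notation mu := (lebesgue_Rn R n.+1).
Variables (Omega1 Omega2 : set T) (f g : T -> T) (Df : T -> 'M[R]_n.+1).
Hypotheses (oO1 : open Omega1) (oO2 : open Omega2)
  (bijf : set_bij Omega1 Omega2 f) (cf : {within Omega1, continuous f})
  (cg : {within Omega2, continuous g}) (gf : forall x, Omega1 x -> g (f x) = x)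
  (sobf : W11loc Omega1 f Df).

Local Notation J := (jac Df).

Let mfE (E : set T) : measurable E -> E `<=` Omega1 -> measurable (f @` E).
Proof. exact: (measurable_homeo_image oO2 bijf cg gf). Qed.

Let mJ (E : set T) : measurable E -> E `<=` Omega1 -> measurable_fun E (EFin \o J).
Proof. exact: (measurable_jacE oO1 sobf). Qed.

Lemma area_bounds_bigcup (t : R) (E : (set T)^nat) : 0 < t ->
  (forall k, measurable (E k)) -> (forall k, E k `<=` Omega1) ->
  trivIset setT E -> (forall k, area_bounds f Df t (E k)) ->
  area_bounds f Df t (\bigcup_k E k).
Proof.
move=> t0 mE EO tE HE.
have UO : \bigcup_k E k `<=` Omega1 by move=> x [k _]; exact: EO.
have fU : f @` (\bigcup_k E k) = \bigcup_k (f @` E k) by rewrite image_bigcup.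
have tfE : trivIset setT (fun k => f @` E k).
  apply/trivIsetP => i j _ _ ij; apply/seteqP; split=> // y [[x Ex <-] [x' Ex' xx']].
  have x'x : x' = x by rewrite -(gf (EO _ _ Ex')) xx' gf//; exact: EO Ex.
  by move/trivIsetP : tE => /(_ i j I I ij) /seteqP[+ _] => /(_ x); apply; split=> //; rewrite -x'x.
have mufE : (mu (f @` (\bigcup_k E k)) = \sum_(k <oo) mu (f @` E k))%E.
  rewrite fU measure_bigcup//; first by apply: eq_eseriesl => k; rewrite in_setT.
  by move=> k _; exact: mfE.
have muE : (mu (\bigcup_k E k) = \sum_(k <oo) mu (E k))%E.
  by rewrite measure_bigcup//; apply: eq_eseriesl => k; rewrite in_setT.
have intE : (\int[mu]_(x in \bigcup_k E k) (J x)%:E = \sum_(k <oo) \int[mu]_(x in E k) (J x)%:E)%E.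
  apply: ge0_integral_bigcup => //.
  - by apply: mJ => //; exact: bigcupT_measurable.
  - by move=> x _; rewrite lee_fin jac_ge0.
have i0 k : (0 <= \int[mu]_(x in E k) (J x)%:E)%E.
  by apply: integral_ge0 => x _; rewrite lee_fin jac_ge0.
have t1 : 0 <= 1 + t by rewrite addr_ge0// ltW.
rewrite /area_bounds mufE muE intE -!nneseriesZl//; split; last first.
  by apply: lee_nneseries => [k _ _|k _]; [exact: i0|have [_] := HE k].
rewrite -nneseriesD//; last 2 first.
- by move=> k _ _; rewrite mule_ge0// lee_fin.
- by move=> k _ _; rewrite mule_ge0// lee_fin ltW.
by apply: lee_nneseries => [k _ _|k _] //; have [+ _] := HE k.
Qed.

Lemma area_bounds_ae (t : R) : 0 < t -> exists2 Z, measurable Z /\ mu Z = 0%E &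
  forall E, measurable E -> E `<=` Omega1 -> (forall x, E x -> ~ Z x) ->
  area_bounds f Df t E.
Proof.
move=> t0; have [I [G [Z [mG mZ Gcov HG]]]] := area_pieces oO1 oO2 bijf cf cg gf sobf t0.
exists Z => // E mE EO EZ.
pose GN k := if @pickle_inv I k is Some i then G i else set0.
have mGN k : measurable (GN k).
  by rewrite /GN; case: pickle_inv => // i; have [] := mG i.
have boundGN k F : measurable F -> F `<=` GN k -> area_bounds f Df t F.
  rewrite /GN; case: pickle_inv => [i mF FG|mF F0]; first exact: HG FG.
  have -> : F = set0 by apply/seteqP; split.
  exact: area_bounds0.
have EU : E = \bigcup_k (E `&` seqDU GN k).
  rewrite -setI_bigcupr -seqDU_bigcup_eq; apply/seteqP; split=> [x Ex|x []//].
  split=> //; have [i Gx] := Gcov x (EO _ Ex) (EZ _ Ex).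
  by exists (pickle i) => //; rewrite /GN pickleK_inv.
have mD k : measurable (seqDU GN k).
  by apply: measurableD => //; exact: bigsetU_measurable.
rewrite EU; apply: area_bounds_bigcup => //.
- by move=> k; exact: measurableI.
- by move=> k x [/EO].
- by apply: trivIset_setIl; exact: trivIset_seqDU.
- move=> k; apply: (boundGN k); first exact: measurableI.
  by move=> x [_ Ex]; exact: (subset_seqDU Ex).
Qed.

(** Letting [t] tend to [0] in [area_bounds]. The additive error [t * mu E] tends to
    [0] only if [mu E] is finite. A null set has to be left out since its image may
    have positive measure. *)
Lemma area_formula : exists2 Z, measurable Z /\ mu Z = 0%E &
  forall E, measurable E -> E `<=` Omega1 -> (forall x, E x -> ~ Z x) ->
  ((mu E < +oo)%E -> (mu (f @` E) <= \int[mu]_(x in E) (J x)%:E)%E) /\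
  (\int[mu]_(x in E) (J x)%:E <= mu (f @` E))%E.
Proof.
have k0 (k : nat) : 0 < (k.+1%:R^-1 : R) by rewrite invr_gt0.
have /choice[Z HZ] (k : nat) : exists Z, (measurable Z /\ mu Z = 0%E) /\
    forall E, measurable E -> E `<=` Omega1 -> (forall x, E x -> ~ Z x) ->
    area_bounds f Df k.+1%:R^-1 E.
  by have [Z HZ1 HZ2] := area_bounds_ae (k0 k); exists Z.
exists (\bigcup_k Z k); first by apply: null_bigcup => k; have [] := HZ k.
move=> E mE EO EZ.
have bounds k : area_bounds f Df k.+1%:R^-1 E.
  by have [_] := HZ k; apply=> // x Ex Zx; apply: (EZ x Ex); exists k.
set X := mu (f @` E); set Y := (\int[mu]_(x in E) (J x)%:E)%E.
have Y0 : (0 <= Y)%E by apply: integral_ge0 => x _; rewrite lee_fin jac_ge0.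
have X0 : (0 <= X)%E by exact: measure_ge0.
have limit (a b c : R) : 0 <= b -> 0 <= c -> (forall k : nat, a <= (1 + k.+1%:R^-1) * b + k.+1%:R^-1 * c) -> a <= b.
  move=> b0 c0 H; apply/ler_addgt0Pr => e e0.
  have bc : 0 < b + c + 1 by rewrite ltr_wpDl// addr_ge0.
  have [k] := @ltr_add_invr R 0 (e / (b + c + 1)) (divr_gt0 e0 bc); rewrite add0r.
  rewrite ltr_pdivlMr// => ke; apply: (le_trans (H k)).
  have := k0 k; move: ke; move: (k.+1%:R^-1 : R) => d; nra.
split.
  move=> Efin; have [->|Yfin] := eqVneq Y +oo%E; first exact: leey.
  have {}Yfin : Y \is a fin_num by rewrite ge0_fin_numE// ltey.
  have {}Efin : mu E \is a fin_num by rewrite ge0_fin_numE.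
  have Xfin : X \is a fin_num.
    rewrite ge0_fin_numE//; have [H _] := bounds 0%N; apply: (le_lt_trans H).
    by rewrite -/Y -(fineK Yfin) -(fineK Efin) -!EFinM -EFinD ltry.
  rewrite -(fineK Xfin) -(fineK Yfin) lee_fin.
  apply: (limit _ _ (fine (mu E))); [exact: fine_ge0|exact: fine_ge0|].
  move=> k; have [H _] := bounds k; move: H; rewrite -/X -/Y.
  by rewrite -(fineK Xfin) -(fineK Yfin) -(fineK Efin) -!EFinM -EFinD lee_fin.
have [->|Xfin] := eqVneq X +oo%E; first exact: leey.
have {}Xfin : X \is a fin_num by rewrite ge0_fin_numE// ltey.
have Yfin : Y \is a fin_num.
  rewrite ge0_fin_numE//; have [_ H] := bounds 0%N; apply: (le_lt_trans H).
  by rewrite -/X -(fineK Xfin) -EFinM ltry.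
rewrite -(fineK Xfin) -(fineK Yfin) lee_fin.
apply: (limit _ _ 0) => //; first exact: fine_ge0.
move=> k; have [_ H] := bounds k; move: H; rewrite -/X -/Y mulr0 addr0.
by rewrite -(fineK Xfin) -(fineK Yfin) -EFinM lee_fin.
Qed.

End area_formula_global.

(** * Comparison of the two densities *)

Section matrix_norms.
Context (R : realType) (m : nat) (N : 'M[R]_m.+1 -> R) (HN : matrix_norm N).

Lemma matrix_norm0 : N 0 = 0.
Proof. by have [_ NZ _] := HN; rewrite -(scale0r 0) NZ normr0 mul0r. Qed.

Lemma matrix_norm_ge0 A : 0 <= N A.
Proof.
have [_ NZ ND] := HN; have := ND A (-1 *: A).
rewrite scaleN1r subrr matrix_norm0 -scaleN1r NZ normrN1 mul1r; lra.
Qed.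

(** Expanding [A] in the elementary matrices. *)
Lemma matrix_norm_le : exists2 C : R, 0 <= C & forall A, N A <= C * `|A|.
Proof.
have [_ NZ ND] := HN.
exists (\sum_i \sum_j N (delta_mx i j)).
  by apply: sumr_ge0 => i _; apply: sumr_ge0 => j _; exact: matrix_norm_ge0.
move=> A; have Nsum (I : Type) (s : seq I) (F : I -> 'M[R]_m.+1) :
    N (\sum_(i <- s) F i) <= \sum_(i <- s) N (F i).
  elim: s => [|i s IH]; first by rewrite !big_nil matrix_norm0.
  by rewrite !big_cons; apply: (le_trans (ND _ _)); rewrite lerD2l.
rewrite {1}[A]matrix_sum_delta; apply: (le_trans (Nsum _ _ _)).
rewrite mulr_suml; apply: ler_sum => i _; apply: (le_trans (Nsum _ _ _)).
rewrite mulr_suml; apply: ler_sum => j _; rewrite NZ mulrC.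
by apply: ler_wpM2l; [exact: matrix_norm_ge0|exact: coord_mx_le_norm].
Qed.

Lemma continuous_matrix_norm : continuous N.
Proof.
have [_ NZ ND] := HN; have [C C0 HC] := matrix_norm_le.
have C1 : 0 < C + 1 by rewrite ltr_wpDl.
have lipN A B : N A - N B <= (C + 1) * `|A - B|.
  have := ND (A - B) B; rewrite subrK => h1; have := HC (A - B) => h2.
  have := normr_ge0 (A - B); move: h1 h2; move: `|A - B| => q; nra.
move=> A; apply/(@cvgrPdist_le _ _ _ (nbhs A) (nbhs_filter A)) => e e0.
apply/(@nbhs_ballP R 'M[R]_m.+1); exists (e / (C + 1)) => /=; first by rewrite divr_gt0.
move=> B; rewrite mx_norm_ball /ball_ /= => AB.
have CAB : (C + 1) * `|A - B| <= e by rewrite mulrC -ler_pdivlMr// ltW.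
have h1 := lipN A B; have := lipN B A; rewrite (distrC B) => h2.
by rewrite ler_norml; apply/andP; split; lra.
Qed.

Lemma measurable_matrix_norm d (T : measurableType d) (O : set T) (A : T -> 'M[R]_m.+1) :
  measurable O -> (forall i j, measurable_fun O (fun x => A x i j)) ->
  measurable_fun O (fun x => N (A x)).
Proof.
move=> mO mA; apply: (measurableT_comp (f := N)); last exact: measurable_fun_mx.
apply: (measurability _ (RGenOpens.measurableE R)).
move=> _ [_ [a [b ->] <-]]; rewrite setTI; apply: open_measurable_mx.
by apply: open_comp => [x _|]; [exact: continuous_matrix_norm|exact: interval_open].
Qed.

End matrix_norms.

Section density_comparison.
Context (R : realType) (n : nat).
Local Notation T := 'rV[R]_n.+1.
Local Notation mu := (lebesgue_Rn R n.+1).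
Variables (N : 'M[R]_n.+1 -> R) (HN : matrix_norm N) (Omega1 Omega2 : set T)
  (f g : T -> T) (Df : T -> 'M[R]_n.+1) (K : R).
Hypotheses (oO1 : open Omega1) (oO2 : open Omega2)
  (bijf : set_bij Omega1 Omega2 f) (cf : {within Omega1, continuous f})
  (cg : {within Omega2, continuous g}) (gf : forall x, Omega1 x -> g (f x) = x)
  (sobf : W11loc Omega1 f Df) (K0 : 0 < K).

Local Notation J := (jac Df).
Local Notation u := (fun x => N (Df x)).

Let mO1 : measurable Omega1. Proof. exact: open_measurable_mx. Qed.

Let mf : measurable_fun Omega1 f. Proof. exact: continuous_within_measurable. Qed.

Let mfE (E : set T) : measurable E -> E `<=` Omega1 -> measurable (f @` E).
Proof. exact: (measurable_homeo_image oO2 bijf cg gf). Qed.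

Let mJ (E : set T) : measurable E -> E `<=` Omega1 -> measurable_fun E (EFin \o J).
Proof. exact: (measurable_jacE oO1 sobf). Qed.

Let mu0 : measurable_fun Omega1 u.
Proof.
apply: measurable_matrix_norm => // i j; exact: measurable_Df sobf i j.
Qed.

Let mu_ (E : set T) : measurable E -> E `<=` Omega1 -> measurable_fun E (EFin \o u).
Proof. by move=> mE EO; apply/measurable_EFinP; exact: measurable_funS mu0. Qed.

Let u0 x : 0 <= u x. Proof. exact: matrix_norm_ge0. Qed.

(** Integrating the pointwise bound over the preimage of [A], off the exceptional
    null set. The image of what remains lies in [A], so [\int J <= mu (f E)] concludes. *)
Lemma variation_le_of_ae :
  {ae mu, forall x, Omega1 x -> u x <= K * J x} ->
  forall A : set T, measurable A -> A `<=` Omega2 ->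
    (total_variation_measure N Df (Omega1 `&` f @^-1` A) <= K%:E * mu A)%E.
Proof.
move=> [B [mB B0 HB]] A mA AO.
have [Z [mZ Z0] HZ] := area_formula oO1 oO2 bijf cf cg gf sobf.
set E := Omega1 `&` f @^-1` A.
have mE : measurable E by exact: mf.
have EO : E `<=` Omega1 by move=> x [].
pose E' := E `\` (B `|` Z).
have mBZ : measurable (B `|` Z) by exact: measurableU.
have BZ0 : mu (B `|` Z) = 0%E.
  by apply/negligibleP => //; apply: negligibleU; apply/negligibleP.
have mE' : measurable E' by exact: measurableD.
have E'O : E' `<=` Omega1 by move=> x [/EO].
rewrite /total_variation_measure (@ge0_negligible_integral _ _ _ mu _ _ (fun x => (u x)%:E) mBZ mE)//; last 2 first.
- exact: mu_.
- by move=> x _; rewrite lee_fin.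
apply: (@le_trans _ _ (\int[mu]_(x in E') (K * J x)%:E)%E).
  apply: ge0_le_integral => //.
  - by move=> x _; rewrite lee_fin.
  - exact: mu_.
  - apply/measurable_EFinP; apply: measurable_funM; first exact: measurable_cst.
    by apply/measurable_EFinP; exact: mJ.
  move=> x [Ex nBZ]; rewrite lee_fin; apply: contrapT => nx; apply: nBZ; left.
  by apply: HB => /= /(_ (EO _ Ex)).
under eq_integral do rewrite EFinM.
rewrite ge0_integralZl//; [|exact: mJ|by move=> x _; rewrite lee_fin jac_ge0|by rewrite lee_fin ltW].
apply: lee_wpmul2l; first by rewrite lee_fin ltW.
have [|_ H] := HZ E' mE' E'O; first by move=> x [_ nBZ] Zx; apply: nBZ; right.
apply: (le_trans H); apply: le_measure; [apply/mem_set; exact: mfE|exact/mem_set|].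
by move=> _ [x [[_ ?] _] <-].
Qed.

(** On the set [W k] the pointwise bound fails by a definite amount [d k]. Testing
    the hypothesis on its image and using [mu (f W) <= \int J] leaves
    [d k * mu (W k) <= 0]. *)
Lemma ae_of_variation_le :
  (forall A : set T, measurable A -> A `<=` Omega2 ->
    (total_variation_measure N Df (Omega1 `&` f @^-1` A) <= K%:E * mu A)%E) ->
  {ae mu, forall x, Omega1 x -> u x <= K * J x}.
Proof.
move=> HK; have [Z [mZ Z0] HZ] := area_formula oO1 oO2 bijf cf cg gf sobf.
pose d (k : nat) : R := k.+1%:R^-1.
have d0 k : 0 < d k by rewrite invr_gt0.
(* The bounds on [J] and on [x] make the integral of [J] finite, so that it can
   be cancelled. *)
pose W k := (Omega1 `&` [set x | K * J x + d k <= u x /\ J x <= k.+1%:R]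
  `&` ball (0 : T) k.+1%:R) `\` Z.
have WO k : W k `<=` Omega1 by move=> x [[[]]].
have mJ0 : measurable_fun Omega1 J by exact: measurable_jac sobf.
have mW k : measurable (W k).
  apply: measurableD => //; apply: measurableI; last exact: measurable_ball_mx.
  pose v x := u x - (K * J x + d k).
  rewrite (_ : _ `&` _ = (Omega1 `&` v @^-1` `[0, +oo[) `&`
                         (Omega1 `&` J @^-1` `]-oo, k.+1%:R])).
    apply: measurableI; last exact: mJ0.
    suff : measurable_fun Omega1 v by apply.
    apply: measurable_funB => //; apply: measurable_funD => //.
    by apply: measurable_funM => //.
  apply/seteqP; split=> x /=; rewrite !in_itv /= /v andbT subr_ge0.
    by move=> [Ox [H1 H2]].
  by move=> [[Ox H1] [_ H2]].
have W0 k : mu (W k) = 0%E.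
  have Wfin : (mu (W k) < +oo)%E.
    apply: (@le_lt_trans _ _ (mu (ball (0 : T) k.+1%:R))).
      apply: le_measure; [apply/mem_set; exact: mW|apply/mem_set; exact: measurable_ball_mx|].
      by move=> x [[]].
    by rewrite lebesgue_Rn_ball// ltry.
  have [|H _] := HZ _ (mW k) (@WO k); first by move=> x [_].
  have {}H := H Wfin.
  have fWK : Omega1 `&` f @^-1` (f @` W k) = W k.
    apply/seteqP; split=> [x [Ox [y Wy fxy]]|x Wx]; last by split; [exact: WO Wx|exists x].
    by rewrite -(gf Ox) -fxy gf//; exact: WO Wy.
  have fWO : f @` W k `<=` Omega2.
    by move=> _ [x Wx <-]; case: bijf => + _ _; apply; exact: WO Wx.
  have := HK _ (mfE (mW k) (@WO k)) fWO; rewrite fWK /total_variation_measure => HuW.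
  set X := (\int[mu]_(x in W k) (J x)%:E)%E.
  have X0 : (0 <= X)%E by apply: integral_ge0 => x _; rewrite lee_fin jac_ge0.
  have mKJ : measurable_fun (W k) (fun x => (K * J x)%:E).
    apply/measurable_EFinP; apply: measurable_funM; first exact: measurable_cst.
    by apply/measurable_EFinP; exact: mJ.
  have Xfin : X \is a fin_num.
    rewrite ge0_fin_numE//; apply: (@le_lt_trans _ _ (\int[mu]_(x in W k) (cst k.+1%:R%:E) x)%E).
      apply: ge0_le_integral => //.
      - by move=> x _; rewrite lee_fin jac_ge0.
      - exact: mJ.
      - by move=> x [[[_ [_ H2]] _] _]; rewrite lee_fin.
    by rewrite integral_cst//= lte_mul_pinfty.
  have low : (K%:E * X + (d k)%:E * mu (W k) <= \int[mu]_(x in W k) (u x)%:E)%E.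
    rewrite -integral_cst// -ge0_integralZl//; last 3 first.
    - exact: mJ.
    - by move=> x _; rewrite lee_fin jac_ge0.
    - by rewrite lee_fin ltW.
    rewrite -ge0_integralD//; last 2 first.
    - by move=> x _; rewrite lee_fin mulr_ge0 ?jac_ge0// ltW.
    - by move=> x _; rewrite lee_fin ltW.
    apply: ge0_le_integral => //.
    - by move=> x _; rewrite -EFinD lee_fin addr_ge0 ?(ltW (d0 _))// mulr_ge0 ?jac_ge0// ltW.
    - exact: emeasurable_funD.
    - exact: mu_.
    - by move=> x [[[_ [H1 _]] _] _]; rewrite -EFinM -EFinD lee_fin.
  have up : (K%:E * X + (d k)%:E * mu (W k) <= K%:E * X)%E.
    apply: (le_trans low); apply: (le_trans HuW); apply: lee_wpmul2l => //.
    by rewrite lee_fin ltW.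
  have {}Wfin : mu (W k) \is a fin_num by rewrite ge0_fin_numE.
  have m0 : 0 <= fine (mu (W k)) by exact: fine_ge0.
  move: up; rewrite -(fineK Wfin) -(fineK Xfin) -!EFinM -EFinD lee_fin => up.
  congr EFin; have := d0 k; move: up m0; move: (fine _) (fine _) (d k) => a b c; nra.
have [mV V0] : measurable (\bigcup_k W k) /\ mu (\bigcup_k W k) = 0%E.
  exact: null_bigcup.
have neg : mu.-negligible (Z `|` \bigcup_k W k).
  by apply: negligibleU; apply/negligibleP.
apply: negligibleS neg => x /= /not_implyP[Ox /negP]; rewrite -ltNge => ux.
have [Zx|nZx] := pselect (Z x); [by left|right].
have [k1 Hk1] := @ltr_add_invr R _ _ ux.
pose k2 := Num.truncn (J x); pose k3 := Num.truncn `|x|.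
pose k := maxn k1 (maxn k2 k3).
have le1 (i : nat) : (i <= k)%N -> (i.+1%:R : R) <= k.+1%:R by rewrite ler_nat.
have l1 : (k1 <= k)%N by rewrite leq_maxl.
have l2 : (k2 <= k)%N by rewrite leq_max leq_maxl orbT.
have l3 : (k3 <= k)%N by rewrite leq_max (leq_maxr k2) orbT.
exists k => //; split=> //; split; last first.
  by rewrite mx_norm_ball /ball_ /= sub0r normrN; exact: lt_le_trans (truncnS_gt _) (le1 _ l3).
split=> //; split; last exact: ltW (lt_le_trans (truncnS_gt _) (le1 _ l2)).
apply: (le_trans _ (ltW Hk1)); rewrite lerD2l /d lef_pV2 ?posrE//; exact: le1.
Qed.

End density_comparison.

Theorem corollary4p6 (R : realType) (n : nat) (N : 'M[R]_n -> R)
    (HN : matrix_norm N)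
    (Omega1 Omega2 : set 'rV[R]_n) (f : 'rV[R]_n -> 'rV[R]_n)
    (Df : 'rV[R]_n -> 'M[R]_n) (K : R)
    (oOmega1 : open Omega1) (oOmega2 : open Omega2)
    (homeof : homeo_onto Omega1 Omega2 f)
    (sobf : W11loc Omega1 f Df)
    (K0 : 0 < K) :
  (forall A : set 'rV[R]_n, measurable A -> A `<=` Omega2 ->
     (total_variation_measure N Df (Omega1 `&` f @^-1` A)
      <= K%:E * lebesgue_Rn R n A)%E)
  <->
  {ae lebesgue_Rn R n, forall x, Omega1 x ->
     N (Df x) <= K * `|\det (Df x)|}.
Proof.
case: n N HN Omega1 Omega2 f Df oOmega1 oOmega2 homeof sobf =>
  [|n] N HN O1 O2 f Df oO1 oO2 homeof sobf.
  have NZ A : N A = 0.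
    have [_ NZ _] := HN; rewrite (_ : A = 0 *: A); first by rewrite NZ normr0 mul0r.
    by apply/matrixP => -[].
  split=> _.
    by apply: aeW => x _; rewrite NZ mulr_ge0// ltW.
  move=> A mA _; rewrite /total_variation_measure integral0_eq; last by move=> x _; rewrite NZ.
  by rewrite mule_ge0// lee_fin ltW.
have [bijf cf [g cg gf]] := homeof.
split; [exact: (ae_of_variation_le HN oO1 oO2 bijf cf cg gf sobf K0)|].
exact: (variation_le_of_ae HN oO1 oO2 bijf cf cg gf sobf K0).
Qed.
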